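(* Suppose $\mathcal{G}$ is a two-node graph with $q_{ij}\equiv1$ and $\Omega=\mathbb{R}$ (so $d=1$, $n=2$), and let $Q:=\max_i\sum_jq_{ij}$. Then there exist interpolation functions $\theta$ satisfying (A1)–(A7) so that: (i) for each pair of inequalities (each comparison of consecutive terms) in $$\min\{1,Q^{-1/2}\}\,d_{BL}(\boldsymbol{\mu},\boldsymbol{\nu})\le W_{\mathbb{R}\times\mathcal{G}}(\boldsymbol{\mu},\boldsymbol{\nu})\le D_{\mathbb{R}\times\mathcal{G}}(\boldsymbol{\mu},\boldsymbol{\nu})\le W_{2,\mathcal{W}}(\boldsymbol{\mu},\boldsymbol{\nu}),\qquad\boldsymbol{\mu},\boldsymbol{\nu}\in\mathcal{P}_2(\mathbb{R}\times\mathcal{G}),$$ the constants are sharp and there exist measures for which strict inequality holds; (ii) $D_{\mathbb{R}\times\mathcal{G}}$ fails to satisfy the triangle inequality.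
   Context: Interpolation function. Assumptions on $\theta:[0,\infty)\times[0,\infty)\to[0,\infty)$: (A1) $\theta$ is continuous on $[0,\infty)^2$ and $C^\infty$ on $(0,\infty)^2$; (A2) $\theta(t,s)=\theta(s,t)$; (A3) $\theta>0$ on $(0,\infty)^2$; (A4) $\theta(1,1)=1$; (A5) $\theta(r,t)\le\theta(s,t)$ for $t\ge0$, $0\le r\le s$; (A6) $\theta(\lambda t,\lambda s)=\lambda\theta(t,s)$ for $\lambda>0$, $t,s\ge0$; (A7) $\theta$ is concave. Graph. $\mathcal{G}$ has nodes $\{1,\dots,n\}$ and symmetric edge weights $q_{ij}\ge0$, $i,j=1,\dots,n$. Below $d=1$, $n=2$, $\Omega=\mathbb{R}$. Vector valued measures. $\mathcal{P}(\Omega\times\mathcal{G})$ is the set of $\boldsymbol{\mu}=[\mu_1,\dots,\mu_n]^t$ with $\mu_i$ finite nonnegative Borel measures on $\Omega$ and $\sum_i\mu_i(\Omega)=1$, with the topology of componentwise narrow convergence; $\bar\mu:=\sum_i\mu_i$. $\mathcal{P}_2(\Omega\times\mathcal{G})$ is the subset with $\int_\Omega|x|^2d\mu_i<\infty$ for all $i$. Bounded Lipschitz distance. $\|\eta\|_{W^{1,\infty}_2}:=(\|\eta\|_{L^\infty(\mathbb{R}^d)}^2+\|\nabla\eta\|_{L^\infty(\mathbb{R}^d)}^2)^{1/2}$, $\|\sigma\|_{BL}:=\sup\{\int\eta\,d\sigma:\eta\in C_c^\infty(\mathbb{R}^d),\|\eta\|_{W_2^{1,\infty}}\le1\}$, and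 $d_{BL}(\boldsymbol{\mu},\boldsymbol{\nu}):=(\sum_i\|\mu_i-\nu_i\|_{BL}^2)^{1/2}$. Vector valued continuity equation. $(\boldsymbol{\rho},\mathbf{u},\boldsymbol{v})$ is a solution on $[t_0,t_1]$ if: (i) $\boldsymbol{\rho}\in C([t_0,t_1];\mathcal{P}(\Omega\times\mathcal{G}))$; (ii) $\mathbf{u}=[u_i]_{i=1}^n:\mathbb{R}^d\times[t_0,t_1]\to(\mathbb{R}^d)^n$ is measurable with $\int_{t_0}^{t_1}\int_\Omega|u_{i,t}|\,d\rho_{i,t}\,dt<\infty$ for all $i$; (iii) $\boldsymbol{v}=[v_{ij}]:\mathbb{R}^d\times[t_0,t_1]\to\mathbb{R}^{n\times n}$ is measurable with $\int_{t_0}^{t_1}\int_\Omega|v_{ij,t}|\,\theta(\frac{d\rho_{i,t}}{d\bar\rho_t},\frac{d\rho_{j,t}}{d\bar\rho_t})\,d\bar\rho_t\,dt<\infty$ for all $i,j$; (iv) for all $\eta\in C_c^\infty(\mathbb{R}^d\times(t_0,t_1))$ and all $i$, $$\int_{t_0}^{t_1}\!\!\int\partial_t\eta\,d\rho_{i,t}dt=-\int_{t_0}^{t_1}\!\!\int\nabla\eta\cdot u_{i,t}\,d\rho_{i,t}dt-\frac12\sum_{j=1}^n\int_{t_0}^{t_1}\!\!\int\eta\,\theta\Big(\frac{d\rho_{i,t}}{d\bar\rho_t},\frac{d\rho_{j,t}}{d\bar\rho_t}\Big)(v_{ij,t}-v_{ji,t})q_{ij}\,d\bar\rho_t\,dt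 .$$ $\mathcal{C}(\boldsymbol{\mu},\boldsymbol{\nu})$ is the set of solutions on $[0,1]$ with $\boldsymbol{\rho}_0=\boldsymbol{\mu}$, $\boldsymbol{\rho}_1=\boldsymbol{\nu}$. Dynamic distance. $\|(\mathbf{u},\boldsymbol{v})\|^2_{\boldsymbol{\rho}}:=\sum_i\int_\Omega|u_i|^2d\rho_i+\frac12\sum_{i,j}\int_\Omega|v_{ij}|^2\theta(\frac{d\rho_i}{d\bar\rho},\frac{d\rho_j}{d\bar\rho})q_{ij}\,d\bar\rho$ and $W^2_{\Omega\times\mathcal{G}}(\boldsymbol{\mu},\boldsymbol{\nu}):=\inf\{\int_0^1\|(\mathbf{u}_t,\boldsymbol{v}_t)\|^2_{\boldsymbol{\rho}_t}dt:(\boldsymbol{\rho},\mathbf{u},\boldsymbol{v})\in\mathcal{C}(\boldsymbol{\mu},\boldsymbol{\nu})\}$. Graph Wasserstein metric. $\mathcal{P}(\mathcal{G})=\{p\in\mathbb{R}^n:p_i\ge0,\sum_ip_i=1\}$. A pair $(p,v)$ solves the graph continuity equation on $[0,1]$ if $p:[0,1]\to\mathcal{P}(\mathcal{G})$ is continuous, $v:[0,1]\to\mathbb{R}^{n\times n}$ is measurable, $t\mapsto\theta(p_{i,t},p_{j,t})v_{ij,t}$ is locally integrable on $(0,1)$ for all $i,j$, and $\partial_tp_i=\frac12\sum_j\theta(p_i,p_j)(v_{ij}-v_{ji})q_{ij}$ in the sense of distributions for all $i$. Then $W_\mathcal{G}^2(p_0,p_1)$ is the infimum of $\int_0^1\frac12\sum_{i,j}v_{ij,t}^2\theta(p_{i,t},p_{j,t})q_{ij}\,dt$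 over all such $(p,v)$ with endpoints $p_0,p_1$. Lifted space. $\Delta^{1}=[0,1]$, $\mathbf{p}(r)=[p_1(r),p_2(r)]:=[r,1-r]\in\mathcal{P}(\mathcal{G})$, $d_{[0,1]}(r,\tilde r):=W_\mathcal{G}(\mathbf{p}(r),\mathbf{p}(\tilde r))$, and $d^2_{\mathbb{R}\times[0,1]}((x,r),(\tilde x,\tilde r)):=|x-\tilde x|^2+d^2_{[0,1]}(r,\tilde r)$. $W_{\mathbb{R}\times[0,1]}$ is the 2-Wasserstein (Kantorovich) distance on probability measures on $\mathbb{R}\times[0,1]$ with ground distance $d_{\mathbb{R}\times[0,1]}$. The projection $\mathfrak{P}:\mathcal{P}(\mathbb{R}\times[0,1])\to\mathcal{P}(\mathbb{R}\times\mathcal{G})$ is given by $\int\eta\,d(\mathfrak{P}\lambda)_j=\int p_j(r)\eta(x)\,d\lambda(x,r)$ for all bounded continuous $\eta$, $j=1,2$. The canonical lifting of $\boldsymbol{\mu}$ is $\lambda_{\boldsymbol{\mu}}:=\mu_1\otimes\delta_1+\mu_2\otimes\delta_0$. Static quantities. $D_{\mathbb{R}\times\mathcal{G}}(\boldsymbol{\mu},\boldsymbol{\nu}):=\inf\{W_{\mathbb{R}\times[0,1]}(\lambda_1,\lambda_2):\mathfrak{P}\lambda_1=\boldsymbol{\mu},\ \mathfrak{P}\lambda_2=\boldsymbol{\nu}\}$ and $W_{2,\mathcal{W}}(\boldsymbol{\mu},\boldsymbol{\nu}):=W_{\mathbb{R}\times[0,1]}(\lambda_{\boldsymbol{\mu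}},\lambda_{\boldsymbol{\nu}})$.
   Formalization: The weights q_ij≡1 are taken only for i≠j, with q_11=q_22=0, so Q=1 and the first constant is 1; with q_ii=1 one gets Q=2 and constant 1/√2, which is not sharp since d_BL ≤ W holds for every admissible θ. *)

(* Defs.v *)
From HB Require Import structures.
From mathcomp Require Import all_boot all_order all_algebra.
From mathcomp Require Import all_classical all_reals all_analysis.

Set Implicit Arguments.
Unset Strict Implicit.
Unset Printing Implicit Defensive.

Import Order.TTheory GRing.Theory Num.Theory.
Import numFieldNormedType.Exports.

Local Open Scope classical_set_scope.
Local Open Scope ring_scope.

Section smooth_functions.
Context {R : realType} {V : normedModType R}.

(* [f] is C^k on the open set [U]: all iterated directional derivatives of
   order at most [k] exist and are continuous on [U]. *)
Fixpoint Ck_on (U : set V) (k : nat) (f : V -> R) : Prop :=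
  (forall x, U x -> {for x, continuous f}) /\
  if k is k'.+1 then
    forall v : V, (forall x, U x -> derivable f x v) /\ Ck_on U k' ('D_v f)
  else True.

Definition smooth_on (U : set V) (f : V -> R) : Prop := forall k, Ck_on U k f.

(* C_c^oo(U), each function being extended by zero to the whole space. *)
Definition test_function (U : set V) (f : V -> R) : Prop :=
  [/\ smooth_on setT f, compact (closure [set x | f x != 0]) &
      closure [set x | f x != 0] `<=` U].

End smooth_functions.

Section interpolation.
Context {R : realType}.

Definition nneg_quadrant : set (R * R) := [set z | 0 <= z.1 /\ 0 <= z.2].
Definition pos_quadrant : set (R * R) := [set z | 0 < z.1 /\ 0 < z.2].

(* A function [0,oo)^2 -> [0,oo) is a total function [theta] whose values
   outside the nonnegative quadrant are irrelevant. *)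
Record interpolation_function (theta : R -> R -> R) : Prop := {
  theta_ge0 : forall s t, 0 <= s -> 0 <= t -> 0 <= theta s t ;
  theta_continuous :
    {within nneg_quadrant, continuous (fun z : R * R => theta z.1 z.2)} ;
  theta_smooth : smooth_on pos_quadrant (fun z : R * R => theta z.1 z.2) ;
  theta_sym : forall s t, 0 <= s -> 0 <= t -> theta t s = theta s t ;
  theta_gt0 : forall s t, 0 < s -> 0 < t -> 0 < theta s t ;
  theta11 : theta 1 1 = 1 ;
  theta_monotone : forall r s t, 0 <= t -> 0 <= r -> r <= s ->
    theta r t <= theta s t ;
  theta_homogeneous : forall l s t, 0 < l -> 0 <= s -> 0 <= t ->
    theta (l * t) (l * s) = l * theta t s ;
  theta_concave : forall l s t s' t', 0 <= l -> l <= 1 ->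
    0 <= s -> 0 <= t -> 0 <= s' -> 0 <= t' ->
    l * theta s t + (1 - l) * theta s' t'
      <= theta (l * s + (1 - l) * s') (l * t + (1 - l) * t') }.

End interpolation.

Section vector_measures.
Context {R : realType} {n : nat}.

Record vprob := VProb {
  vcomp :> 'I_n -> {finite_measure set (measurableTypeR R) -> \bar R} ;
  vcomp_mass : (\sum_(i < n) vcomp i setT = 1)%E }.

Definition vbar (mu : vprob) (A : set (measurableTypeR R)) : \bar R :=
  (\sum_(i < n) mu i A)%E.

Section vbar_measure.
Variable mu : vprob.

Let vbar0 : vbar mu set0 = 0%E.
Proof. by rewrite /vbar big1. Qed.

Let vbar_ge0 A : (0 <= vbar mu A)%E.
Proof. by apply: sume_ge0 => i _; exact: measure_ge0. Qed.

Let vbar_sigma_additive : semi_sigma_additive (vbar mu).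
Proof.
move=> F mF tF mUF.
rewrite [X in X @ \oo --> _](_ : _ =
    (fun k => \sum_(i < n) \sum_(0 <= j < k) mu i (F j))%E); last first.
  by apply/funext => k; rewrite exchange_big.
apply: cvg_nnesum => [i _|i _]; last exact: measure_semi_sigma_additive.
by apply: nearW => k; apply: sume_ge0 => j _; exact: measure_ge0.
Qed.

HB.instance Definition _ := isMeasure.Build _ _ _ (vbar mu)
  vbar0 vbar_ge0 vbar_sigma_additive.

Let vbar_finite : fin_num_fun (vbar mu).
Proof.
by move=> A mA; rewrite /vbar sum_fin_num; apply/allP => x /mapP[i _ ->];
  exact: fin_num_measure.
Qed.

HB.instance Definition _ := Measure_isFinite.Build _ _ _ (vbar mu) vbar_finite.

End vbar_measure.

Lemma vcomp_dominates (mu : vprob) (i : 'I_n) : mu i `<< vbar mu.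
Proof.
apply/null_content_dominatesP => A mA; rewrite /vbar => /eqP.
by rewrite seq_psume_eq0// => /allP /(_ i (mem_index_enum _)) /eqP.
Qed.

(* The density d mu_i / d bar(mu); by [vcomp_dominates] it is the genuine
   derivative, and this version is nonnegative and finite everywhere, so that
   [theta] is only ever evaluated on the nonnegative quadrant. *)
Definition vdens (mu : vprob) (i : 'I_n) (x : R) : R :=
  fine (Radon_Nikodym_SigmaFinite.f (mu i) (vbar mu) x).

(* The values of a measure on nonmeasurable sets carry no information. *)
Definition vprob_eq (mu nu : vprob) : Prop :=
  forall i (A : set (measurableTypeR R)), measurable A -> mu i A = nu i A.

Definition P2 (mu : vprob) : Prop :=
  forall i, (\int[mu i]_x (x ^+ 2)%:E < +oo)%E.

End vector_measures.
Arguments vprob : clear implicits.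

Section bounded_lipschitz.
Context {R : realType} {n : nat}.
Local Open Scope ereal_scope.

Definition W12oo_norm (eta : R -> R) : \bar R :=
  sqrte (Lnorm (@lebesgue_measure R) +oo (EFin \o eta) ^+ 2 +
         Lnorm (@lebesgue_measure R) +oo (EFin \o eta^`()%classic) ^+ 2).

(* ||mu - nu||_BL for finite nonnegative measures *)
Definition BL_norm (mu nu : {finite_measure set (measurableTypeR R) -> \bar R})
    : \bar R :=
  ereal_sup [set ((\int[mu]_x eta x) - (\int[nu]_x eta x))%R%:E | eta in
    [set eta : R -> R | test_function setT eta /\ W12oo_norm eta <= 1]].

Definition d_BL (mu nu : vprob R n) : \bar R :=
  sqrte (\sum_(i < n) BL_norm (mu i) (nu i) ^+ 2).

End bounded_lipschitz.

Section dynamic_distance.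
Context {R : realType} {n : nat}.
Variables (q : 'I_n -> 'I_n -> R) (theta : R -> R -> R).

Definition narrow_continuous (t0 t1 : R) (rho : R -> vprob R n) : Prop :=
  forall (i : 'I_n) (eta : R -> R), continuous eta -> bounded_fun eta ->
    {within `[t0, t1], continuous (fun t => \int[rho t i]_x eta x)}.

Definition vtheta (mu : vprob R n) (i j : 'I_n) (x : R) : R :=
  theta (vdens mu i x) (vdens mu j x).

(* [u i t x] and [v i j t x] stand for u_{i,t}(x) and v_{ij,t}(x); test
   functions are functions of (x, t). *)
Record continuity_equation (t0 t1 : R) (rho : R -> vprob R n)
    (u : 'I_n -> R -> R -> R) (v : 'I_n -> 'I_n -> R -> R -> R) : Prop := {
  ce_continuous : narrow_continuous t0 t1 rho ;
  ce_measurable_u : forall i,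
    measurable_fun ([set: measurableTypeR R] `*` (`[t0, t1] : set (measurableTypeR R)))
      (fun z : measurableTypeR R * measurableTypeR R => u i z.2 z.1) ;
  ce_integrable_u : forall i,
    (\int[lebesgue_measure]_(t in `[t0, t1])
       \int[rho t i]_x `|u i t x|%:E < +oo)%E ;
  ce_measurable_v : forall i j,
    measurable_fun ([set: measurableTypeR R] `*` (`[t0, t1] : set (measurableTypeR R)))
      (fun z : measurableTypeR R * measurableTypeR R => v i j z.2 z.1) ;
  ce_integrable_v : forall i j,
    (\int[lebesgue_measure]_(t in `[t0, t1])
       \int[vbar (rho t)]_x (`|v i j t x| * vtheta (rho t) i j x)%:E
         < +oo)%E ;
  ce_weak : forall (eta : R * R -> R) (i : 'I_n),
    test_function ([set: R] `*` `]t0, t1[) eta ->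
    \int[lebesgue_measure]_(t in `[t0, t1])
      \int[rho t i]_x 'D_((0, 1) : R * R) eta (x, t) =
    - (\int[lebesgue_measure]_(t in `[t0, t1])
         \int[rho t i]_x ('D_((1, 0) : R * R) eta (x, t) * u i t x))
    - 2^-1 * (\sum_(j < n) \int[lebesgue_measure]_(t in `[t0, t1])
         \int[vbar (rho t)]_x (eta (x, t) * vtheta (rho t) i j x *
           (v i j t x - v j i t x) * q i j)) }.

Definition action (mu : vprob R n) (u : 'I_n -> R -> R)
    (v : 'I_n -> 'I_n -> R -> R) : \bar R :=
  ((\sum_(i < n) \int[mu i]_x (u i x ^+ 2)%:E) +
   (2^-1)%:E * (\sum_(i < n) \sum_(j < n)
     \int[vbar mu]_x (v i j x ^+ 2 * vtheta mu i j x * q i j)%:E))%E.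

Definition W_dyn (mu nu : vprob R n) : \bar R :=
  sqrte (ereal_inf [set e : \bar R | exists rho u v,
    [/\ continuity_equation 0 1 rho u v,
        vprob_eq (rho 0) mu, vprob_eq (rho 1) nu &
        e = (\int[lebesgue_measure]_(t in `[0%R, 1%R])
               action (rho t) (fun i => u i t) (fun i j => v i j t))%E]]).

End dynamic_distance.

Section graph_distance.
Context {R : realType} {n : nat}.
Variables (q : 'I_n -> 'I_n -> R) (theta : R -> R -> R).

Definition simplex : set ('I_n -> R) :=
  [set p | (forall i, 0 <= p i) /\ \sum_(i < n) p i = 1].

Record graph_continuity_equation (p : R -> 'I_n -> R)
    (v : R -> 'I_n -> 'I_n -> R) : Prop := {
  gce_simplex : forall t : R, 0 <= t <= 1 -> simplex (p t) ;
  gce_continuous : forall i, {within `[0, 1], continuous (fun t => p t i)} ;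
  gce_measurable : forall i j,
    measurable_fun (`[0, 1] : set (measurableTypeR R)) (fun t => v t i j) ;
  gce_integrable : forall i j,
    locally_integrable (`]0, 1[) (fun t => theta (p t i) (p t j) * v t i j) ;
  gce_weak : forall (eta : R -> R) (i : 'I_n), test_function (`]0, 1[ : set R) eta ->
    \int[lebesgue_measure]_(t in `[0, 1]) (eta^`()%classic t * p t i) =
    - (\int[lebesgue_measure]_(t in `[0, 1])
         (eta t * (2^-1 * \sum_(j < n)
            theta (p t i) (p t j) * (v t i j - v t j i) * q i j))) }.

Definition W_graph (p0 p1 : 'I_n -> R) : \bar R :=
  sqrte (ereal_inf [set e : \bar R | exists p v,
    [/\ graph_continuity_equation p v, p 0 =1 p0, p 1 =1 p1 &
        e = (\int[lebesgue_measure]_(t in `[0%R, 1%R])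
          (2^-1 * \sum_(i < n) \sum_(j < n)
             v t i j ^+ 2 * theta (p t i) (p t j) * q i j)%R%:E)%E]]).

End graph_distance.

Section static_quantities.
Context {R : realType}.
Variables (q : 'I_2 -> 'I_2 -> R) (theta : R -> R -> R).

(* Nodes 1 and 2 are [ord0] and [ord_max]. *)
Definition simplex_param (r : R) (i : 'I_2) : R :=
  if i == ord0 then r else 1 - r.

Definition d_interval (r s : R) : \bar R :=
  W_graph q theta (simplex_param r) (simplex_param s).

Local Notation RxR := (measurableTypeR R * measurableTypeR R)%type.

Definition strip : set RxR := [set z | 0 <= z.2 <= 1].

(* Probability measures on R x [0,1] are the probability measures on R x R
   that give full mass to the strip. *)
Definition lifted (lam : probability RxR R) : Prop := lam strip = 1%E.

Definition coupling (lam1 lam2 : {measure set RxR -> \bar R})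
    (gam : probability (RxR * RxR)%type R) : Prop :=
  forall A : set RxR, measurable A ->
    gam (fst @^-1` A) = lam1 A /\ gam (snd @^-1` A) = lam2 A.

Definition W_lifted (lam1 lam2 : {measure set RxR -> \bar R}) : \bar R :=
  sqrte (ereal_inf
    [set (\int[gam]_z (((z.1.1 - z.2.1) ^+ 2)%R%:E +
                       d_interval z.1.2 z.2.2 ^+ 2))%E |
      gam in coupling lam1 lam2]).

Definition lift_of (mu : vprob R 2) (lam : probability RxR R) : Prop :=
  lifted lam /\
  forall (eta : R -> R) (j : 'I_2), continuous eta -> bounded_fun eta ->
    \int[mu j]_x eta x = \int[lam]_z (simplex_param z.2 j * eta z.1).

Definition D_static (mu nu : vprob R 2) : \bar R :=
  ereal_inf [set e : \bar R | exists lam1 lam2 : probability RxR R,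
    [/\ lift_of mu lam1, lift_of nu lam2 & e = W_lifted lam1 lam2]].

Definition canonical_lifting (mu : vprob R 2) : {measure set RxR -> \bar R} :=
  measure_add (mu ord0 \x (\d_(1%R : measurableTypeR R)))%E
              (mu ord_max \x (\d_(0%R : measurableTypeR R)))%E.

Definition W_2W (mu nu : vprob R 2) : \bar R :=
  W_lifted (canonical_lifting mu) (canonical_lifting nu).

End static_quantities.

Section sharpness.
Context {R : realType} {n : nat}.
Local Open Scope ereal_scope.

(* [c * A <= B] holds on P_2 and [c] is the largest such constant. *)
Definition sharp_inequality (c : R) (A B : vprob R n -> vprob R n -> \bar R)
    : Prop :=
  (forall mu nu, P2 mu -> P2 nu -> c%:E * A mu nu <= B mu nu) /\
  (forall c' : R,
    (forall mu nu, P2 mu -> P2 nu -> c'%:E * A mu nu <= B mu nu) ->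
    (c' <= c)%R).

Definition strict_somewhere (c : R) (A B : vprob R n -> vprob R n -> \bar R)
    : Prop :=
  exists mu nu, [/\ P2 mu, P2 nu & c%:E * A mu nu < B mu nu].

Definition triangle_inequality (d : vprob R n -> vprob R n -> \bar R) : Prop :=
  forall mu nu sigma, P2 mu -> P2 nu -> P2 sigma ->
    d mu sigma <= d mu nu + d nu sigma.

End sharpness.

Section two_node_graph.
Context {R : realType}.

Definition max_degree {n : nat} (q : 'I_n -> 'I_n -> R) : R :=
  \big[Num.max/0]_(i < n) \sum_(j < n) q i j.

(* Unit weight on the edge joining the two nodes and no self-loops, so that
   the maximal degree is 1. A weight q_ii > 0 would not change any of the
   distances: it cancels in the continuity equations and only adds to the
   action. It would only increase the maximal degree. *)
Definition two_node_weight (i j : 'I_2) : R := (i != j)%:R.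

End two_node_graph.

(* Main.v *)
(* With theta the arithmetic mean, theta (d rho_1 / d rhobar, d rho_2 / d rhobar)
   is 1/2 almost everywhere, since the two densities add up to 1. The continuity
   equation becomes linear in the exchange rate, and d_[0,1] (r, s) equals
   sqrt 2 |r - s|.

   For d_BL <= W one tests the weak equation with eta (x) phi (t), lets phi tend
   to the indicator of [0, 1], and applies the Cauchy-Schwarz inequality. For
   W <= D, a coupling of two lifts moves particles along segments of R x [0, 1];
   conditioning the velocities on the space-time position yields an admissible
   curve whose energy is at most the transport cost. The last inequality
   holds because the canonical lifting is a lift.

   All four quantities equal sqrt 2 for [delta_0, 0] and [0, delta_0], hence the
   sharpness. Strictness in the first inequality occurs for two distant Dirac
   masses on the same node, since d_BL is bounded there. For the rest let
   mu = [delta_(-a), delta_a] / 2, nu = [delta_0, delta_0] / 2 and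
   sigma = [delta_0, 0] with a small. Every lift of mu has r in {0, 1} almost
   surely, so that D (mu, sigma) >= 1, but letting the two particles meet before
   they exchange mass gives W (mu, sigma) < 1. On the other hand nu lifts to
   delta_(0, 1/2), so that D (nu, sigma) <= 1 / sqrt 2 < 1 <= W_2W (nu, sigma),
   and D (mu, nu) <= a: the triangle inequality fails. *)
Require Import Defs.
From HB Require Import structures.
From mathcomp Require Import all_boot all_order all_algebra.
From mathcomp Require Import all_classical all_reals all_analysis.
From mathcomp Require Import measurable_realfun ess_sup_inf.
From mathcomp Require Import ring lra.

Set Implicit Arguments.
Unset Strict Implicit.
Unset Printing Implicit Defensive.

Import Order.TTheory GRing.Theory Num.Theory.
Import numFieldNormedType.Exports.

Local Open Scope classical_set_scope.
Local Open Scope ring_scope.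

(** * Smooth functions and cutoffs *)

(** The two bounds on the dynamic distance meet different obstacles. From below, integrals against
    [rho t] need not be measurable in t, so only facts that survive for lower integrals are
    available: monotonicity, scaling, superadditivity, and a Cauchy-Schwarz inequality obtained
    through measurable minorants. From above, no disintegration of the coupling over space-time
    positions is constructed. Duality replaces it: if 2 int |f| g(Phi) dP <= C + int g^2 dm for all
    bounded measurable g >= 0, then Radon-Nikodym and truncation yield a density U of the image of f
    P with int U^2 dm <= C.

    The constants agree because of one computation. With theta = 1/2, mass moves at rate (v_12 -
    v_21) / 4, which is cheapest for v_12 = - v_21 = 2 S: rate S, cost 2 S^2. This coefficient 2
    appears in the graph distance, in the energy of the particle paths and in the dual bound.

    Measurability of the distance on [0,1] in its two arguments is never established. Transport
    costs are estimated from below by measurable functions and from above only at atoms. *)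

Section Ck_closure.
Context {R : realType} {V : normedModType R}.
Implicit Types (f g : V -> R) (U : set V).

Lemma Ck_onW U k f : Ck_on U k.+1 f -> Ck_on U k f.
Proof.
elim: k f => [|k IH] f [cf /= df]; first by split.
by split=> // v; have [dfv Cf] := df v; split => //; exact: IH.
Qed.

Lemma Ck_onT_continuous k f : Ck_on setT k f -> forall x, {for x, continuous f}.
Proof. by case: k => [|k] [cf _] x; exact: cf. Qed.

Lemma Ck_onT_derivable k f : Ck_on setT k.+1 f -> forall x v, derivable f x v.
Proof. by move=> [_ df] x v; have [+ _] := df v; exact. Qed.

Local Arguments Ck_onT_continuous [k f] _ x.
Local Arguments Ck_onT_derivable [k f] _ x v.

Lemma Ck_onTS k f : continuous f ->
  (forall v, (forall x, derivable f x v) /\ Ck_on setT k ('D_v f)) ->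
  Ck_on setT k.+1 f.
Proof.
move=> cf df; split=> [x _|v]; first exact: cf.
by have [dfv Cf] := df v; split.
Qed.

Lemma Ck_on_cst U k (c : R) : Ck_on U k (cst c : V -> R).
Proof.
elim: k c => [|k IH] c; split => //; try by move=> x _; exact: cst_continuous.
move=> v; split => [x _|]; first exact: derivable_cst.
rewrite (_ : 'D_v _ = cst 0); first exact: IH.
by apply/funext => x; rewrite derive_cst.
Qed.

(** The difference quotients in direction v are constant, equal to [L v], so the first derivatives
    are constants. Gives the smoothness of [amean]. *)
Lemma Ck_on_affine U k f (L : V -> R) : continuous f ->
  (forall h v x, f (h *: v + x) = h * L v + f x) -> Ck_on U k f.
Proof.
move=> cf fL; case: k => [|k]; split => //; try by move=> x _; exact: cf.
have dfL v x : is_derive x v f (L v).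
  apply: DeriveDef; first apply/cvg_ex; rewrite /=.
    exists (L v); apply: cvg_near_cst; near=> h.
    rewrite /= fL addrK /GRing.scale/= mulrA mulVf ?mul1r//.
    by near: h; exact: nbhs_dnbhs_neq.
  apply: cvg_lim => //; apply: cvg_near_cst; near=> h.
  rewrite /= fL addrK /GRing.scale/= mulrA mulVf ?mul1r//.
  by near: h; exact: nbhs_dnbhs_neq.
move=> v; split => [x _|]; first by have [] := dfL v x.
rewrite (_ : 'D_v f = cst (L v)); first exact: Ck_on_cst.
by apply/funext => x; have [] := dfL v x.
Unshelve. all: by end_near. Qed.

Lemma Ck_onD k f g : Ck_on setT k f -> Ck_on setT k g ->
  Ck_on setT k (fun x => f x + g x).
Proof.
elim: k f g => [|k IH] f g Cf Cg.
  split => // x _; apply: cvgD; [exact: Ck_onT_continuous Cf x|exact: Ck_onT_continuous Cg x].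
apply: Ck_onTS => [x|v].
  by apply: cvgD; [exact: Ck_onT_continuous Cf _|exact: Ck_onT_continuous Cg _].
have df x := Ck_onT_derivable Cf x v; have dg x := Ck_onT_derivable Cg x v.
split=> [x|]; first exact: derivableD.
rewrite (_ : 'D_v _ = fun x => 'D_v f x + 'D_v g x); last first.
  by apply/funext => x; rewrite (deriveD (df x) (dg x)).
by apply: IH; [have [_ /(_ v)[]] := Cf|have [_ /(_ v)[]] := Cg].
Qed.

Lemma Ck_onM k f g : Ck_on setT k f -> Ck_on setT k g ->
  Ck_on setT k (fun x => f x * g x).
Proof.
elim: k f g => [|k IH] f g Cf Cg.
  split => // x _; apply: cvgM; [exact: Ck_onT_continuous Cf x|exact: Ck_onT_continuous Cg x].
apply: Ck_onTS => [x|v].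
  by apply: cvgM; [exact: Ck_onT_continuous Cf _|exact: Ck_onT_continuous Cg _].
have df x := Ck_onT_derivable Cf x v; have dg x := Ck_onT_derivable Cg x v.
split=> [x|]; first exact: derivableM.
rewrite (_ : 'D_v _ = fun x => f x * 'D_v g x + g x * 'D_v f x); last first.
  by apply/funext => x; rewrite (deriveM (df x) (dg x)).
apply: Ck_onD; apply: IH; try exact: Ck_onW.
  by have [_ /(_ v)[]] := Cg.
by have [_ /(_ v)[]] := Cf.
Qed.

Lemma Ck_onV k f : (forall x, f x != 0) -> Ck_on setT k f ->
  Ck_on setT k (fun x => (f x)^-1).
Proof.
move=> f0; elim: k => [|k IH] Cf.
  by split => // x _; apply: cvgV => //; exact: Ck_onT_continuous Cf _.
apply: Ck_onTS => [x|v].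
  by apply: cvgV => //; exact: Ck_onT_continuous Cf _.
have df x := Ck_onT_derivable Cf x v.
split=> [x|]; first exact: derivableV.
rewrite (_ : 'D_v _ = fun x => cst (-1) x * ((f x)^-1 * (f x)^-1 * 'D_v f x)).
  apply: Ck_onM; first exact: Ck_on_cst.
  apply: Ck_onM; last by have [_ /(_ v)[]] := Cf.
  by apply: Ck_onM; apply: IH; exact: Ck_onW.
apply/funext => x; rewrite (@deriveV _ _ f x v) // /GRing.scale/= /cst.
by rewrite -exprVn expr2 mulNr mul1r mulNr.
Qed.

End Ck_closure.

Arguments Ck_onT_continuous {R V k f} _ x.
Arguments Ck_onT_derivable {R V k f} _ x v.

Section Ck_comp_affine.
Context {R : realType} {V : normedModType R}.

(** The difference quotient of [f \o l] in direction v is literally that of f in direction [L v].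
    Since [Ck_on] speaks of all directions, the induction closes without a chain rule. *)
Lemma Ck_onT_comp_affine k (f : R -> R) (l L : V -> R) : continuous l ->
  (forall h v x, l (h *: v + x) = h * L v + l x) ->
  Ck_on setT k f -> Ck_on setT k (f \o l).
Proof.
move=> cl lL; elim: k f => [|k IH] f Cf.
  split => // x _; have cfl := Ck_onT_continuous Cf (l x).
  by apply: continuous_comp; [exact: cl|exact: cfl].
apply: Ck_onTS => [x|v].
  have cfl := Ck_onT_continuous Cf (l x).
  by apply: continuous_comp; [exact: cl|exact: cfl].
have E (x : V) : (fun h : R => h^-1 *: ((f \o l) (h *: v + x) - (f \o l) x)) =
          (fun h => h^-1 *: (f (h *: L v + l x) - f (l x))).
  by apply/funext => h /=; rewrite lL.
split=> [x|]; first by rewrite /derivable E; exact: (Ck_onT_derivable Cf).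
rewrite (_ : 'D_v _ = 'D_(L v) f \o l).
  by apply: IH; have [_ /(_ (L v))[]] := Cf.
by apply/funext => x; rewrite /derive E.
Qed.

End Ck_comp_affine.

Section flat_function.
Context {R : realType}.
Implicit Types (p : {poly R}) (x : R).

(** The extra power y^m is what makes the induction on p close: the leading part of p X + c is
    absorbed by passing from m to m + 1, and y^m <= m! exp y comes from the exponential series. *)
Lemma poly_expR_bound p m : exists C : R, forall y : R, 0 <= y ->
  `|p.[y]| * y ^+ m <= C * expR y.
Proof.
elim/poly_ind: p m => [|p c IH] m.
  by exists 0 => y _; rewrite horner0 normr0 !mul0r.
have [C HC] := IH m.+1; exists (C + `|c| * m`!%:R) => y y0.
rewrite hornerMXaddC.
have ym : y ^+ m <= m`!%:R * expR y.
  case: m {IH HC} => [|m].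
    by rewrite expr0 fact0 mul1r -expR0 ler_expR.
  have := expR_ge1Dxn m y0; have : 0 < m.+1`!%:R :> R by rewrite ltr0n fact_gt0.
  move=> f0; rewrite -[_ <= _ * _]ler_pdivrMl// mulrC; apply: le_trans.
  by rewrite lerDr.
apply: (@le_trans _ _ (`|p.[y]| * y ^+ m.+1 + `|c| * y ^+ m)).
  rewrite exprS mulrA -mulrDl ler_wpM2r ?exprn_ge0//.
  by rewrite (le_trans (ler_normD _ _))// normrM (ger0_norm y0).
rewrite mulrDl lerD// ?HC// -mulrA ler_wpM2l//.
Qed.

(* The derivatives of [x |-> exp (- 1 / x)], extended by 0, are again of the form
   [flat p], so that smoothness follows by induction on the order. *)
Definition flat p x : R := if 0 < x then p.[x^-1] * expR (- x^-1) else 0.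

(** [poly_expR_bound] with m = 2 at y = 1 / x. A bound quadratic in x is just what forces the
    derivative at 0 to vanish. *)
Lemma flat_bound p : exists C : R, forall x, `|flat p x| <= C * x ^+ 2.
Proof.
have [C HC] := poly_expR_bound p 2; exists C => x; rewrite /flat.
have C0 : 0 <= C.
  by have := HC 0 (lexx 0); rewrite expr0n mulr0 expR0 mulr1.
case: ifPn => x0; last by rewrite normr0 mulr_ge0// sqr_ge0.
rewrite normrM (ger0_norm (expR_ge0 _)) expRN.
rewrite ler_pdivrMr ?expR_gt0// mulrAC -ler_pdivrMr ?exprn_gt0//.
by have := HC x^-1; rewrite exprVn; apply; rewrite invr_ge0 ltW.
Qed.

(** With y = 1 / x one has dy/dx = - y^2, hence the derivative of p(y) exp(- y) in x is y^2 (p(y) -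
    p'(y)) exp(- y). *)
Definition flat_deriv p : {poly R} := 'X^2 * (p - p^`()).

Lemma is_derive_flat p x : is_derive x 1 (flat p) (flat (flat_deriv p) x).
Proof.
have [x0|x0|->] := ltrgtP x 0.
- rewrite (_ : flat _ x = 0); last by rewrite /flat ltNge (ltW x0).
  apply: (@near_eq_is_derive _ _ _ (cst 0)).
  near=> y; rewrite /flat ltNge (_ : y <= 0)//.
  by apply: ltW; near: y; exact: lt_nbhsl.
- have xn0 : x != 0 by rewrite gt_eqF.
  have dV : is_derive x 1 (fun y : R => y^-1) (- x ^- 2).
    apply: DeriveDef; first by apply: derivableV => //; exact: derivable_id.
    by rewrite deriveV ?derive_id// /GRing.scale/= mulr1.
  have dp : is_derive x 1 (horner p \o (fun y => y^-1)) (p^`().[x^-1] * (- x ^- 2)).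
    have dh : is_derive (x^-1) 1 (horner p) p^`().[x^-1].
      by apply: DeriveDef; [exact: derivable_horner|rewrite -derive1E -derivE].
    exact: is_derive1_comp.
  have de : is_derive x 1 (expR \o (fun y => - y^-1)) (expR (- x^-1) * x ^- 2).
    have dN : is_derive x 1 (fun y : R => - y^-1) (x ^- 2).
      by rewrite -[x ^- 2]opprK; exact: (is_deriveN dV).
    exact: is_derive1_comp.
  have D := @is_deriveM _ _ _ _ _ _ _ _ dp de.
  have N : \near x, ((horner p \o (fun y => y^-1)) * (expR \o (fun y => - y^-1))) x = flat p x.
    near=> y; rewrite /flat ifT//.
    by near: y; exact: lt_nbhsr.
  refine (is_derive_eq (near_eq_is_derive N D) _).
  rewrite /flat x0 /flat_deriv /GRing.scale/= hornerM hornerXn hornerD hornerN.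
  rewrite exprVn; ring.
- rewrite (_ : flat _ 0 = 0); last by rewrite /flat ltxx.
  have [C HC] := flat_bound p.
  have C0 : 0 <= C by have := HC 1; rewrite expr1n mulr1; exact: le_trans.
  suff H : h^-1 *: ((flat p \o shift 0) (h *: (1 : R)) - flat p 0) @[h --> 0^'] --> (0:R).
    apply: DeriveDef; first by apply/cvg_ex; exists 0.
    exact: cvg_lim.
  apply/cvgrPdist_le => e e0; near=> h.
  rewrite sub0r normrN /= addr0 /GRing.scale/= mulr1 {2}/flat ltxx subr0.
  have h0 : h != 0 by near: h; exact: nbhs_dnbhs_neq.
  rewrite normrM normfV ler_pdivrMl ?normr_gt0//.
  apply: le_trans (HC h) _; rewrite -[h ^+ 2]real_normK ?num_real//.
  rewrite expr2 mulrA [leRHS]mulrC ler_wpM2r//.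
  have hd : `|h| <= e / (C + 1).
    near: h; apply: dnbhs0_le; rewrite divr_gt0//; lra.
  apply: (@le_trans _ _ ((C + 1) * (e / (C + 1)))).
    by apply: ler_pM => //; lra.
  by rewrite mulrCA divff ?mulr1//; apply: lt0r_neq0; lra.
Unshelve. all: by end_near. Qed.

Lemma flat_continuous p : continuous (flat p).
Proof.
move=> x; apply: differentiable_continuous; apply/derivable1_diffP.
by have [] := is_derive_flat p x.
Qed.

(** On the line, too, [Ck_on] asks for derivatives in every direction v; this reduces them to the
    direction 1. *)
Lemma derive_scale (f : R -> R) (x v : R) : derivable f x 1 ->
  derivable f x v /\ 'D_v f x = v * 'D_1 f x.
Proof.
move=> /derivable1_diffP df; split; first exact: diff_derivable.
rewrite !deriveE// deriv1E; last exact/derivable1_diffP.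
by rewrite /= /GRing.scale/= mul1r.
Qed.

Lemma Ck_flat k p : Ck_on setT k (flat p).
Proof.
elim: k p => [|k IH] p; first by split => // x _; exact: flat_continuous.
apply: Ck_onTS => [x|v]; first exact: flat_continuous.
have d1 x : derivable (flat p) x 1 by have [] := is_derive_flat p x.
split=> [x|]; first by have [] := derive_scale v (d1 x).
rewrite (_ : 'D_v _ = fun x => cst v x * flat (flat_deriv p) x).
  by apply: Ck_onM => //; exact: Ck_on_cst.
apply/funext => x; have [_ ->] := derive_scale v (d1 x).
by rewrite (@derive_val _ _ _ _ _ _ _ (is_derive_flat p x)).
Qed.

End flat_function.

Section calculus.
Context {R : realType}.
Implicit Types (f F : R -> R) (x a b : R).
Local Notation mu := (@lebesgue_measure R).

Lemma derivable_continuous1 f x : derivable f x 1 -> {for x, continuous f}.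
Proof. by move=> /derivable1_diffP; exact: differentiable_continuous. Qed.

Lemma is_derive_affine (c d : R) x : is_derive x 1 (fun t : R => c * t + d) c.
Proof.
have D := is_deriveD (is_deriveM (is_derive_cst c x 1) (is_derive_id x 1)) (is_derive_cst d x 1).
by refine (is_derive_eq D _); rewrite /GRing.scale/= mulr0 mulr1 !addr0.
Qed.

Lemma is_derive_segment (c d t : R) : is_derive t 1 (fun t : R => c + t * (d - c)) (d - c).
Proof.
have D := is_deriveD (is_derive_cst c t 1)
  (is_deriveM (is_derive_id t 1) (is_derive_cst (d - c) t 1)).
by refine (is_derive_eq D _); rewrite /GRing.scale/= mulr0 mulr1 !add0r.
Qed.

Lemma is_derive_oneB x : is_derive x 1 (fun t => 1 - t) (-1 : R).
Proof.
have D := is_deriveB (is_derive_cst (1:R) x 1) (is_derive_id x 1).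
by refine (is_derive_eq D _); rewrite sub0r.
Qed.

Lemma Ck_derive1 k f : Ck_on setT k.+1 f -> Ck_on setT k f^`()%classic.
Proof.
move=> [_ /(_ (1 : R))[_]]; rewrite (_ : 'D_1 f = f^`()%classic)//.
by apply/funext => x; rewrite derive1E.
Qed.

Lemma derivable_oo_LRcontinuousT F a b : (forall x, derivable F x 1) ->
  derivable_oo_LRcontinuous F a b.
Proof.
move=> dF; split => [x _//||].
  by apply: cvg_at_right_filter; exact: derivable_continuous1.
by apply: cvg_at_left_filter; exact: derivable_continuous1.
Qed.

Lemma Rintegral_derive1 F a b : a < b -> (forall x, derivable F x 1) ->
  continuous (F^`()%classic) ->
  \int[mu]_(x in `[a, b]) F^`()%classic x = F b - F a.
Proof.
move=> ab dF cF'; rewrite /Rintegral.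
have -> // := continuous_FTC2 ab (continuous_subspaceT cF')
  (@derivable_oo_LRcontinuousT F a b dF) (fun _ _ => erefl).
Qed.

Lemma within_continuous_integrable a b f : {within `[a, b], continuous f} ->
  mu.-integrable `[a, b] (EFin \o f).
Proof.
by move=> cf; apply: continuous_compact_integrable => //; exact: segment_compact.
Qed.

End calculus.

(** * Smooth steps, plateaus and the endpoint estimate *)

Section cutoffs.
Context {R : realType}.
Implicit Types (x s t d : R).

Lemma flat1E x : flat 1 x = if 0 < x then expR (- x^-1) else 0 :> R.
Proof. by rewrite /flat hornerE mul1r. Qed.

Lemma flat1_ge0 x : 0 <= flat 1 x.
Proof. by rewrite flat1E; case: ifP => // _; exact: expR_ge0. Qed.

Lemma flat1_gt0 x : 0 < x -> 0 < flat 1 x.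
Proof. by rewrite flat1E => ->; exact: expR_gt0. Qed.

Lemma flat1_le0 x : x <= 0 -> flat 1 x = 0.
Proof. by rewrite flat1E ltNge => ->. Qed.

Lemma flat1_homo : {homo (flat 1 : R -> R) : x y / x <= y}.
Proof.
move=> x y xy; have [x0|x0] := leP x 0; first by rewrite (flat1_le0 x0) flat1_ge0.
rewrite !flat1E x0 (lt_le_trans x0 xy) ler_expR lerN2 lef_pV2// posrE//.
exact: lt_le_trans xy.
Qed.

Definition step s : R := flat 1 s * (flat 1 s + flat 1 (1 - s))^-1.

Lemma step_den_gt0 s : 0 < flat 1 s + flat 1 (1 - s).
Proof.
have [s0|s0] := leP s 0.
  by rewrite (flat1_le0 s0) add0r flat1_gt0// subr_gt0 (le_lt_trans s0).
by rewrite ltr_pwDl// ?flat1_ge0// flat1_gt0.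
Qed.

Lemma step_ge0 s : 0 <= step s.
Proof. by rewrite /step divr_ge0 ?flat1_ge0// ltW// step_den_gt0. Qed.

Lemma step_le1 s : step s <= 1.
Proof. by rewrite /step ler_pdivrMr ?step_den_gt0// mul1r lerDl flat1_ge0. Qed.

Lemma step_le0 s : s <= 0 -> step s = 0.
Proof. by move=> s0; rewrite /step flat1_le0// mul0r. Qed.

Lemma step_ge1 s : 1 <= s -> step s = 1.
Proof.
move=> s1; rewrite /step (@flat1_le0 (1 - s)) ?subr_le0// addr0 divff//.
by rewrite gt_eqF// flat1_gt0// (lt_le_trans ltr01).
Qed.

(** After clearing denominators the product of [flat 1 x] and [flat 1 y] cancels, and what remains
    compares [flat 1 x] times [flat 1 (1 - y)] with [flat 1 y] times [flat 1 (1 - x)]. *)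
Lemma step_homo : {homo step : x y / x <= y}.
Proof.
move=> x y xy; rewrite /step ler_pdivrMr ?step_den_gt0// mulrAC.
rewrite ler_pdivlMr ?step_den_gt0// !mulrDr mulrC lerD2l.
by apply: ler_pM; rewrite ?flat1_ge0// flat1_homo// lerB.
Qed.

Lemma Ck_step k : Ck_on setT k step.
Proof.
apply: Ck_onM; first exact: Ck_flat.
apply: Ck_onV => [s|]; first by rewrite gt_eqF// step_den_gt0.
apply: Ck_onD; first exact: Ck_flat.
apply: (@Ck_onT_comp_affine R R k (flat 1) (fun s : R => 1 - s) (fun s : R => - s)).
- by move=> s; apply: cvgB; [exact: cvg_cst|exact: cvg_id].
- by move=> h v x; rewrite /GRing.scale/=; ring.
- exact: Ck_flat.
Qed.

Lemma Ck_comp_affine k (f : R -> R) (a b : R) : Ck_on setT k f ->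
  Ck_on setT k (fun x => f (a * x + b)).
Proof.
apply: (@Ck_onT_comp_affine R R k f (fun x => a * x + b) (fun x => a * x)).
- by move=> x; apply: cvgD; [apply: cvgM; [exact: cvg_cst|exact: cvg_id]|exact: cvg_cst].
- by move=> h v x; rewrite /GRing.scale/=; ring.
Qed.

Definition ramp d t : R := step (d^-1 * t + (-1)).

Lemma Ck_ramp k d : Ck_on setT k (ramp d).
Proof. by apply: Ck_comp_affine; exact: Ck_step. Qed.

Lemma ramp_eq0 d t : 0 < d -> t <= d -> ramp d t = 0.
Proof. by move=> d0 td; rewrite /ramp step_le0// subr_le0 ler_pdivrMl// mulr1. Qed.

Lemma ramp_eq1 d t : 0 < d -> 2 * d <= t -> ramp d t = 1.
Proof.
move=> d0 td; rewrite /ramp step_ge1// lerBrDl ler_pdivlMl//; lra.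
Qed.

Lemma ramp_homo d : 0 < d -> {homo ramp d : x y / x <= y}.
Proof.
by move=> d0 x y xy; apply: step_homo; rewrite lerD2r ler_pM2l// invr_gt0.
Qed.

Lemma derivable_ramp d t : derivable (ramp d) t 1.
Proof. exact: Ck_onT_derivable (Ck_ramp 1 d) t 1. Qed.

Lemma ramp_deriv_ge0 d t : 0 < d -> 0 <= (ramp d)^`()%classic t.
Proof.
move=> d0; rewrite derive1E.
have /cvg_lim <- // : h^-1 *: ((ramp d \o shift t) (h *: (1:R)) - ramp d t) @[h --> 0^'+]
   --> 'D_1 (ramp d) t.
  by apply: cvg_dnbhs_at_right; exact: derivable_ramp.
apply: limr_ge.
  apply/cvg_ex; exists ('D_1 (ramp d) t).
  by apply: cvg_dnbhs_at_right; exact: derivable_ramp.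
near=> h; have h0 : 0 < h by near: h; exact: nbhs_right_gt.
rewrite mulr_ge0 ?invr_ge0 ?(ltW h0)// subr_ge0; apply: ramp_homo => //=.
by rewrite /GRing.scale/= mulr1 lerDr ltW.
Unshelve. all: by end_near. Qed.

Lemma ramp_deriv_eq0 d t : 0 < d -> 2 * d < t -> (ramp d)^`()%classic t = 0.
Proof.
move=> d0 dt; rewrite derive1E (@near_eq_derive R R R _ (cst 1)) ?derive_cst//.
near=> s; apply: ramp_eq1 => //; apply: ltW; near: s; exact: lt_nbhsr.
Unshelve. all: by end_near. Qed.

Definition plateau d t : R := ramp d t + ramp d (1 - t) - 1.

(** The rise takes place on [d, 2d] and the fall on [1 - 2d, 1 - d]. For d <= 1/4 these lie on
    either side of 1/2, so at each time one of the two ramps equals 1 and cancels the - 1. *)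
Lemma plateau_ramp d t : 0 < d -> d <= 4^-1 ->
  plateau d t = if t <= 2^-1 then ramp d t else ramp d (1 - t).
Proof.
move=> d0 d4; rewrite /plateau; case: ifPn => t2.
  by rewrite (@ramp_eq1 d (1 - t))// ?addrK//; lra.
by rewrite -ltNge in t2; rewrite (@ramp_eq1 d t)// 1?addrAC ?subrr ?add0r//; lra.
Qed.

Lemma plateau_ge0 d t : 0 < d -> d <= 4^-1 -> 0 <= plateau d t.
Proof. by move=> d0 d4; rewrite plateau_ramp//; case: ifP => _; exact: step_ge0. Qed.

Lemma plateau_le1 d t : 0 < d -> d <= 4^-1 -> plateau d t <= 1.
Proof. by move=> d0 d4; rewrite plateau_ramp//; case: ifP => _; exact: step_le1. Qed.

Lemma plateau_eq0 d t : 0 < d -> d <= 4^-1 -> ~ (d <= t <= 1 - d) -> plateau d t = 0.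
Proof.
move=> d0 d4 /negP; rewrite negb_and -!ltNge plateau_ramp// => h.
by case: ifPn => t2; apply: ramp_eq0 => //; case/orP: h => h; lra.
Qed.

Lemma Ck_plateau k d : Ck_on setT k (plateau d).
Proof.
rewrite (_ : plateau d = fun t => (ramp d t + ramp d ((-1) * t + 1)) + cst (-1) t).
  apply: Ck_onD; last exact: Ck_on_cst.
  by apply: Ck_onD; [exact: Ck_ramp|apply: Ck_comp_affine; exact: Ck_ramp].
by apply/funext => t; rewrite /plateau mulN1r [- t + 1]addrC.
Qed.

Lemma is_derive_plateau d t : is_derive t 1 (plateau d)
  ((ramp d)^`()%classic t - (ramp d)^`()%classic (1 - t)).
Proof.
have d1 : is_derive t 1 (ramp d) ((ramp d)^`()%classic t).
  by apply: DeriveDef; [exact: derivable_ramp|rewrite derive1E].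
have d3 := is_derive_oneB t.
have d2 : is_derive t 1 (ramp d \o (fun t => 1 - t)) ((ramp d)^`()%classic (1 - t) * -1).
  by apply: is_derive1_comp; apply: DeriveDef; [exact: derivable_ramp|rewrite derive1E].
have d4 := is_derive_cst (1:R) t 1.
have D := is_deriveB (is_deriveD d1 d2) d4.
by refine (is_derive_eq D _); rewrite mulrN1 subr0.
Qed.

Lemma test_function_continuous {V : normedModType R} (U : set V) (f : V -> R) :
  test_function U f -> continuous f.
Proof. by move=> [Cf _ _] x; exact: Ck_onT_continuous (Cf 0%N) x. Qed.

Lemma test_function_continuous_derive {V : normedModType R} (U : set V) (f : V -> R) (v : V) :
  test_function U f -> continuous ('D_v f).
Proof.
move=> [Cf _ _] x; have [_ /(_ v)[_ Cv]] := Cf 1%N.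
exact: (@Ck_onT_continuous _ _ 0%N _ Cv x).
Qed.

Lemma test_function_continuous_derive1 (U : set R) (f : R -> R) :
  test_function U f -> continuous f^`()%classic.
Proof. by move=> [Cf _ _] x; exact: Ck_onT_continuous (Ck_derive1 (Cf 1%N)) x. Qed.

Lemma is_derive_test_function (U : set R) (f : R -> R) (x : R) :
  test_function U f -> is_derive x 1 f (f^`()%classic x).
Proof.
move=> [Cf _ _]; apply: DeriveDef; first exact: Ck_onT_derivable (Cf 1%N) x 1.
by rewrite derive1E.
Qed.

Lemma test_function_itv (f : R -> R) (a b : R) (U : set R) : `[a, b] `<=` U ->
  (forall k, Ck_on setT k f) -> (forall x, ~ (a <= x <= b) -> f x = 0) ->
  test_function U f.
Proof.
move=> abU Cf f0; have sub : closure [set x | f x != 0] `<=` `[a, b].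
  rewrite [X in _ `<=` X](closure_id _).1; last exact: interval_closed.
  apply: closureS => x /= fx; rewrite in_itv/=.
  by apply: contrapT => /f0 fx0; rewrite fx0 eqxx in fx.
split => //; last exact: subset_trans sub abU.
by apply: subclosed_compact sub => //; [exact: closed_closure|exact: segment_compact].
Qed.

Lemma test_function_plateau d : 0 < d -> d <= 4^-1 ->
  test_function (`]0, 1[ : set R) (plateau d).
Proof.
move=> d0 d4; apply: (@test_function_itv _ d (1 - d)).
- by move=> x /=; rewrite !in_itv/= => /andP[h1 h2]; lra.
- by move=> k; exact: Ck_plateau.
- by move=> x; exact: plateau_eq0.
Qed.

Lemma cutoff_endpoints (m : R -> R) (C : R) :
  {within `[0, 1], continuous m} ->
  (forall phi, test_function (`]0, 1[ : set R) phi ->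
    (forall t, 0 <= phi t <= 1) ->
    \int[lebesgue_measure]_(t in `[0, 1]) (phi^`()%classic t * m t) <= C) ->
  m 0 - m 1 <= C.
Proof.
move=> cm H; apply/ler_addgt0Pr => e e0.
have /(continuous_within_itvP _ ltr01)[_ m0 m1] := cm.
have e20 : 0 < e / 2 by lra.
have [d0 d00 Hd0] : exists2 d, 0 < d & forall t, 0 <= t < d -> `|m t - m 0| <= e / 2.
  have := (cvgrPdist_le _ _).1 m0 _ e20; rewrite near_withinE => -[r /= r0 Hr].
  exists r => // t /andP[]; rewrite le_eqVlt => /orP[/eqP<- _|t0 tr].
    by rewrite subrr normr0 ltW.
  by rewrite distrC; apply: Hr => //=; rewrite sub0r normrN gtr0_norm.
have [d1 d10 Hd1] : exists2 d, 0 < d & forall t, 1 - d < t <= 1 -> `|m t - m 1| <= e / 2.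
  have := (cvgrPdist_le _ _).1 m1 _ e20; rewrite near_withinE => -[r /= r0 Hr].
  exists r => // t /andP[tr]; rewrite le_eqVlt => /orP[/eqP->|t1].
    by rewrite subrr normr0 ltW.
  by rewrite distrC; apply: Hr => //=; rewrite gtr0_norm ?subr_gt0//; lra.
(* The ramps are flat beyond distance 2d from the endpoints; the factor 1/3 puts 2d strictly below
   [d0] and [d1], where m is within e / 2 of its endpoint values. *)
pose d := Num.min (4^-1) (Num.min (d0 / 3) (d1 / 3)).
have dd : [/\ 0 < d, d <= 4^-1, d <= d0 / 3 & d <= d1 / 3].
  rewrite /d !ge_min !lt_min !lexx !orbT/=; split => //.
  by rewrite invr_gt0 ltr0n !divr_gt0.
have [d_0 d4 dd0 dd1] := dd.
have := H _ (test_function_plateau d_0 d4).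
have pl01 t : 0 <= plateau d t <= 1 by rewrite plateau_ge0 ?plateau_le1.
move=> /(_ pl01) HC.
pose A := m 0 - e / 2; pose B := m 1 + e / 2.
suff : A - B <= C by rewrite /A /B; lra.
apply: le_trans HC.
pose r' : R -> R := (ramp d)^`()%classic.
have cr' : continuous r'.
  by move=> x; exact: Ck_onT_continuous (Ck_derive1 (Ck_ramp 1 d)) x.
have cr'1 : continuous (fun t => r' (1 - t)).
  move=> x; apply: (@continuous_comp _ _ _ (fun t => 1 - t) r'); last exact: cr'.
  by apply: cvgB; [exact: cvg_cst|exact: cvg_id].
(* A lies below m near 0 and B lies above m near 1, so F' minorizes the integrand pointwise, while
   its integral is exactly F 1 - F 0 = A - B. *)
pose F t := A * ramp d t + B * ramp d (1 - t).
have dF t : is_derive t 1 F (A * r' t - B * r' (1 - t)).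
  have h1 : is_derive t 1 (ramp d) (r' t).
    by apply: DeriveDef; [exact: derivable_ramp|rewrite /r' derive1E].
  have h3 := is_derive_oneB t.
  have h2 : is_derive t 1 (ramp d \o (fun t => 1 - t)) (r' (1 - t) * -1).
    by apply: is_derive1_comp; apply: DeriveDef;
      [exact: derivable_ramp|rewrite /r' derive1E].
  have D := is_deriveD (is_deriveZ A h1) (is_deriveZ B h2).
  by refine (is_derive_eq D _); rewrite /GRing.scale/= mulrN1 mulrN.
have F'E : F^`()%classic = fun t => A * r' t - B * r' (1 - t).
  by apply/funext => t; rewrite derive1E (@derive_val _ _ _ _ _ _ _ (dF t)).
have cF' : continuous F^`()%classic.
  rewrite F'E => x; apply: cvgB; apply: cvgM.
  - exact: cvg_cst.
  - exact: cr'.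
  - exact: cvg_cst.
  - exact: cr'1.
have -> : A - B = \int[lebesgue_measure]_(t in `[0, 1]) F^`()%classic t.
  have dF1 t : derivable F t 1 by have [] := dF t.
  rewrite (Rintegral_derive1 ltr01 dF1 cF').
  rewrite /F subr0 subrr (@ramp_eq0 d 0) ?(ltW d_0)// (@ramp_eq1 d 1)//; first ring.
  lra.
have plE : (plateau d)^`()%classic = fun t => r' t - r' (1 - t).
  by apply/funext => t; rewrite derive1E (@derive_val _ _ _ _ _ _ _ (is_derive_plateau d t)).
have pt (t : R) : 0 <= t -> t <= 1 ->
    A * r' t - B * r' (1 - t) <= (r' t - r' (1 - t)) * m t.
  move=> t0 t1.
  have h1 : A * r' t <= r' t * m t.
    have [td|td] := leP t (2 * d); last by rewrite /r' ramp_deriv_eq0// mulr0 mul0r.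
    rewrite mulrC ler_wpM2l ?ramp_deriv_ge0//.
    have : `|m t - m 0| <= e / 2 by apply: Hd0; rewrite t0/=; lra.
    by rewrite ler_norml /A => /andP[]; lra.
  have h2 : r' (1 - t) * m t <= B * r' (1 - t).
    have [td|td] := leP (1 - t) (2 * d); last by rewrite /r' ramp_deriv_eq0// mulr0 mul0r.
    rewrite mulrC ler_wpM2r ?ramp_deriv_ge0//.
    have : `|m t - m 1| <= e / 2 by apply: Hd1; rewrite t1/=; lra.
    by rewrite ler_norml /B => /andP[]; lra.
  by rewrite [leRHS]mulrBl; exact: (@lerB R).
apply: le_Rintegral; first exact: measurable_itv.
- exact: within_continuous_integrable (continuous_subspaceT cF').
- apply: within_continuous_integrable.
  have cpl : continuous (fun t => r' t - r' (1 - t)).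
    by move=> x; apply: cvgB; [exact: cr'|exact: cr'1].
  have {}cpl : {within `[0, 1], continuous (fun t => r' t - r' (1 - t))}.
    exact: continuous_subspaceT.
  by rewrite plE; move=> x; apply: cvgM; [exact: cpl|exact: cm].
move=> t; rewrite /= in_itv/= => /andP[t0 t1]; rewrite F'E plE.
exact: pt.
Qed.

End cutoffs.

(** * Integrals of nonmeasurable functions *)

Section lower_integral.
Context d (T : measurableType d) {R : realType}.
Variable mu : {measure set T -> \bar R}.
Implicit Types (D : set T) (f g : T -> \bar R).
Local Open Scope ereal_scope.
Import HBNNSimple.

(* The Lebesgue integral of a nonnegative function is a supremum over simple
   functions, hence makes sense (as a lower integral) without measurability.
   Solutions of the continuity equation are not assumed to depend measurably on
   time through [rho t], so that the time integrals are handled this way. *)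
Lemma ge0_le_lower_integral D f g : (forall x, D x -> 0 <= f x) ->
  (forall x, D x -> f x <= g x) ->
  \int[mu]_(x in D) f x <= \int[mu]_(x in D) g x.
Proof.
move=> f0 fg; rewrite !ge0_integralE//; last first.
  by move=> x Dx; exact: le_trans (f0 _ Dx) (fg _ Dx).
apply: ereal_sup_le => _ /= [h hf <-]; exists h => // x.
apply: le_trans (hf x) _; rewrite !patchE; case: ifPn => //.
by rewrite inE => /fg.
Qed.

(** Countably many simple functions below f have integrals approaching the supremum that defines the
    integral. Their pointwise supremum is measurable, stays below f and has the same integral.
    Inequalities for arbitrary f are transferred from this minorant. *)
Lemma lower_integral_minorant D f : measurable D ->
  (forall x, D x -> 0 <= f x) ->
  exists g : T -> \bar R, [/\ measurable_fun [set: T] g, (forall x, 0 <= g x),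
    (forall x, D x -> g x <= f x) &
    \int[mu]_(x in D) g x = \int[mu]_(x in D) f x].
Proof.
move=> mD f0; set I := \int[mu]_(x in D) f x.
have approx (r : R) : r%:E < I -> exists h : {nnsfun T >-> R},
    (forall x, (h x)%:E <= (f \_ D) x) /\ r%:E < sintegral mu h.
  rewrite /I ge0_integralE// => /ereal_sup_gt[_ [h hf <-] rh].
  by exists h.
have [r rI] : exists r : nat -> R, (forall n, (r n)%:E < I \/ I = 0) /\
    (forall y, (forall n, (r n)%:E <= y) -> I <= y).
  have I0 : 0 <= I by exact: integral_ge0.
  have [II|II|II] := ltgtP I +oo; last first.
  - exists (fun n => n%:R)%R; split => [n|y yn]; first by left; rewrite II ltry.
    rewrite II leye_eq; apply/eqP/eqyP => e e0.
    apply: le_trans (yn (Num.trunc e).+1); rewrite lee_fin ltW//.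
    exact: truncnS_gt.
  - by rewrite ltNge leey in II.
  have If : I \is a fin_num by rewrite ge0_fin_numE.
  exists (fun n => fine I - n.+1%:R^-1)%R; split => [n|y yn].
    by left; rewrite -[ltRHS]fineK// lte_fin ltrBlDr ltrDl invr_gt0 ltr0n.
  rewrite -[leLHS]fineK//; apply/lee_addgt0Pr => e e0.
  have [n ne] : exists n, (n.+1%:R^-1 <= e)%R.
    exists (Num.trunc e^-1); rewrite invf_ple ?posrE ?ltr0n//.
    exact/ltW/truncnS_gt.
  apply: (@le_trans _ _ ((fine I - n.+1%:R^-1)%:E + e%:E)).
    by rewrite -EFinD lee_fin -addrA lerDl addrC subr_ge0.
  by rewrite leeD2r.
have [I0|I0] := eqVneq I 0.
  by exists (cst 0); split => //; rewrite I0 integral0.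
have /choice[h hP] n : exists h : {nnsfun T >-> R},
    (forall x, (h x)%:E <= (f \_ D) x) /\ (r n)%:E < sintegral mu h.
  by apply: approx; have [/(_ n)[//|/eqP]] := rI; rewrite (negbTE I0).
pose g (x : T) : \bar R := ereal_sup (range (fun n => (h n x)%:E)).
have hg n x : (h n x)%:E <= g x by apply: ereal_sup_ubound; exists n.
have gf x : g x <= (f \_ D) x.
  by apply: ge_ereal_sup => _ [n _ <-]; have [+ _] := hP n; exact.
have g0 x : 0 <= g x by apply: le_trans (hg 0%N x); rewrite lee_fin.
have mg : measurable_fun [set: T] g.
  rewrite (_ : g = fun x => esups (fun n => (h n x)%:E) 0%N).
    apply: measurable_fun_esups => // n; exact/measurable_EFinP.
  apply/funext => x; rewrite /g /esups /=; congr ereal_sup.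
  by rewrite /sdrop; apply/seteqP; split => y [n /= _ <-]; exists n.
exists g; split => //.
  by move=> x Dx; apply: le_trans (gf x) _; rewrite patchE mem_set.
apply/eqP; rewrite eq_le; apply/andP; split.
  apply: ge0_le_lower_integral => // x Dx.
  by apply: le_trans (gf x) _; rewrite patchE mem_set.
have [_ +] := rI; apply => n; have [hf /ltW hr] := hP n.
apply: le_trans hr _; rewrite -integralT_nnsfun integral_mkcond.
rewrite (integral_mkcond D); apply: ge0_le_lower_integral => x _.
  by rewrite patchE in_setT lee_fin.
rewrite !patchE in_setT; case: ifPn => xD; first exact: hg.
by have := hf x; rewrite patchE (negbTE xD).
Qed.

(** For lower integrals this is the direction of additivity that persists: the sum of measurable
    minorants is a minorant of the sum. It is also the one needed to bound the action from below. *)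
Lemma lower_integralD D f g : measurable D ->
  (forall x, D x -> 0 <= f x) -> (forall x, D x -> 0 <= g x) ->
  \int[mu]_(x in D) f x + \int[mu]_(x in D) g x <=
  \int[mu]_(x in D) (f x + g x).
Proof.
move=> mD f0 g0.
have [f' [mf' f'0 f'f <-]] := lower_integral_minorant mD f0.
have [g' [mg' g'0 g'g <-]] := lower_integral_minorant mD g0.
rewrite -ge0_integralD//; [|exact: measurable_funTS|exact: measurable_funTS].
apply: ge0_le_lower_integral => x Dx; first exact: adde_ge0.
by rewrite leeD// ?f'f// g'g.
Qed.

Lemma lower_integralZl D f (k : R) : measurable D -> (0 <= k)%R ->
  (forall x, D x -> 0 <= f x) ->
  k%:E * \int[mu]_(x in D) f x <= \int[mu]_(x in D) (k%:E * f x).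
Proof.
move=> mD k0 f0.
have [f' [mf' f'0 f'f <-]] := lower_integral_minorant mD f0.
rewrite -ge0_integralZl//; last exact: measurable_funTS.
apply: ge0_le_lower_integral => x Dx; first by rewrite mule_ge0.
by rewrite lee_wpmul2l// f'f.
Qed.

(** If the right side is finite, so are the positive and the negative part; if it is infinite, there
    is nothing to prove. This holds without integrability because [fine] turns infinite values into
    0. *)
Lemma le_abse_fine_integral D (f : T -> R) :
  `|(\int[mu]_(x in D) f x)%R|%:E <= \int[mu]_(x in D) `|f x|%:E.
Proof.
rewrite /Rintegral.
have pos : \int[mu]_(x in D) ((EFin \o f)^\+ x) <= \int[mu]_(x in D) `|f x|%:E.
  apply: ge0_le_lower_integral => x Dx; first exact: funepos_ge0.
  by rewrite funeposE/= ge_max !lee_fin ler_norm normr_ge0.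
have neg : \int[mu]_(x in D) ((EFin \o f)^\- x) <= \int[mu]_(x in D) `|f x|%:E.
  apply: ge0_le_lower_integral => x Dx; first exact: funeneg_ge0.
  by rewrite funenegE/= ge_max !lee_fin normr_ge0 ler_normr lexx orbT.
rewrite (_ : \int[mu]_(x in D) (f x)%:E = \int[mu]_(x in D) ((EFin \o f)^\+ x) -
    \int[mu]_(x in D) ((EFin \o f)^\- x)); last exact: integralE.
move: pos neg; set I := \int[mu]_(x in D) `|f x|%:E.
have P0 : 0 <= \int[mu]_(x in D) ((EFin \o f)^\+ x) by exact: integral_ge0.
have N0 : 0 <= \int[mu]_(x in D) ((EFin \o f)^\- x) by exact: integral_ge0.
move: P0 N0.
set P := \int[mu]_(x in D) ((EFin \o f)^\+ x).
set N := \int[mu]_(x in D) ((EFin \o f)^\- x).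
case: I => [i| |]; last 2 first.
- by move=> *; rewrite leey.
- by case: P.
  case: P => [p| |] //; case: N => [n| |] //.
  by rewrite !lee_fin /= => p0 n0 pi ni; rewrite ler_norml; lra.
Qed.

(** Negation exchanges the positive and negative parts. In the infinite cases, including oo - oo,
    [fine] returns 0 on both sides. *)
Lemma fine_integralN D (f : T -> R) :
  (\int[mu]_(x in D) (- f x) = - \int[mu]_(x in D) f x)%R.
Proof.
rewrite /Rintegral integralE [in RHS]integralE.
have -> : (fun x => (- f x)%:E)^\+ = (fun x => (f x)%:E)^\-.
  by apply/funext => x; rewrite funeposE funenegE EFinN.
have -> : (fun x => (- f x)%:E)^\- = (fun x => (f x)%:E)^\+.
  by apply/funext => x; rewrite funeposE funenegE EFinN oppeK.
have : 0 <= \int[mu]_(x in D) ((fun x => (f x)%:E)^\+ x) by exact: integral_ge0.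
have : 0 <= \int[mu]_(x in D) ((fun x => (f x)%:E)^\- x) by exact: integral_ge0.
case: (\int[mu]_(x in D) ((fun x => (f x)%:E)^\+ x)) => [p| |] //;
case: (\int[mu]_(x in D) ((fun x => (f x)%:E)^\- x)) => [n| |] //= _ _;
  rewrite ?oppr0//.
by rewrite opprB.
Qed.

(** G is replaced by a measurable minorant g with the same integral. Then 2 c g <= g^2 + c^2 is
    integrated and c optimized. On the other side, g^2 / k is a measurable function below H, so H
    itself may be arbitrary. *)
Lemma lower_integral_cauchy_schwarz D (G H : T -> \bar R) (M k : R) :
  measurable D -> mu D <= M%:E -> (0 <= k)%R -> (0 <= M)%R ->
  (forall x, D x -> 0 <= G x) -> (forall x, D x -> 0 <= H x) ->
  (forall x, D x -> G x ^+ 2 <= k%:E * H x) ->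
  (\int[mu]_(x in D) G x) ^+ 2 <= (M * k)%:E * \int[mu]_(x in D) H x.
Proof.
move=> mD muM k0 M0 G0 H0 GH.
have [g [mg g0 gG <-]] := lower_integral_minorant mD G0.
have {}GH x : D x -> g x ^+ 2 <= k%:E * H x.
  move=> Dx; apply: le_trans (GH x Dx).
  by rewrite !expe2 lee_pmul// gG.
have step1 : (\int[mu]_(x in D) g x) ^+ 2 <= M%:E * \int[mu]_(x in D) (g x ^+ 2).
  have I0 : 0 <= \int[mu]_(x in D) g x by exact: integral_ge0.
  have J0 : 0 <= \int[mu]_(x in D) (g x ^+ 2).
    by apply: integral_ge0 => x _; rewrite expe2 mule_ge0.
  have mg2 : measurable_fun D (fun x => g x ^+ 2).
    apply: measurable_funTS; under eq_fun do rewrite expe2.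
    exact: emeasurable_funM.
  have [M00|M_gt0] := eqVneq M 0%R.
    have D0 : mu D = 0.
      by apply/eqP; rewrite eq_le measure_ge0 andbT; rewrite M00 in muM.
    have -> : \int[mu]_(x in D) g x = 0 by apply: null_set_integral => //; exact: measurable_funTS.
    by rewrite expe2 mul0e mule_ge0// lee_fin.
  have {}M_gt0 : (0 < M)%R by rewrite lt_def M_gt0.
  have key (c : R) : (0 < c)%R ->
      (2 * c)%:E * \int[mu]_(x in D) g x <= \int[mu]_(x in D) (g x ^+ 2) + (c ^+ 2 * M)%:E.
    move=> c0; rewrite -ge0_integralZl//; [|exact: measurable_funTS|by rewrite lee_fin; lra].
    apply: (@le_trans _ _ (\int[mu]_(x in D) (g x ^+ 2 + (c ^+ 2)%:E))).
      apply: ge0_le_lower_integral => x Dx.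
        by rewrite mule_ge0// lee_fin; lra.
      case: (g x) (g0 x) => [y| |] //; last first.
        by move=> _; rewrite expe2 mulyy addye// leey.
      move=> _; rewrite expe2 -!EFinM -EFinD lee_fin.
      by have := sqr_ge0 (y - c); rewrite sqrrB -mulr_natl; lra.
    rewrite ge0_integralD//; last 2 first.
      by move=> x _; rewrite expe2 mule_ge0.
      by move=> x _; rewrite lee_fin sqr_ge0.
    by rewrite leeD2l// integral_cst// [leRHS]EFinM lee_wpmul2l// lee_fin sqr_ge0.
  move: key J0 I0; set I := \int[mu]_(x in D) g x; set J := \int[mu]_(x in D) _.
  case: J => [j| |] //; last first.
    by move=> _ _ _; rewrite gt0_muley ?lte_fin// leey.
  case: I => [i| |] // key; last first.
    have := key 1%R ltr01; rewrite gt0_muley ?lte_fin; last lra.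
    by rewrite -EFinD leye_eq.
  move=> j0' i0'; have j0 : (0 <= j)%R by rewrite -lee_fin.
  have i0 : (0 <= i)%R by rewrite -lee_fin.
  rewrite expe2 -!EFinM lee_fin.
  have [->|ine0] := eqVneq i 0%R; first by rewrite mul0r mulr_ge0.
  have i_gt0 : (0 < i)%R by rewrite lt_def ine0.
  (* The value c = i / M maximizes 2 c i - c^2 M and turns the inequality into i^2 / M <= j. *)
  have := key (i / M)%R (divr_gt0 i_gt0 M_gt0).
  rewrite -!EFinM -EFinD lee_fin.
  have -> : (2 * (i / M) * i = 2 * (i * i / M))%R by ring.
  have -> : ((i / M) ^+ 2 * M = i * i / M)%R by field; rewrite gt_eqF.
  move=> h; have : (i * i / M <= j)%R by lra.
  by rewrite ler_pdivrMr// (mulrC M).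
apply: le_trans step1 _; rewrite EFinM -muleA lee_wpmul2l ?lee_fin//.
have [k00|k_neq0] := eqVneq k 0%R.
  rewrite k00 mul0e integral0_eq// => x Dx; apply/eqP; rewrite eq_le; apply/andP; split.
    by have := GH _ Dx; rewrite k00 mul0e.
  by rewrite expe2 mule_ge0.
have k_gt0 : (0 < k)%R by rewrite lt_def k_neq0.
have -> : \int[mu]_(x in D) (g x ^+ 2) = k%:E * \int[mu]_(x in D) ((k^-1)%:E * g x ^+ 2).
  rewrite -ge0_integralZl//.
  - by apply: eq_integral => x _; rewrite muleA -EFinM divff// mul1e.
  - apply: measurable_funTS; apply: emeasurable_funM => //.
    by under eq_fun do rewrite expe2; exact: emeasurable_funM.
  - by move=> x _; rewrite mule_ge0 ?lee_fin ?invr_ge0// expe2 mule_ge0.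
rewrite lee_wpmul2l//; apply: ge0_le_lower_integral => x Dx.
  by rewrite mule_ge0 ?lee_fin ?invr_ge0// expe2 mule_ge0.
by rewrite muleC lee_pdivrMr// muleC GH.
Qed.

End lower_integral.

(** * The continuity equation for the arithmetic mean *)

Section tensor_test_functions.
Context {R : realType}.
Implicit Types (eta phi : R -> R).

Lemma derive_comp_affine {V : normedModType R} (f : R -> R) (l L : V -> R) (x v : V) :
  (forall h v x, l (h *: v + x) = h * L v + l x) ->
  'D_v (f \o l) x = 'D_(L v) f (l x).
Proof. by move=> lL; rewrite /derive; under eq_fun do rewrite /= lL. Qed.

Definition tensor eta phi : R * R -> R := fun z => eta z.1 * phi z.2.

Lemma fst_continuous2 : continuous (fst : R * R -> R).
Proof. by move=> z; exact: cvg_fst. Qed.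

Lemma snd_continuous2 : continuous (snd : R * R -> R).
Proof. by move=> z; exact: cvg_snd. Qed.

Lemma Ck_fst k eta : Ck_on setT k eta -> Ck_on setT k (eta \o (fst : R * R -> R)).
Proof.
by apply: (@Ck_onT_comp_affine R (R * R)%type k eta fst fst); first exact: fst_continuous2.
Qed.

Lemma Ck_snd k phi : Ck_on setT k phi -> Ck_on setT k (phi \o (snd : R * R -> R)).
Proof.
by apply: (@Ck_onT_comp_affine R (R * R)%type k phi snd snd); first exact: snd_continuous2.
Qed.

Lemma test_function_tensor (U : set R) eta phi : test_function setT eta ->
  test_function U phi -> test_function ([set: R] `*` U) (tensor eta phi).
Proof.
move=> [Ceta keta _] [Cphi kphi phiU].
have sub : closure [set z : R * R | tensor eta phi z != 0] `<=`
    closure [set x | eta x != 0] `*` closure [set t | phi t != 0].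
  move=> [x t] /= cl; split => /= A A_nbhs.
    have [|[y s] /= [+ Ay]] := cl (A `*` setT).
      by exists (A, setT) => //=; split => //; exact: filterT.
    by rewrite mulf_eq0 negb_or => /andP[ey _]; exists y; split => //; case: Ay.
  have [|[y s] /= [+ Ay]] := cl (setT `*` A).
    by exists (setT, A) => //=; split => //; exact: filterT.
  by rewrite mulf_eq0 negb_or => /andP[_ es]; exists s; split => //; case: Ay.
split.
- by move=> k; apply: Ck_onM; [exact: Ck_fst|exact: Ck_snd].
- by apply: subclosed_compact (compact_setX keta kphi) sub; exact: closed_closure.
- by move=> z /sub[_ /phiU].
Qed.

Lemma derive_tensor eta phi (v z : R * R) :
  test_function setT eta -> (forall k, Ck_on setT k phi) ->
  'D_v (tensor eta phi) z =
  v.2 * eta z.1 * phi^`()%classic z.2 + v.1 * eta^`()%classic z.1 * phi z.2.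
Proof.
move=> [Ceta _ _] Cphi.
have h1 := Ck_onT_derivable (Ck_fst (Ceta 1)) z v.
have h2 := Ck_onT_derivable (Ck_snd (Cphi 1)) z v.
have := deriveM h1 h2; rewrite /tensor => ->.
rewrite (@derive_comp_affine _ eta fst fst)//.
rewrite (@derive_comp_affine _ phi snd snd)//.
have [_ ->] := derive_scale v.1 (Ck_onT_derivable (Ceta 1) z.1 1).
have [_ ->] := derive_scale v.2 (Ck_onT_derivable (Cphi 1) z.2 1).
rewrite -!derive1E /GRing.scale/=; ring.
Qed.

End tensor_test_functions.

Section sums_over_two_nodes.
Context {R : realType}.

Lemma ord2_cases (i : 'I_2) : i = ord0 \/ i = ord_max.
Proof. by case: i => [[|[|//]] ?]; [left|right]; exact: val_inj. Qed.

Lemma ord_max_neq0 : (ord_max == ord0 :> 'I_2) = false.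
Proof. by []. Qed.

Definition edge_sign (i : 'I_2) : R := if i == ord0 then 1 else -1.

Lemma normr_edge_sign i : `|edge_sign i| = 1.
Proof. by rewrite /edge_sign; case: ifP => _; rewrite ?normrN normr1. Qed.

Lemma is_derive_simplex_param (i : 'I_2) (p : R -> R) (t dp : R) : is_derive t 1 p dp ->
  is_derive t 1 (fun s => simplex_param (p s) i) (edge_sign i * dp).
Proof.
rewrite /edge_sign /simplex_param => D0; have [->|->] := ord2_cases i.
  by rewrite eqxx mul1r.
rewrite ord_max_neq0; have D := is_deriveB (is_derive_cst (1 : R) t 1) D0.
by refine (is_derive_eq D _); rewrite sub0r mulN1r.
Qed.

Lemma sum_ord2 (V : nmodType) (F : 'I_2 -> V) :
  \sum_(i < 2) F i = F ord0 + F ord_max.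
Proof.
by rewrite big_ord_recl big_ord1; congr (_ + F _); exact: val_inj.
Qed.

Lemma sume_ord2 (F : 'I_2 -> \bar R) :
  (\sum_(i < 2) F i = F ord0 + F ord_max)%E.
Proof. exact: sum_ord2. Qed.

Lemma max_degree_two_node : max_degree (two_node_weight : 'I_2 -> 'I_2 -> R) = 1.
Proof.
rewrite /max_degree !big_ord_recl !big_ord0 /two_node_weight /=.
by rewrite !addr0 !add0r [Num.max 1 0]max_l// maxxx.
Qed.

End sums_over_two_nodes.

Section arithmetic_mean.
Context {R : realType}.

Definition amean (s t : R) : R := (s + t) / 2.

Lemma interpolation_amean : interpolation_function amean.
Proof.
have cont : continuous (fun z : R * R => amean z.1 z.2).
  move=> z; apply: cvgM; last exact: cvg_cst.
  by apply: cvgD; [exact: fst_continuous2|exact: snd_continuous2].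
split.
- by move=> s t s0 t0; rewrite divr_ge0 ?addr_ge0.
- exact: continuous_subspaceT.
- move=> k; apply: (@Ck_on_affine _ _ _ _ _ (fun v : R * R => amean v.1 v.2)) => //.
  by move=> h v x; rewrite /amean /= /GRing.scale/=; lra.
- by move=> s t _ _; rewrite /amean addrC.
- by move=> s t s0 t0; rewrite divr_gt0 ?addr_gt0.
- by rewrite /amean; lra.
- by move=> r s t _ _ rs; rewrite /amean; lra.
- by move=> l s t _ _ _; rewrite /amean; lra.
- by move=> l s t s' t' _ _ _ _ _ _; rewrite /amean; lra.
Qed.

Variable mu : vprob R 2.

Lemma vdens_ge0 i x : 0 <= vdens mu i x.
Proof.
by rewrite /vdens fine_ge0// Radon_Nikodym_SigmaFinite.f_ge0//; exact: vcomp_dominates.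
Qed.

Lemma measurable_vdens i : measurable_fun setT (vdens mu i).
Proof.
apply: (@measurableT_comp _ _ _ _ _ _ fine); first exact: fine_measurable.
exact: measurable_int (Radon_Nikodym_SigmaFinite.f_integrable (@vcomp_dominates _ _ mu i)).
Qed.

Lemma vbar_setT : vbar mu setT = 1%E.
Proof. exact: vcomp_mass. Qed.

Lemma vcomp_le1 i : (mu i setT <= 1)%E.
Proof.
rewrite -vbar_setT /vbar sume_ord2.
by have [->|->] := ord2_cases i; [rewrite leeDl|rewrite leeDr].
Qed.

(** Over every measurable set the sum of the two densities integrates to [vbar mu], as does the
    constant 1. The arithmetic mean sees the densities only through this sum. *)
Lemma vdens_sum : {ae vbar mu, forall x, vdens mu ord0 x + vdens mu ord_max x = 1}.
Proof.
pose f i := Radon_Nikodym_SigmaFinite.f (mu i) (vbar mu).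
have dom i := @vcomp_dominates _ _ mu i.
have If i : (vbar mu).-integrable setT (f i).
  exact: Radon_Nikodym_SigmaFinite.f_integrable.
have E : ae_eq (vbar mu) setT (fun x => f ord0 x + f ord_max x)%E (cst 1%E).
  apply: integral_ae_eq => //; first exact: integrableD.
  move=> A _ mA; rewrite integralD//; try exact: integrableS (If _).
  rewrite -!Radon_Nikodym_SigmaFinite.f_integral//.
  by rewrite integral_cst// mul1e; exact/esym/sume_ord2.
have FF := @ae_filter_ringOfSetsType _ _ _ (vbar mu).
apply: filterS E => x /(_ Logic.I); rewrite /vdens -/(f _) -/(f _) => E.
by rewrite -fineD ?E//; exact: Radon_Nikodym_SigmaFinite.f_fin_num.
Qed.

Lemma vtheta_amean i j : i != j ->
  {ae vbar mu, forall x, vtheta amean mu i j x = 2^-1}.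
Proof.
move=> ij; have FF := @ae_filter_ringOfSetsType _ _ _ (vbar mu).
have E := vdens_sum; apply: filterS E => x E; rewrite /vtheta /amean.
suff -> : vdens mu i x + vdens mu j x = 1 by rewrite mul1r.
have [i0|i1] := ord2_cases i; have [j0|j1] := ord2_cases j; subst.
- by rewrite eqxx in ij.
- exact: E.
- by rewrite addrC.
- by rewrite eqxx in ij.
Qed.

Lemma measurable_vtheta i j : measurable_fun setT (vtheta amean mu i j).
Proof.
apply: measurable_funM => //; apply: measurable_funD; exact: measurable_vdens.
Qed.

Lemma vtheta_ge0 i j x : 0 <= vtheta amean mu i j x.
Proof. by rewrite /vtheta /amean divr_ge0// addr_ge0 ?vdens_ge0. Qed.

End arithmetic_mean.

Section slices.
Context {R : realType}.

Lemma measurable_slice (A : set (measurableTypeR R)) (w : R -> R -> R) (t : R) :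
  measurable_fun ([set: measurableTypeR R] `*` A)
    (fun z : measurableTypeR R * measurableTypeR R => w z.2 z.1) ->
  measurable A -> A t -> measurable_fun [set: measurableTypeR R] (w t).
Proof.
move=> mw mA At.
apply: (@measurable_comp _ _ _ _ _ _ ([set: measurableTypeR R] `*` A)
  (fun z : measurableTypeR R * measurableTypeR R => w z.2 z.1) _
  (fun x : measurableTypeR R => (x, t) : measurableTypeR R * measurableTypeR R)) => //.
- exact: measurableX.
- by move=> _ [x _ <-].
Qed.

End slices.

Section bounded_functions.
Context d (T : measurableType d) {R : realType}.

Lemma bounded_integrable (mu : {finite_measure set T -> \bar R}) (f : T -> R) (a : R) :
  measurable_fun setT f -> (forall x, `|f x| <= a) ->
  mu.-integrable setT (EFin \o f).
Proof.
move=> mf fa; apply/integrableP; split; first exact/measurable_EFinP.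
apply: (@le_lt_trans _ _ (\int[mu]_x (cst a%:E x))%E).
  by apply: ge0_le_lower_integral => x _ //=; rewrite lee_fin.
by rewrite integral_cst// ltey_eq fin_numM// fin_num_measure.
Qed.

(** The missing inequality is [lower_integralZl] for the factor 1 / k and the function k f. *)
Lemma lower_integralZl_eq (mu : {measure set T -> \bar R}) (D : set T)
    (f : T -> \bar R) (k : R) : measurable D -> 0 <= k ->
  (forall x, D x -> 0 <= f x)%E ->
  (\int[mu]_(x in D) (k%:E * f x) = k%:E * \int[mu]_(x in D) f x)%E.
Proof.
move=> mD k0 f0; have [->|kn0] := eqVneq k 0.
  by rewrite mul0e integral0_eq// => x _; rewrite mul0e.
have kgt0 : 0 < k by rewrite lt_def kn0.
apply/eqP; rewrite eq_le lower_integralZl// andbT.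
have := @lower_integralZl _ _ _ mu D (fun x => k%:E * f x)%E k^-1 mD.
rewrite invr_ge0 => /(_ k0).
have kf0 x : D x -> (0 <= k%:E * f x)%E by move=> Dx; rewrite mule_ge0 ?lee_fin// f0.
move=> /(_ kf0).
have -> : (\int[mu]_(x in D) (k^-1%:E * (k%:E * f x)) = \int[mu]_(x in D) f x)%E.
  by apply: eq_integral => x _; rewrite muleA -EFinM mulVf// mul1e.
move=> /(lee_wpmul2l (k0 : (0 <= k%:E)%E)).
by rewrite muleA -EFinM divff// mul1e.
Qed.

End bounded_functions.

(** * Dual bounds from the weak equation *)

Section weak_formulation.
Context {R : realType}.
Variables (rho : R -> vprob R 2) (u : 'I_2 -> R -> R -> R)
  (v : 'I_2 -> 'I_2 -> R -> R -> R).
Hypothesis sol : continuity_equation two_node_weight amean 0 1 rho u v.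
Local Notation mu := (@lebesgue_measure R).
Local Notation I01 := (`[0%R, 1%R]%classic : set (measurableTypeR R)).

Definition exchange (t x : R) : R := v ord0 ord_max t x - v ord_max ord0 t x.

Definition transport_term (eta phi : R -> R) (i : 'I_2) : R :=
  \int[mu]_(t in `[0, 1]) \int[rho t i]_x (eta^`()%classic x * phi t * u i t x).

Definition exchange_term (eta phi : R -> R) : R :=
  \int[mu]_(t in `[0, 1]) \int[vbar (rho t)]_x
    (eta x * phi t * vtheta amean (rho t) ord0 ord_max x * exchange t x).

Lemma continuous_measurableT (f : R -> R) : continuous f ->
  measurable_fun [set: measurableTypeR R] f.
Proof. by move=> cf; exact: continuous_measurable_fun. Qed.

Lemma test_function_measurable (U : set R) (f : R -> R) :
  test_function U f -> measurable_fun [set: measurableTypeR R] f.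
Proof. by move=> tf; exact: continuous_measurableT (test_function_continuous tf). Qed.

(** The two nodes share a single edge and theta is symmetric, so the same exchange term enters at
    both nodes with opposite signs; the diagonal terms cancel. *)
Lemma weak_tensor (eta phi : R -> R) (a : R) (i : 'I_2) :
  test_function setT eta -> test_function (`]0, 1[ : set R) phi ->
  (forall x, `|eta x| <= a) ->
  \int[mu]_(t in `[0, 1]) (phi^`()%classic t * \int[rho t i]_x eta x) =
  - transport_term eta phi i
  - 2^-1 * (if i == ord0 then exchange_term eta phi else - exchange_term eta phi).
Proof.
move=> teta tphi etaa.
have [Ceta _ _] := teta; have [Cphi _ _] := tphi.
have ceta := test_function_continuous teta.
have meta : measurable_fun [set: measurableTypeR R] eta.
  exact: continuous_measurableT.
have := ce_weak sol i (test_function_tensor teta tphi).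
have -> : \int[mu]_(t in `[0, 1]) \int[rho t i]_x 'D_((0, 1) : R * R) (tensor eta phi) (x, t) =
    \int[mu]_(t in `[0, 1]) (phi^`()%classic t * \int[rho t i]_x eta x).
  apply: eq_Rintegral => t _; rewrite -RintegralZl//; last first.
    exact: (@bounded_integrable _ _ R (rho t i) eta a meta etaa).
  by apply: eq_Rintegral => x _; rewrite derive_tensor//=; ring.
have -> : \int[mu]_(t in `[0, 1]) \int[rho t i]_x
      ('D_((1, 0) : R * R) (tensor eta phi) (x, t) * u i t x) = transport_term eta phi i.
  apply: eq_Rintegral => t _; apply: eq_Rintegral => x _.
  by rewrite derive_tensor//=; ring.
move=> ->; congr (_ - _ * _); rewrite sum_ord2.
have diag j : \int[mu]_(t in `[0, 1]) \int[vbar (rho t)]_x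
    (tensor eta phi (x, t) * vtheta amean (rho t) j j x * (v j j t x - v j j t x) *
     two_node_weight j j) = 0.
  under eq_Rintegral do under eq_Rintegral do
    rewrite /two_node_weight eqxx mulr0.
  under eq_Rintegral do rewrite /Rintegral integral0.
  by rewrite /Rintegral integral0.
have [i0|i1] := ord2_cases i; subst i.
  rewrite eqxx -[RHS]add0r; congr (_ + _); first exact: diag ord0.
  apply: eq_Rintegral => t _; apply: eq_Rintegral => x _.
  by rewrite /exchange /two_node_weight mulr1.
rewrite ord_max_neq0 -[RHS]addr0; congr (_ + _); last exact: diag ord_max.
rewrite /exchange_term -fine_integralN; apply: eq_Rintegral => t _.
rewrite -fine_integralN; apply: eq_Rintegral => x _.
by rewrite /exchange /two_node_weight mulr1 /vtheta /amean /tensor; ring.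
Qed.

Lemma continuous_mass (eta : R -> R) (a : R) (i : 'I_2) :
  continuous eta -> (forall x, `|eta x| <= a) ->
  {within `[0, 1], continuous (fun t => \int[rho t i]_x eta x)}.
Proof.
move=> ceta etaa; have := ce_continuous sol.
rewrite /narrow_continuous => /(_ i eta ceta); apply.
exists (a); split; first exact: num_real.
by move=> y ay x _; apply: le_trans (etaa x) (ltW ay).
Qed.

Definition speed (i : 'I_2) : \bar R :=
  (\int[mu]_(t in `[0%R, 1%R]) \int[rho t i]_x `|u i t x|%:E)%E.

Definition exchange_rate : \bar R :=
  (\int[mu]_(t in `[0%R, 1%R]) \int[vbar (rho t)]_x
     `|vtheta amean (rho t) ord0 ord_max x * exchange t x|%:E)%E.

Lemma transport_term_bound (eta phi : R -> R) (b : R) i :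
  (forall x, `|eta^`()%classic x| <= b) -> (forall t, 0 <= phi t <= 1) ->
  (`|transport_term eta phi i|%:E <= b%:E * speed i)%E.
Proof.
move=> etab phi01.
have b0 : 0 <= b by apply: le_trans (etab 0).
apply: le_trans (le_abse_fine_integral _ _ _) _.
rewrite -lower_integralZl_eq//; last by move=> t _; exact: integral_ge0.
apply: ge0_le_lower_integral => t t01; first by rewrite lee_fin.
apply: le_trans (le_abse_fine_integral _ _ _) _.
rewrite -lower_integralZl_eq//.
apply: ge0_le_lower_integral => x _; first by rewrite lee_fin.
rewrite -EFinM lee_fin !normrM; apply: ler_wpM2r => //.
have /andP[p0 p1] := phi01 t.
by rewrite (ger0_norm p0) -[leRHS]mulr1 ler_pM.
Qed.

Lemma exchange_term_bound (eta phi : R -> R) (a : R) :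
  (forall x, `|eta x| <= a) -> (forall t, 0 <= phi t <= 1) ->
  (`|exchange_term eta phi|%:E <= a%:E * exchange_rate)%E.
Proof.
move=> etaa phi01.
have a0 : 0 <= a by apply: le_trans (etaa 0).
apply: le_trans (le_abse_fine_integral _ _ _) _.
rewrite -lower_integralZl_eq//; last by move=> t _; exact: integral_ge0.
apply: ge0_le_lower_integral => t t01; first by rewrite lee_fin.
apply: le_trans (le_abse_fine_integral _ _ _) _.
rewrite -lower_integralZl_eq//.
apply: ge0_le_lower_integral => x _; first by rewrite lee_fin.
rewrite -EFinM lee_fin -mulrA normrM; apply: ler_wpM2r => //.
have /andP[p0 p1] := phi01 t.
by rewrite normrM (ger0_norm p0) -[leRHS]mulr1 ler_pM.
Qed.

(** [cutoff_endpoints] applied to the integral of eta against [rho t i]: transport is paid by the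
    slope of eta, exchange by its height. The factor 1/2 before K is the one in front of the sum in
    the continuity equation. *)
Lemma dual_bound (eta : R -> R) (a b U K : R) (i : 'I_2) :
  test_function setT eta ->
  (forall x, `|eta x| <= a) -> (forall x, `|eta^`()%classic x| <= b) ->
  speed i = U%:E -> exchange_rate = K%:E ->
  \int[rho 0 i]_x eta x - \int[rho 1 i]_x eta x <= b * U + a * (K / 2).
Proof.
move=> teta etaa etab UE KE.
have ceta := test_function_continuous teta.
have := @cutoff_endpoints R _ (b * U + a * (K / 2)) (continuous_mass (i := i) ceta etaa).
apply => phi tphi phi01.
rewrite (weak_tensor i teta tphi etaa).
have := transport_term_bound i etab phi01; rewrite UE -EFinM lee_fin.
have := exchange_term_bound etaa phi01; rewrite KE -EFinM lee_fin.
rewrite !ler_norml => /andP[h1 h2] /andP[h3 _].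
by clear -h1 h2 h3; case: ifP => _; lra.
Qed.

(** Adding the two nodes cancels the exchange, so that only the slope of eta remains. This is what
    detects large distances, which the bounded Lipschitz distance cannot. *)
Lemma dual_bound_total (eta : R -> R) (a b U0 U1 : R) :
  test_function setT eta ->
  (forall x, `|eta x| <= a) -> (forall x, `|eta^`()%classic x| <= b) ->
  speed ord0 = U0%:E -> speed ord_max = U1%:E ->
  (\int[rho 0 ord0]_x eta x + \int[rho 0 ord_max]_x eta x) -
  (\int[rho 1 ord0]_x eta x + \int[rho 1 ord_max]_x eta x) <= b * (U0 + U1).
Proof.
move=> teta etaa etab U0E U1E.
have ceta := test_function_continuous teta.
pose m i t := \int[rho t i]_x eta x.
have cm i : {within `[0, 1], continuous (m i)} by exact: continuous_mass ceta etaa.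
have cm2 : {within `[0, 1], continuous (fun t => m ord0 t + m ord_max t)}.
  by move=> t; apply: cvgD; exact: cm.
apply: (cutoff_endpoints cm2) => phi tphi phi01.
have cphi' : {within `[0, 1], continuous (phi^`()%classic)}.
  exact: continuous_subspaceT (test_function_continuous_derive1 tphi).
have Im i : mu.-integrable `[0, 1] (EFin \o (fun t => phi^`()%classic t * m i t)).
  by apply: within_continuous_integrable => t; apply: cvgM; [exact: cphi'|exact: cm].
under eq_Rintegral do rewrite mulrDr.
rewrite RintegralD//.
rewrite !(weak_tensor _ teta tphi etaa) eqxx ord_max_neq0.
have := transport_term_bound ord0 etab phi01; rewrite U0E -EFinM lee_fin.
have := transport_term_bound ord_max etab phi01; rewrite U1E -EFinM lee_fin.
rewrite !ler_norml => /andP[h1 _] /andP[h3 _].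
by clear -h1 h3; lra.
Qed.

End weak_formulation.

(** * Lower bounds for the action *)

Section action_lower_bound.
Context {R : realType}.
Variables (rho : R -> vprob R 2) (u : 'I_2 -> R -> R -> R)
  (v : 'I_2 -> 'I_2 -> R -> R -> R).
Hypothesis sol : continuity_equation two_node_weight amean 0 1 rho u v.
Local Notation mu := (@lebesgue_measure R).
Local Open Scope ereal_scope.

Definition transport_energy (i : 'I_2) : \bar R :=
  \int[mu]_(t in `[0%R, 1%R]) \int[rho t i]_x (u i t x ^+ 2)%:E.

(** Twice the exchange part of the action at time t, after theta has been replaced by its almost
    sure value 1/2. *)
Definition exchange_density (t : R) : \bar R :=
  \int[vbar (rho t)]_x ((v ord0 ord_max t x ^+ 2 + v ord_max ord0 t x ^+ 2) / 2)%:E.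

Definition exchange_energy : \bar R :=
  \int[mu]_(t in `[0%R, 1%R]) exchange_density t.

Definition total_action : \bar R :=
  \int[mu]_(t in `[0%R, 1%R]) action two_node_weight amean (rho t)
    (fun i => u i t) (fun i j => v i j t).

Let mI : measurable (`[0%R, 1%R]%classic : set (measurableTypeR R)).
Proof. exact: measurable_itv. Qed.

Let muI : mu `[0%R, 1%R] <= 1%:E.
Proof. by rewrite lebesgue_measure_itv/= lte01 -EFinB subr0. Qed.

(** Cauchy-Schwarz twice: in space, where the mass of a node is at most 1, and in time, where the
    interval has length 1. *)
Lemma speed_energy i : speed rho u i ^+ 2 <= transport_energy i.
Proof.
rewrite -[leRHS]mul1e -[1]/(1%:E) -[X in X%:E * _]mulr1.
apply: lower_integral_cauchy_schwarz => // [t _|t _|t _].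
- by apply: integral_ge0 => x _; rewrite lee_fin.
- by apply: integral_ge0 => x _; rewrite lee_fin sqr_ge0.
rewrite -[X in X%:E * _]mulr1.
apply: lower_integral_cauchy_schwarz => // [|x _|x _].
- exact: vcomp_le1.
- by rewrite lee_fin sqr_ge0.
- by rewrite mul1e expe2 -EFinM lee_fin -expr2 real_normK ?num_real.
Qed.

Let mv i j t : (0 <= t <= 1)%R -> measurable_fun [set: measurableTypeR R] (v i j t).
Proof. by move=> t01; apply: (measurable_slice (ce_measurable_v sol i j)) => //=; rewrite in_itv. Qed.

Lemma vtheta_integral (nu : vprob R 2) i j (f : R -> R) : i != j ->
  measurable_fun [set: measurableTypeR R] f -> (forall x, (0 <= f x)%R) ->
  \int[vbar nu]_x (f x * vtheta amean nu i j x)%:E = \int[vbar nu]_x (f x / 2)%:E.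
Proof.
move=> ij mf f0; apply: ge0_ae_eq_integral => //.
- by apply/measurable_EFinP; apply: measurable_funM => //; exact: measurable_vtheta.
- by apply/measurable_EFinP; exact: measurable_funM.
- by move=> x _; rewrite lee_fin mulr_ge0// vtheta_ge0.
- by move=> x _; rewrite lee_fin divr_ge0.
have FF := @ae_filter_ringOfSetsType _ _ _ (vbar nu).
have E := vtheta_amean nu ij.
by apply: filterS E => x + _ => ->.
Qed.

Lemma exchange_rate_energy : exchange_rate rho v ^+ 2 <= exchange_energy.
Proof.
rewrite -[leRHS]mul1e -[1]/(1%:E) -[X in X%:E * _]mulr1.
apply: lower_integral_cauchy_schwarz => // [t _|t _|t t01].
- by apply: integral_ge0 => x _; rewrite lee_fin.
- by apply: integral_ge0 => x _; rewrite lee_fin divr_ge0 ?addr_ge0 ?sqr_ge0.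
have mw : measurable_fun [set: measurableTypeR R] (fun x => `|exchange v t x|%R).
  apply: (@measurableT_comp _ _ _ _ _ _ (@Num.norm R R)) => //.
  apply: measurable_funB; exact: mv.
have -> : \int[vbar (rho t)]_x `|vtheta amean (rho t) ord0 ord_max x * exchange v t x|%:E =
    \int[vbar (rho t)]_x (`|exchange v t x| / 2)%:E.
  rewrite -(@vtheta_integral _ ord0 ord_max)//.
  apply: eq_integral => x _; congr (_%:E).
  by rewrite normrM mulrC (ger0_norm (vtheta_ge0 _ _ _ _)).
rewrite -[X in X%:E * _]mulr1.
apply: lower_integral_cauchy_schwarz => //.
- by rewrite -[leRHS](vbar_setT (rho t)); exact: lexx.
- by move=> x _; rewrite lee_fin divr_ge0 ?addr_ge0 ?sqr_ge0.
(* The inequality is (p - q)^2 / 4 <= (p^2 + q^2) / 2, with equality exactly for antisymmetric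
   exchange. *)
move=> x _; rewrite mul1e expe2 -EFinM lee_fin -expr2 expr_div_n real_normK ?num_real//.
rewrite /exchange; set p := v _ _ _ _; set q := v _ _ _ _.
by have := sqr_ge0 (p + q); rewrite sqrrD sqrrB; lra.
Qed.

Lemma actionE t : (0 <= t <= 1)%R ->
  action two_node_weight amean (rho t) (fun i => u i t) (fun i j => v i j t) =
  \int[rho t ord0]_x (u ord0 t x ^+ 2)%:E +
  (\int[rho t ord_max]_x (u ord_max t x ^+ 2)%:E + (2^-1)%:E * exchange_density t).
Proof.
move=> t01; rewrite /action [X in X + _ = _]sume_ord2 -addeA; congr (_ + (_ + _ * _)).
rewrite !sume_ord2.
have diag i : \int[vbar (rho t)]_x
    (v i i t x ^+ 2 * vtheta amean (rho t) i i x * two_node_weight i i)%:E = 0.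
  by rewrite integral0_eq// => x _; rewrite /two_node_weight eqxx mulr0.
have offd i j : i != j -> \int[vbar (rho t)]_x
    (v i j t x ^+ 2 * vtheta amean (rho t) i j x * two_node_weight i j)%:E =
    \int[vbar (rho t)]_x (v i j t x ^+ 2 / 2)%:E.
  move=> ij; rewrite -(@vtheta_integral _ i j)//.
  - by apply: eq_integral => x _; rewrite /two_node_weight ij mulr1.
  - by apply: measurable_funX; exact: mv.
  - by move=> x; exact: sqr_ge0.
rewrite !diag add0e adde0 !offd// -ge0_integralD//; first last.
- by apply/measurable_EFinP; apply: measurable_funM => //; apply: measurable_funX; exact: mv.
- by move=> x _; rewrite lee_fin divr_ge0// sqr_ge0.
- by apply/measurable_EFinP; apply: measurable_funM => //; apply: measurable_funX; exact: mv.
- by move=> x _; rewrite lee_fin divr_ge0// sqr_ge0.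
by apply: eq_integral => x _; rewrite -EFinD -mulrDl.
Qed.

Lemma total_action_ge : transport_energy ord0 +
  (transport_energy ord_max + (2^-1)%:E * exchange_energy) <= total_action.
Proof.
have T0 i t : 0 <= \int[rho t i]_x (u i t x ^+ 2)%:E.
  by apply: integral_ge0 => x _; rewrite lee_fin sqr_ge0.
have D0 t : 0 <= exchange_density t.
  by apply: integral_ge0 => x _; rewrite lee_fin divr_ge0// addr_ge0 ?sqr_ge0.
have hD0 t : 0 <= (2^-1)%:E * exchange_density t by rewrite mule_ge0// lee_fin.
rewrite /exchange_energy -lower_integralZl_eq//; last first.
have step1 := @lower_integralD _ _ _ mu `[0%R, 1%R]%classic _ _ mI
  (fun t _ => T0 ord_max t) (fun t _ => hD0 t).
apply: (le_trans (leeD2l _ step1)).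
have ThD0 t : 0 <= \int[rho t ord_max]_x (u ord_max t x ^+ 2)%:E +
    (2^-1)%:E * exchange_density t by rewrite adde_ge0.
have step2 := @lower_integralD _ _ _ mu `[0%R, 1%R]%classic _ _ mI
  (fun t _ => T0 ord0 t) (fun t _ => ThD0 t).
apply: (le_trans step2).
apply: ge0_le_lower_integral => t.
  by move=> _; apply: adde_ge0; [exact: T0|exact: ThD0].
by rewrite /= in_itv/= => t01; rewrite actionE.
Qed.

End action_lower_bound.

(** * The bounded Lipschitz norm and its comparison with the action *)

Section bounded_lipschitz_norm.
Context {R : realType}.
Local Notation mu := (@lebesgue_measure R).

Lemma lebesgue_measureT_gt0 : (0 < mu setT)%E.
Proof.
apply: (@lt_le_trans _ _ (mu `[0, 1]%classic)).
  by rewrite lebesgue_measure_itv/= lte01 -EFinB subr0.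
by apply: le_measure => //; rewrite inE.
Qed.

(** A continuous function exceeding the essential supremum at a point would exceed it on a ball,
    which has positive Lebesgue measure. *)
Lemma le_Lnorm_oo (f : R -> R) (x : R) : continuous f ->
  (`|f x|%:E <= Lnorm mu +oo (EFin \o f))%E.
Proof.
move=> cf; rewrite unlock lebesgue_measureT_gt0 leNgt; apply/negP.
set s := ess_sup _ _ => sfx.
have [c sc cfx] : exists2 c : R, (s <= c%:E)%E & c < `|f x|.
  case: s sfx => [c| |] //.
    by rewrite lte_fin => cfx; exists c.
  by exists (`|f x| - 1); rewrite ?leNye// ltrBlDr ltrDl.
have [N [mN N0 fN]] := ess_sup_ge mu (abse \o (EFin \o f)).
have nf : continuous (fun y => `|f y|).
  by move=> y; apply: continuous_comp; [exact: cf|exact: norm_continuous].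
have /nbhs_ballP[e /= e0 He] : \forall y \near x, c < `|f y|.
  exact: (cvgr_gt _ (nf x)).
have bN : ball x e `<=` N.
  move=> y /He cfy; apply: fN => /= H.
  by have := le_trans H sc; rewrite lee_fin leNgt cfy.
have : (mu (ball x e) <= mu N)%E.
  by apply: le_measure => //; rewrite inE//; exact: measurable_ball.
by rewrite N0 lebesgue_measure_ball ?(ltW e0)// lee_fin leNgt mulrn_wgt0.
Qed.

Lemma Lnorm_oo_le (f : R -> R) (a : R) : (forall x, `|f x| <= a) ->
  (Lnorm mu +oo (EFin \o f) <= a%:E)%E.
Proof.
move=> fa; rewrite unlock lebesgue_measureT_gt0.
by apply/ess_supP; exists set0; split => // x /=; rewrite lee_fin fa.
Qed.

Lemma W12oo_norm_le1 (eta : R -> R) (a b : R) :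
  (forall x, `|eta x| <= a) -> (forall x, `|eta^`()%classic x| <= b) ->
  a ^+ 2 + b ^+ 2 <= 1 -> (W12oo_norm eta <= 1)%E.
Proof.
move=> ea eb ab; rewrite /W12oo_norm -[leRHS](_ : sqrte 1 = 1%E); last first.
  by rewrite /= sqrtr1.
rewrite lee_sqrt//; apply: (@le_trans _ _ (a ^+ 2 + b ^+ 2)%:E); last by rewrite lee_fin.
have a0 : 0 <= a by apply: le_trans (ea 0).
have b0 : 0 <= b by apply: le_trans (eb 0).
rewrite EFinD leeD// EFin_expe !expe2.
  by rewrite lee_pmul ?Lnorm_ge0// Lnorm_oo_le.
by rewrite lee_pmul ?Lnorm_ge0// Lnorm_oo_le.
Qed.

Lemma W12oo_norm_le1P (eta : R -> R) : test_function setT eta ->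
  (W12oo_norm eta <= 1)%E -> exists a b : R,
  [/\ forall x, `|eta x| <= a, forall x, `|eta^`()%classic x| <= b &
      a ^+ 2 + b ^+ 2 <= 1].
Proof.
move=> teta; rewrite /W12oo_norm -[leRHS](_ : sqrte 1 = 1%E); last first.
  by rewrite /= sqrtr1.
rewrite lee_sqrt//.
have ceta := test_function_continuous teta.
have ceta' := test_function_continuous_derive1 teta.
have := @Lnorm_ge0 _ _ _ mu +oo%E (EFin \o eta).
have := @Lnorm_ge0 _ _ _ mu +oo%E (EFin \o eta^`()%classic).
have := fun x => le_Lnorm_oo x ceta.
have := fun x => le_Lnorm_oo x ceta'.
case: (Lnorm _ _ _) => [a| |]; case: (Lnorm _ _ _) => [b| |] //=.
move=> hb ha _ _; rewrite -!EFinM -EFinD lee_fin => ab.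
by exists b, a; split => // x; rewrite -lee_fin.
Qed.

End bounded_lipschitz_norm.

Section bounded_lipschitz_lower_bound.
Context {R : realType}.
Local Notation mu := (@lebesgue_measure R).

Lemma test_function0 (U : set R) : test_function U (cst 0 : R -> R).
Proof.
apply: (@test_function_itv _ _ 1 0) => //.
  by move=> x /=; rewrite in_itv/= => /andP[h1 h2]; lra.
by move=> k; exact: Ck_on_cst.
Qed.

Lemma test_functionZ (U : set R) (k : R) (eta : R -> R) : k != 0 ->
  test_function U eta -> test_function U (fun x => k * eta x).
Proof.
move=> k0 [Ceta keta Ueta].
have E : [set x | k * eta x != 0] = [set x | eta x != 0].
  by apply/seteqP; split => x /=; rewrite mulf_eq0 negb_or k0.
split; rewrite ?E//.
by move=> m; apply: Ck_onM => //; exact: Ck_on_cst.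
Qed.

Lemma BL_norm_ge0 (m1 m2 : {finite_measure set (measurableTypeR R) -> \bar R}) :
  (0 <= BL_norm m1 m2)%E.
Proof.
apply: ereal_sup_ubound; exists (cst 0).
  split; first exact: test_function0.
  apply: (@W12oo_norm_le1 _ _ 0 0) => [x|x|].
  - by rewrite normr0.
  - by rewrite (_ : (cst 0)^`()%classic x = 0) ?normr0// derive1_cst.
  - by rewrite expr0n addr0.
by congr (_%:E); rewrite /Rintegral !integral0 subrr.
Qed.

Lemma vprob_eq_integral (n : nat) (m1 m2 : vprob R n) (i : 'I_n)
    (f : measurableTypeR R -> \bar R) : vprob_eq m1 m2 ->
  (\int[m1 i]_x f x = \int[m2 i]_x f x)%E.
Proof. by move=> e12; apply: eq_measure_integral => A mA _; exact: e12. Qed.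

Lemma action_ge0 (m : vprob R 2) (u : 'I_2 -> R -> R) (v : 'I_2 -> 'I_2 -> R -> R) :
  (0 <= action two_node_weight amean m u v)%E.
Proof.
apply: adde_ge0.
  by apply: sume_ge0 => i _; apply: integral_ge0 => x _; rewrite lee_fin sqr_ge0.
apply: mule_ge0; first by rewrite lee_fin.
apply: sume_ge0 => i _; apply: sume_ge0 => j _; apply: integral_ge0 => x _.
rewrite lee_fin mulr_ge0 ?ler0n//.
by apply: mulr_ge0; [exact: sqr_ge0|exact: vtheta_ge0].
Qed.

Lemma finite_action (rho : R -> vprob R 2) u v (e : R) :
  continuity_equation two_node_weight amean 0 1 rho u v ->
  (total_action rho u v <= e%:E)%E -> exists s0 s1 k : R,
  [/\ speed rho u ord0 = s0%:E, speed rho u ord_max = s1%:E,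
      exchange_rate rho v = k%:E & s0 ^+ 2 + (s1 ^+ 2 + k ^+ 2 / 2) <= e].
Proof.
move=> sol /(le_trans (total_action_ge sol)) Le.
have s_ge0 i : (0 <= speed rho u i)%E.
  by apply: integral_ge0 => t _; apply: integral_ge0 => x _; rewrite lee_fin.
have x_ge0 : (0 <= exchange_rate rho v)%E.
  by apply: integral_ge0 => t _; apply: integral_ge0 => x _; rewrite lee_fin.
have := s_ge0 ord0; have := s_ge0 ord_max; have := x_ge0.
have : (speed rho u ord0 ^+ 2 + (speed rho u ord_max ^+ 2 +
    (2^-1)%:E * exchange_rate rho v ^+ 2) <= e%:E)%E.
  apply: le_trans Le; apply: leeD; first exact: speed_energy.
  apply: leeD; first exact: speed_energy.
  apply: lee_wpmul2l; first by rewrite lee_fin.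
  exact: (exchange_rate_energy sol).
rewrite !expe2.
case: (speed rho u ord0) => [s0| |]; case: (speed rho u ord_max) => [s1| |];
  case: (exchange_rate rho v) => [k| |] //.
- rewrite -!EFinM -!EFinD lee_fin => h _ _ _; exists s0, s1, k; split => //.
  by rewrite !expr2 (mulrC (k * k)).
all: rewrite ?mulyy ?gt0_muley ?lte_fin ?invr_gt0 ?ltr0n// -?EFinM ?addye// ?addey//.
Qed.

(** Curves of infinite action impose no constraint on the infimum, so only real bounds e on the
    action need to be considered. *)
Lemma W_dyn_geP (m1 m2 : vprob R 2) (y : \bar R) : (0 <= y)%E ->
  (forall rho u v (e : R), continuity_equation two_node_weight amean 0 1 rho u v ->
    vprob_eq (rho 0) m1 -> vprob_eq (rho 1) m2 ->
    (total_action rho u v <= e%:E)%E -> (y ^+ 2 <= e%:E)%E) ->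
  (y <= W_dyn two_node_weight amean m1 m2)%E.
Proof.
move=> y0 H; rewrite -[y]gee0_abs// -sqrte_sqr /W_dyn lee_sqrt.
  apply: le_ereal_inf_tmp => _ [rho [u [v [sol r0 r1 ->]]]].
  rewrite -/(total_action rho u v).
  have [->|ey] := eqVneq (total_action rho u v) +oo%E; first exact: leey.
  have a0 : (0 <= total_action rho u v)%E.
    by apply: integral_ge0 => t _; exact: action_ge0.
  have := H rho u v (fine (total_action rho u v)) sol r0 r1.
  have fin : total_action rho u v \is a fin_num by rewrite ge0_fin_numE// ltey.
  by rewrite fineK//; apply.
apply: le_ereal_inf_tmp => _ [rho [u [v [sol r0 r1 ->]]]].
by apply: integral_ge0 => t _; exact: action_ge0.
Qed.

(** At a node, [dual_bound] gives b s + a k / 2 with a^2 + b^2 <= 1, hence at most the square root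
    of s^2 + k^2 / 4. The two squares add up to s0^2 + s1^2 + k^2 / 2, which is exactly the lower
    bound for the action, so no constant is lost. *)
Theorem d_BL_le_W_dyn (m1 m2 : vprob R 2) :
  (d_BL m1 m2 <= W_dyn two_node_weight amean m1 m2)%E.
Proof.
apply: W_dyn_geP; first exact: sqrte_ge0.
move=> rho u v e sol r0 r1 Le.
have [s0 [s1 [k [s0E s1E kE sk]]]] := finite_action sol Le.
rewrite /d_BL sqr_sqrte; last by apply: sume_ge0 => i _; rewrite expe_ge0// BL_norm_ge0.
have bl i (s : R) : speed rho u i = s%:E ->
    (BL_norm (m1 i) (m2 i) ^+ 2 <= (s ^+ 2 + (k / 2) ^+ 2)%:E)%E.
  move=> sE; set S := s ^+ 2 + _.
  have S0 : 0 <= S by rewrite addr_ge0// sqr_ge0.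
  have : (BL_norm (m1 i) (m2 i) <= (Num.sqrt S)%:E)%E.
    apply: ge_ereal_sup => _ [eta [teta /(W12oo_norm_le1P teta)[a [b [ea eb ab]]]] <-].
    rewrite lee_fin; have := dual_bound sol teta ea eb sE kE.
    rewrite /Rintegral (vprob_eq_integral _ _ r0) (vprob_eq_integral _ _ r1).
    move=> /le_trans; apply.
    have [neg|pos] := lerP (b * s + a * (k / 2)) 0.
      exact: le_trans neg (sqrtr_ge0 _).
    rewrite -[leLHS]ger0_norm ?(ltW pos)// -sqrtr_sqr ler_sqrt// /S.
    (* Cauchy-Schwarz in the plane, through Lagrange's identity: the defect is (a s - b c)^2. *)
    set c := k / 2; apply: (@le_trans _ _ ((a ^+ 2 + b ^+ 2) * (s ^+ 2 + c ^+ 2))).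
      rewrite -subr_ge0 (_ : _ - _ = (a * s - b * c) ^+ 2) ?sqr_ge0//; ring.
    by rewrite ler_piMl// addr_ge0// sqr_ge0.
  move=> h; have := lee_pmul (BL_norm_ge0 _ _) (BL_norm_ge0 _ _) h h.
  by rewrite -EFinM -expr2 sqr_sqrtr.
rewrite sume_ord2; apply: le_trans (leeD (bl _ _ s0E) (bl _ _ s1E)) _.
by rewrite -EFinD lee_fin; apply: le_trans sk; rewrite !expr2; lra.
Qed.

(** Only the slope b of psi enters, so a wide and flat psi makes the left side large for distant
    measures. The factor 2 is not optimal; it leaves room in ((s0 + s1) / 2)^2 <= (s0^2 + s1^2) /
    2. *)
Lemma total_mass_le_W_dyn (m1 m2 : vprob R 2) (psi : R -> R) (a b : R) :
  test_function setT psi -> (forall x, `|psi x| <= a) ->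
  (forall x, `|psi^`()%classic x| <= b) -> 0 < b ->
  ((((\int[m1 ord0]_x psi x + \int[m1 ord_max]_x psi x) -
   (\int[m2 ord0]_x psi x + \int[m2 ord_max]_x psi x)) / (2 * b))%R%:E
  <= W_dyn two_node_weight amean m1 m2)%E.
Proof.
move=> tpsi pa pb b0; set I := _ - _.
have [I0|I0] := ltP I 0.
  apply: (@le_trans _ _ 0%E); last exact: sqrte_ge0.
  by rewrite lee_fin pmulr_lle0 ?(ltW I0)// invr_gt0 mulr_gt0.
apply: W_dyn_geP; first by rewrite lee_fin divr_ge0// mulr_ge0// ltW.
move=> rho u v e sol r0 r1 Le.
have [s0 [s1 [k [s0E s1E kE sk]]]] := finite_action sol Le.
have := dual_bound_total sol tpsi pa pb s0E s1E.
rewrite /Rintegral !(vprob_eq_integral _ _ r0) !(vprob_eq_integral _ _ r1) -/I => h.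
rewrite expe2 -EFinM lee_fin; apply: le_trans sk.
have : I / (2 * b) <= (s0 + s1) / 2.
  by rewrite ler_pdivrMr ?mulr_gt0//; apply: le_trans h _; lra.
have : 0 <= I / (2 * b) by rewrite divr_ge0// mulr_ge0// ltW.
move: (I / _) => c c0 cs; have := sqr_ge0 (s0 - s1); have := sqr_ge0 k.
have := sqr_ge0 s0; have := sqr_ge0 s1.
have : c * c <= (s0 + s1) / 2 * ((s0 + s1) / 2) by apply: ler_pM.
by rewrite !expr2; lra.
Qed.

End bounded_lipschitz_lower_bound.

(** * The two-point graph distance *)

Section graph_distance_amean.
Context {R : realType}.
Local Notation mu := (@lebesgue_measure R).
Local Notation q := (two_node_weight : 'I_2 -> 'I_2 -> R).

Lemma lebesgue_measure01 : mu `[0, 1]%classic = 1%E.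
Proof. by rewrite lebesgue_measure_itv/= lte01 -EFinB subr0. Qed.

Lemma integral01_cst (c : R) : (\int[mu]_(t in `[0%R, 1%R]) c%:E = c%:E)%E.
Proof.
rewrite (_ : (fun=> c%:E) = cst c%:E)// integral_cst; last exact: measurable_itv.
by rewrite -[RHS]mule1; congr (_ * _)%E; exact: lebesgue_measure01.
Qed.

Lemma test_function_eq0 {V : normedModType R} (U : set V) (eta : V -> R) (x : V) :
  test_function U eta -> ~ U x -> eta x = 0.
Proof.
move=> [_ _ sU] nUx; apply: contrapT => /eqP e0; apply: nUx; apply: sU.
exact: subset_closure.
Qed.

(** On the simplex p_1 + p_2 = 1, so theta is 1/2 off the diagonal and p_i changes at the rate (v_12
    - v_21) / 4, up to the sign of the node. *)
Lemma graph_flux_bound (p : R -> 'I_2 -> R) v (K : R) (i : 'I_2) :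
  graph_continuity_equation q amean p v ->
  (\int[mu]_(t in `[0%R, 1%R]) `|(v t ord0 ord_max - v t ord_max ord0) / 4|%:E = K%:E)%E ->
  p 0 i - p 1 i <= K.
Proof.
move=> sol KE.
have := @cutoff_endpoints R _ K (gce_continuous sol (i:=i)); apply => phi tphi phi01.
rewrite (gce_weak sol i tphi).
set I := Rintegral _ _ _; suff : `|I| <= K by rewrite ler_norml => /andP[]; lra.
rewrite -lee_fin -KE /I; apply: le_trans (le_abse_fine_integral _ _ _) _.
apply: ge0_le_lower_integral => t; rewrite ?lee_fin// => t01.
have pt : p t ord0 + p t ord_max = 1.
  by have := gce_simplex sol; move: t01; rewrite /= in_itv/= => t01 /(_ _ t01)[_]; rewrite sum_ord2.
have /andP[p0 p1] := phi01 t.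
have -> : 2^-1 * (\sum_(j < 2) amean (p t i) (p t j) * (v t i j - v t j i) * q i j) =
    edge_sign i * ((v t ord0 ord_max - v t ord_max ord0) / 4).
  rewrite sum_ord2 /amean /two_node_weight /edge_sign.
  have [->|->] := ord2_cases i; rewrite ?eqxx ?ord_max_neq0.
    by rewrite pt eq_sym ord_max_neq0 mulr0 add0r mulr1; lra.
  by rewrite (addrC (p t ord_max)) pt mulr0 addr0 mulr1; lra.
rewrite normrM (ger0_norm p0) normrM normr_edge_sign.
by rewrite mul1r ler_piMl.
Qed.

Lemma graph_action_ge0 (p : R -> 'I_2 -> R) v (t : R) :
  graph_continuity_equation q amean p v -> `[0, 1]%classic t ->
  (0 <= (2^-1 * \sum_(i < 2) \sum_(j < 2) v t i j ^+ 2 * amean (p t i) (p t j) * q i j)%:E)%E.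
Proof.
move=> sol; rewrite /= in_itv/= => t01; have [pt0 _] := gce_simplex sol t01.
rewrite lee_fin mulr_ge0//; apply: sumr_ge0 => i _; apply: sumr_ge0 => j _.
by rewrite mulr_ge0 ?ler0n// mulr_ge0 ?sqr_ge0// divr_ge0// addr_ge0.
Qed.

(** Cauchy-Schwarz in time, with ((a - b) / 4)^2 bounded by half of the action density (a^2 + b^2) /
    4. The endpoints are arbitrary: outside the simplex no curve exists and the distance is
    infinite, so points off the strip need no separate treatment later. *)
Lemma W_graph_ge (p0 p1 : 'I_2 -> R) :
  ((2 * (p0 ord0 - p1 ord0) ^+ 2)%:E <= W_graph q amean p0 p1 ^+ 2)%E.
Proof.
have nn : (0 <= ereal_inf [set e : \bar R | exists p v,
    [/\ graph_continuity_equation q amean p v, p 0%R =1 p0, p 1%R =1 p1 &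
        e = (\int[lebesgue_measure]_(t in `[0%R, 1%R])
          (2^-1 * \sum_(i < 2) \sum_(j < 2)
             v t i j ^+ 2 * amean (p t i) (p t j) * q i j)%R%:E)%E]])%E.
  apply: le_ereal_inf_tmp => _ [p [v [sol _ _ ->]]].
  by apply: integral_ge0 => t; exact: graph_action_ge0.
rewrite /W_graph sqr_sqrte//; apply: le_ereal_inf_tmp => _ [p [v [sol e0 e1 ->]]].
set act := (X in (_ <= X)%E).
set flux := (\int[mu]_(t in `[0%R, 1%R]) `|(v t ord0 ord_max - v t ord_max ord0) / 4|%:E)%E.
have flux0 : (0 <= flux)%E by apply: integral_ge0 => t _; rewrite lee_fin.
have CS : (flux ^+ 2 <= (2^-1)%:E * act)%E.
  rewrite -[X in (X%:E * _)%E]mul1r.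
  apply: lower_integral_cauchy_schwarz => [||||t _|t|t].
  - exact: measurable_itv.
  - by rewrite -[leRHS]lebesgue_measure01; exact: lexx.
  - by [].
  - by [].
  - by rewrite lee_fin.
  - exact: graph_action_ge0.
  rewrite /= in_itv/= => t01; have [_] := gce_simplex sol t01.
  rewrite sum_ord2 => pt.
  rewrite !sum_ord2 /two_node_weight !eqxx ord_max_neq0 eq_sym ord_max_neq0.
  rewrite /amean (addrC (p t ord_max)) pt -!EFinM lee_fin -expr2.
  rewrite real_normK ?num_real// expr_div_n.
  move: (v t ord0 ord_max) (v t ord_max ord0) => a b.
  by have := sqr_ge0 (a + b); rewrite sqrrD sqrrB /= !mulr0 !mulr1 add0r addr0; lra.
move: flux0 CS; rewrite -/flux expe2; case fluxE : flux => [K| |] //; last first.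
  rewrite mulyy; case: act => [e| |] //; rewrite ?leey// gt0_muleNy ?lte_fin//.
case: act => [e| |]; [|by rewrite leey|by rewrite gt0_muleNy ?lte_fin].
rewrite -!EFinM !lee_fin => K0 CS.
have h1 := graph_flux_bound ord0 sol fluxE.
have h2 := graph_flux_bound ord_max sol fluxE.
have S0 : p 0 ord0 + p 0 ord_max = 1.
  by have [] := @gce_simplex _ _ _ _ _ _ sol 0 (introT andP (conj (lexx 0) ler01)); rewrite sum_ord2.
have S1 : p 1 ord0 + p 1 ord_max = 1.
  by have [] := @gce_simplex _ _ _ _ _ _ sol 1 (introT andP (conj ler01 (lexx 1))); rewrite sum_ord2.
have {h1 h2} : `|p0 ord0 - p1 ord0| <= K.
  by rewrite -e0 -e1 ler_norml; lra.
move=> h; have : `|p0 ord0 - p1 ord0| * `|p0 ord0 - p1 ord0| <= K * K by apply: ler_pM.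
rewrite -expr2 real_normK ?num_real//; lra.
Qed.

Lemma d_interval_ge (r s : R) :
  ((2 * (r - s) ^+ 2)%:E <= d_interval q amean r s ^+ 2)%E.
Proof. exact: (W_graph_ge (simplex_param r) (simplex_param s)). Qed.

(** The choice v_12 = - v_21 gives equality in the bound of [W_graph_ge]; the value 2 (s - r) makes
    the rate (v_12 - v_21) / 4 equal to s - r. *)
Definition geodesic_velocity (r s : R) (i j : 'I_2) : R :=
  2 * (s - r) * ((i == ord0)%:R - (j == ord0)%:R).

Lemma amean_geodesic (r s t : R) (i j : 'I_2) :
  amean (simplex_param (r + t * (s - r)) i) (simplex_param (r + t * (s - r)) j) *
    geodesic_velocity r s i j = (s - r) * ((i == ord0)%:R - (j == ord0)%:R).
Proof.
rewrite /amean /simplex_param /geodesic_velocity.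
by have [->|->] := ord2_cases i; have [->|->] := ord2_cases j;
  rewrite ?eqxx ?ord_max_neq0 /=; lra.
Qed.

Lemma geodesic_energy (r s t : R) (i j : 'I_2) :
  geodesic_velocity r s i j ^+ 2 *
    amean (simplex_param (r + t * (s - r)) i) (simplex_param (r + t * (s - r)) j) =
  2 * (s - r) ^+ 2 * ((i == ord0)%:R - (j == ord0)%:R) ^+ 2.
Proof.
by rewrite expr2 -mulrA mulrC [_ * amean _ _]mulrC amean_geodesic /geodesic_velocity; ring.
Qed.

Lemma geodesic_solution (r s : R) : 0 <= r <= 1 -> 0 <= s <= 1 ->
  graph_continuity_equation q amean
    (fun t => simplex_param (r + t * (s - r))) (fun=> geodesic_velocity r s).
Proof.
move=> /andP[r0 r1] /andP[s0 s1].
have dp i (t : R) := is_derive_simplex_param i (is_derive_segment r s t).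
have cp i : continuous (fun t : R => simplex_param (r + t * (s - r)) i).
  by move=> t; apply: derivable_continuous1; have [] := dp i t.
split.
- move=> t /andP[t0 t1].
  have h1 : 0 <= r + t * (s - r).
    have : 0 <= (1 - t) * r by rewrite mulr_ge0// subr_ge0.
    by have := mulr_ge0 t0 s0; lra.
  have h2 : r + t * (s - r) <= 1.
    have : 0 <= t * (1 - s) by rewrite mulr_ge0// subr_ge0.
    have : 0 <= (1 - t) * (1 - r) by rewrite mulr_ge0// subr_ge0.
    lra.
  split; last by rewrite sum_ord2 /simplex_param eqxx ord_max_neq0 subrKC.
  move=> i; rewrite /simplex_param; case: ifP => // _; lra.
- by move=> i; exact: continuous_subspaceT (cp i).
- by move=> i j; exact: measurable_cst.
- move=> i j; rewrite (_ : (fun t => _) = cst ((s - r) * ((i == ord0)%:R - (j == ord0)%:R))).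
    apply: open_integrable_locally; first exact: interval_open.
    apply/integrableP; split; first exact/measurable_EFinP/measurable_cst.
    apply: (@le_lt_trans _ _ (\int[mu]_(t in `[0%R, 1%R])
        `|(s - r) * ((i == ord0)%:R - (j == ord0)%:R)|%:E)%E); last first.
      by rewrite integral01_cst ltry.
    apply: ge0_subset_integral.
    - exact: measurable_itv.
    - exact: measurable_itv.
    - exact: (measurable_cst (`|(s - r) * ((i == ord0)%:R - (j == ord0)%:R)|%:E : \bar R)).
    - by move=> t _; rewrite lee_fin.
    - by move=> t; rewrite /= !in_itv/= => /andP[t0 t1]; rewrite !ltW.
  by apply/funext => t; rewrite amean_geodesic.
- move=> eta i teta.
  have -> : \int[mu]_(t in `[0, 1]) (eta t * (2^-1 * \sum_(j < 2)
      amean (simplex_param (r + t * (s - r)) i) (simplex_param (r + t * (s - r)) j) *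
      (geodesic_velocity r s i j - geodesic_velocity r s j i) * q i j)) =
      \int[mu]_(t in `[0, 1]) (eta t * (edge_sign i * (s - r))).
    apply: eq_Rintegral => t _; congr (_ * _); rewrite sum_ord2.
    have gvN j : amean (simplex_param (r + t * (s - r)) i) (simplex_param (r + t * (s - r)) j) *
        (geodesic_velocity r s i j - geodesic_velocity r s j i) =
        2 * ((s - r) * ((i == ord0)%:R - (j == ord0)%:R)).
      rewrite -(amean_geodesic r s t) mulrCA; congr (_ * _).
      by rewrite /geodesic_velocity; ring.
    rewrite !gvN /edge_sign /two_node_weight.
    by have [->|->] := ord2_cases i; rewrite ?eqxx ?ord_max_neq0 /=; lra.
  (* F vanishes at 0 and 1 with eta, so the integral of its derivative is 0; by the product rule
     this is the weak equation. *)
  pose F t := eta t * simplex_param (r + t * (s - r)) i.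
  have dF (t : R) : is_derive t 1 F (eta t * (edge_sign i * (s - r)) +
      eta^`()%classic t * simplex_param (r + t * (s - r)) i).
    have D := is_deriveM (is_derive_test_function t teta) (dp i t).
    by refine (is_derive_eq D _); rewrite /GRing.scale/= [X in _ + X]mulrC.
  have F'E : F^`()%classic = fun t : R => eta t * (edge_sign i * (s - r)) +
      eta^`()%classic t * simplex_param (r + t * (s - r)) i.
    by apply/funext => t; rewrite derive1E (@derive_val _ _ _ _ _ _ _ (dF t)).
  have ceta := test_function_continuous teta.
  have ceta' := test_function_continuous_derive1 teta.
  have c1 : continuous (fun t : R => eta t * (edge_sign i * (s - r))).
    by move=> t; apply: cvgM; [exact: ceta|exact: cvg_cst].
  have c2 : continuous (fun t : R => eta^`()%classic t * simplex_param (r + t * (s - r)) i).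
    by move=> t; apply: cvgM; [exact: ceta'|exact: cp].
  have cF' : continuous F^`()%classic.
    by rewrite F'E => t; apply: cvgD; [exact: c1|exact: c2].
  have dF1 (t : R) : derivable F t 1 by have [] := dF t.
  have := Rintegral_derive1 ltr01 dF1 cF'.
  rewrite {1}F'E RintegralD; last 3 first.
  + exact: measurable_itv.
  + exact: within_continuous_integrable (continuous_subspaceT c1).
  + exact: within_continuous_integrable (continuous_subspaceT c2).
  rewrite /F !(test_function_eq0 teta); try by rewrite /= in_itv/= ltxx ?andbF.
  by rewrite !mul0r subrr => /eqP; rewrite addrC addr_eq0 => /eqP.
Qed.

Lemma d_interval_le (r s : R) : 0 <= r <= 1 -> 0 <= s <= 1 ->
  (d_interval q amean r s ^+ 2 <= (2 * (r - s) ^+ 2)%:E)%E.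
Proof.
move=> r01 s01; rewrite /d_interval /W_graph.
set E := ereal_inf _; have E0 : (0 <= E)%E.
  apply: le_ereal_inf_tmp => _ [p [v [sol _ _ ->]]].
  by apply: integral_ge0 => t; exact: graph_action_ge0.
rewrite sqr_sqrte//; apply: ereal_inf_lbound.
exists (fun t => simplex_param (r + t * (s - r))), (fun=> geodesic_velocity r s).
split.
- exact: geodesic_solution.
- by move=> i; rewrite mul0r addr0.
- by move=> i; rewrite mul1r subrKC.
rewrite -[LHS]integral01_cst; apply: eq_integral => t _; congr (_%:E); rewrite !sum_ord2.
rewrite /two_node_weight !eqxx ord_max_neq0 [ord0 == _]eq_sym ord_max_neq0.
by rewrite !geodesic_energy !eqxx ord_max_neq0 /= !expr2; lra.
Qed.

End graph_distance_amean.

(** * Conditional densities *)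

Section measure_with_density.
Context d (T : measurableType d) {R : realType}.
Variables (mu : {measure set T -> \bar R}) (w : T -> R).
Local Open Scope ereal_scope.

(** The proofs are arguments so that the structures of measure and of finite measure can be attached
    to the term. *)
Definition mdens (mw : measurable_fun setT w) (w0 : forall x, (0 <= w x)%R)
  (iw : \int[mu]_x (w x)%:E < +oo) (A : set T) : \bar R :=
  \int[mu]_(x in A) (w x)%:E.

Hypotheses (mw : measurable_fun setT w) (w0 : forall x, (0 <= w x)%R)
  (iw : \int[mu]_x (w x)%:E < +oo).
Local Notation nu := (mdens mw w0 iw).

Let nu0 : nu set0 = 0. Proof. by rewrite /mdens integral_set0. Qed.

Let nu_ge0 A : 0 <= nu A.
Proof. by apply: integral_ge0 => x _; rewrite lee_fin. Qed.

Let nu_sigma_additive : semi_sigma_additive nu.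
Proof.
apply: (@semi_sigma_additive_nng_induced _ _ _ mu (EFin \o w)).
  exact/measurable_EFinP.
by move=> x; rewrite lee_fin.
Qed.

HB.instance Definition _ := isMeasure.Build _ _ _ nu nu0 nu_ge0 nu_sigma_additive.

Let nu_finite : fin_num_fun nu.
Proof.
move=> A mA; rewrite ge0_fin_numE//; apply: le_lt_trans iw.
apply: ge0_subset_integral => //; first exact/measurable_EFinP.
by move=> x _; rewrite lee_fin.
Qed.

HB.instance Definition _ := Measure_isFinite.Build _ _ _ nu nu_finite.

End measure_with_density.

Section measure_with_density_integral.
Context d (T : measurableType d) {R : realType}.
Variables (mu : {sigma_finite_measure set T -> \bar R}) (w : T -> R).
Local Open Scope ereal_scope.
Hypotheses (mw : measurable_fun setT w) (w0 : forall x, (0 <= w x)%R)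
  (iw : \int[mu]_x (w x)%:E < +oo).
Local Notation nu := (mdens mw w0 iw).

(** The Radon-Nikodym derivative of [nu] has the same integral as w over every measurable set, so
    the two agree almost everywhere and the change of variables for the derivative applies. *)
Lemma integral_mdens (g : T -> \bar R) : measurable_fun setT g ->
  (forall x, 0 <= g x) -> \int[nu]_x g x = \int[mu]_x ((w x)%:E * g x).
Proof.
move=> mg g0.
have dom : nu `<< mu.
  apply/null_content_dominatesP => A mA A0; apply: null_set_integral => //.
  by apply: measurable_funTS; exact/measurable_EFinP.
pose f := Radon_Nikodym_SigmaFinite.f nu mu.
rewrite -(Radon_Nikodym_SigmaFinite.change_of_variables dom)//.
have mf : measurable_fun setT f.
  exact: measurable_int (Radon_Nikodym_SigmaFinite.f_integrable dom).
have E : ae_eq mu setT f (EFin \o w).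
  apply: integral_ae_eq => //.
  - exact: Radon_Nikodym_SigmaFinite.f_integrable.
  - exact/measurable_EFinP.
  - by move=> A _ mA; rewrite -Radon_Nikodym_SigmaFinite.f_integral.
apply: ge0_ae_eq_integral => //.
- exact: emeasurable_funM.
- by apply: emeasurable_funM => //; exact/measurable_EFinP.
- by move=> x _; rewrite mule_ge0//; exact: Radon_Nikodym_SigmaFinite.f_ge0.
- by move=> x _; rewrite mule_ge0// lee_fin.
have FF := @ae_filter_ringOfSetsType _ _ _ mu.
by apply: filterS E => x + _ => /(_ Logic.I); rewrite -/f => ->; rewrite muleC.
Qed.

End measure_with_density_integral.

Section weighted_pushforward.
Context d d' (T : measurableType d) (T' : measurableType d') {R : realType}.
Variables (mu : {sigma_finite_measure set T -> \bar R}) (w : T -> R) (Phi : T -> T').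
Local Open Scope ereal_scope.

(** The image under [Phi] of the measure with density w. It produces the law of the particles at a
    given time as well as their space-time law. *)
Definition wpush (mw : measurable_fun setT w) (w0 : forall x, (0 <= w x)%R)
  (iw : \int[mu]_x (w x)%:E < +oo) (mPhi : measurable_fun setT Phi)
  (A : set T') : \bar R := mdens mw w0 iw (Phi @^-1` A).

Hypotheses (mw : measurable_fun setT w) (w0 : forall x, (0 <= w x)%R)
  (iw : \int[mu]_x (w x)%:E < +oo) (mPhi : measurable_fun setT Phi).
Local Notation nu := (wpush mw w0 iw mPhi).

Let mpre A : measurable A -> measurable (Phi @^-1` A).
Proof. by move=> mA; rewrite -[X in measurable X]setTI; exact: mPhi. Qed.

Let nu0 : nu set0 = 0. Proof. by rewrite /wpush preimage_set0 measure0. Qed.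

Let nu_ge0 A : 0 <= nu A.
Proof. by apply: integral_ge0 => x _; rewrite lee_fin. Qed.

Let nu_sigma_additive : semi_sigma_additive nu.
Proof.
move=> F mF tF mUF; rewrite /wpush preimage_bigcup.
apply: measure_semi_sigma_additive.
- by move=> n; exact: mpre.
- apply/trivIsetP => /= i j _ _ ij; rewrite -preimage_setI.
  by move/trivIsetP : tF => /(_ _ _ _ _ ij) ->//; rewrite preimage_set0.
- by rewrite -preimage_bigcup; exact: mpre.
Qed.

HB.instance Definition _ := isMeasure.Build _ _ _ nu nu0 nu_ge0 nu_sigma_additive.

Let nu_finite : fin_num_fun nu.
Proof. by move=> A mA; rewrite /wpush fin_num_measure//; exact: mpre. Qed.

HB.instance Definition _ := Measure_isFinite.Build _ _ _ nu nu_finite.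

Lemma integral_wpush (g : T' -> \bar R) : measurable_fun setT g ->
  (forall x, 0 <= g x) -> \int[nu]_x g x = \int[mu]_z ((w z)%:E * g (Phi z)).
Proof.
move=> mg g0.
have E := @ge0_integral_pushforward _ _ _ _ R _ mPhi (mdens mw w0 iw) setT g
  measurableT mg (fun y _ => g0 y).
have E2 : \int[mdens mw w0 iw]_z g (Phi z) = \int[mu]_z ((w z)%:E * g (Phi z)).
  by apply: integral_mdens => //; exact: measurableT_comp mg mPhi.
by rewrite preimage_setT in E; rewrite -E2 -E.
Qed.

End weighted_pushforward.

Section integral_transfer.
Context d d' (T : measurableType d) (T' : measurableType d') {R : realType}.
Variables (m : {measure set T' -> \bar R}) (P : {measure set T -> \bar R})
  (Phi : T -> T') (a : T' -> R) (b : T -> R).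
Hypotheses (a0 : forall x, 0 <= a x) (b0 : forall z, 0 <= b z).
Hypothesis ge0_transfer : forall g : T' -> R, measurable_fun setT g ->
  (forall x, 0 <= g x) ->
  (\int[m]_x (g x * a x)%:E = \int[P]_z (b z * g (Phi z))%:E)%E.

(** Since the weights a and b are nonnegative, the positive and negative parts of the integrands are
    those of g times the weights. The identity thus passes from nonnegative to signed g without
    integrability. *)
Lemma Rintegral_transfer (g : T' -> R) : measurable_fun setT g ->
  \int[m]_x (g x * a x) = \int[P]_z (b z * g (Phi z)).
Proof.
move=> mg; rewrite /Rintegral integralE [in RHS]integralE; congr (fine (_ - _)%E).
- have := ge0_transfer (measurable_funrpos mg) (fun x => funrpos_ge0 g x).
  move=> E; transitivity (\int[m]_x ((g^\+%R x) * a x)%:E)%E.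
    apply: eq_integral => x _; rewrite funeposE/= /funrpos -EFin_max.
    by rewrite maxr_pMl// mul0r.
  rewrite E; apply: eq_integral => z _; rewrite funeposE/= /funrpos -EFin_max.
  by rewrite maxr_pMr// mulr0.
- have := ge0_transfer (measurable_funrneg mg) (fun x => funrneg_ge0 g x).
  move=> E; transitivity (\int[m]_x ((g^\-%R x) * a x)%:E)%E.
    apply: eq_integral => x _; rewrite funenegE/= /funrneg -EFin_max -mulNr.
    by rewrite maxr_pMl// mul0r.
  rewrite E; apply: eq_integral => z _; rewrite funenegE/= /funrneg -EFin_max -mulrN.
  by rewrite maxr_pMr// mulr0.
Qed.

End integral_transfer.

Section conditional_density.
Context d d' (T : measurableType d) (T' : measurableType d') {R : realType}.
Variables (m : {finite_measure set T' -> \bar R})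
  (P : {sigma_finite_measure set T -> \bar R}) (Phi : T -> T') (f : T -> R) (C : R).
Hypotheses (mPhi : measurable_fun setT Phi) (mf : measurable_fun setT f).
Hypothesis young : forall (g : T' -> R) (k : R), measurable_fun setT g ->
  (forall x, 0 <= g x <= k) ->
  (2%:E * \int[P]_z (`|f z| * g (Phi z))%:E <= C%:E + \int[m]_x (g x ^+ 2)%:E)%E.

Let mabsf : measurable_fun setT (fun z => `|f z|).
Proof. exact: measurableT_comp. Qed.

Lemma young_integrable : (\int[P]_z `|f z|%:E < +oo)%E.
Proof.
have := @young (cst 1) 1 (measurable_cst _) (fun x => introT andP (conj ler01 (lexx 1))).
under eq_integral do rewrite mulr1.
have -> : (\int[m]_x (cst 1 x ^+ 2)%:E = m setT)%E.
  rewrite (eq_integral (cst 1%E)) ?integral_cst ?mul1e// => x _.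
  by rewrite /= expr1n.
move=> h.
have : (C%:E + m setT < +oo)%E.
  by rewrite ltey_eq fin_numD fin_num_measure.
move=> Cm; rewrite ltey; apply/eqP => E; move: h; rewrite E.
by rewrite gt0_muley ?lte_fin// leye_eq => /eqP E2; rewrite E2 in Cm.
Qed.

(** Testing with g = k 1_A on an m-null set A leaves 2 k I <= C for every k > 0, which forces I = 0.
    This is the absolute continuity needed for Radon-Nikodym. *)
Lemma young_null (A : set T') : measurable A -> m A = 0%E ->
  (\int[P]_z (`|f z| * \1_A (Phi z))%:E = 0)%E.
Proof.
move=> mA A0; set I := (\int[P]_z _)%E.
have I0 : (0 <= I)%E by apply: integral_ge0 => z _; rewrite lee_fin mulr_ge0.
have key (k : R) : 0 < k -> ((2 * k)%:E * I <= C%:E)%E.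
  move=> k0; have mg : measurable_fun setT (fun x => k * \1_A x).
    by apply: measurable_funM => //; exact: measurable_indic.
  have g01 x : 0 <= k * \1_A x <= k.
    by rewrite indicE; case: (_ \in _); rewrite ?mulr1 ?mulr0 ?lexx ltW.
  have := young mg g01.
  have -> : (\int[m]_x ((k * \1_A x) ^+ 2)%:E = 0)%E.
    rewrite (eq_integral (fun x => (k ^+ 2)%:E * (\1_A x)%:E)%E); last first.
      move=> x _; rewrite exprMn -EFinM indicE; congr (_ * _)%:E.
      by case: (_ \in _); rewrite ?expr1n ?expr0n.
    rewrite ge0_integralZl//; last 2 first.
    - by apply/measurable_EFinP; exact: measurable_indic.
    - by rewrite lee_fin sqr_ge0.
    rewrite integral_indic// setIT [X in (_ * X)%E](_ : _ = 0%E) ?mule0//.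
  rewrite adde0; apply: le_trans.
  rewrite EFinM -muleA lee_wpmul2l//.
  rewrite le_eqVlt; apply/orP; left; apply/eqP.
  rewrite /I -ge0_integralZl//; last 2 first.
  - apply/measurable_EFinP; apply: measurable_funM => //.
    by apply: measurableT_comp mPhi; exact: measurable_indic.
  - by rewrite lee_fin ltW.
  by apply: eq_integral => z _; rewrite -EFinM mulrCA.
move: I0 key; case: I => [i| |] //.
  rewrite lee_fin => i0 key; congr (_%:E); apply/eqP; rewrite eq_le i0 andbT leNgt.
  (* For k = (|C| + 1) / i the left side is 2 (|C| + 1), which exceeds C. *)
  apply/negP => i_gt0; have c0 : 0 < (`|C| + 1) / i by rewrite divr_gt0// ltr_wpDl.
  have := key _ c0; rewrite -EFinM lee_fin -mulrA divfK ?gt_eqF//.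
  by have := ler_norm C; have := normr_ge0 C; lra.
by move=> _ /(_ 1 ltr01); rewrite gt0_muley ?lte_fin ?mulr1// leye_eq.
Qed.

Section half.
Variable fp : T -> R.
Hypotheses (mfp : measurable_fun setT fp) (fp0 : forall z, 0 <= fp z)
  (fpf : forall z, fp z <= `|f z|).

Let ifp : (\int[P]_z (fp z)%:E < +oo)%E.
Proof.
apply: le_lt_trans young_integrable; apply: ge0_le_integral => //.
- by move=> z _; rewrite lee_fin.
- exact/measurable_EFinP.
- exact/measurable_EFinP.
- by move=> z _; rewrite lee_fin.
Qed.

(** Used for the positive and the negative part of f separately, since Radon-Nikodym is applied to a
    nonnegative measure: the image of [fp] P under [Phi]. *)
Lemma half_density : exists up : T' -> R, [/\ measurable_fun setT up,
  (forall x, 0 <= up x), m.-integrable setT (EFin \o up) &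
  forall g : T' -> R, measurable_fun setT g -> (forall x, 0 <= g x) ->
  (\int[m]_x (g x * up x)%:E = \int[P]_z (fp z * g (Phi z))%:E)%E].
Proof.
pose nu := wpush mfp fp0 ifp mPhi.
have dom : nu `<< m.
  apply/null_content_dominatesP => A mA A0.
  apply/eqP; rewrite eq_le measure_ge0 andbT -(young_null mA A0).
  rewrite /nu /wpush /mdens integral_mkcond; apply: ge0_le_integral => //.
  - by move=> z _; rewrite patchE; case: ifP; rewrite // lee_fin.
  - apply/(measurable_restrictT _ _).1; last first.
      by apply: measurable_funTS; exact/measurable_EFinP.
    by rewrite -[X in measurable X]setTI; exact: mPhi.
  - apply/measurable_EFinP; apply: measurable_funM => //.
    by apply: measurableT_comp mPhi; exact: measurable_indic.
  - move=> z _; rewrite patchE indicE.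
    have -> : (z \in Phi @^-1` A) = (Phi z \in A) by apply/idP/idP; rewrite !inE.
    by case: ifP => _; rewrite lee_fin ?mulr1 ?mulr0.
pose r := Radon_Nikodym_SigmaFinite.f nu m.
have rE x : r x = (fine (r x))%:E.
  by rewrite fineK//; exact: Radon_Nikodym_SigmaFinite.f_fin_num.
have ir := Radon_Nikodym_SigmaFinite.f_integrable dom.
exists (fun x => fine (r x)); split.
- by apply: (@measurableT_comp _ _ _ _ _ _ fine); [exact: fine_measurable|exact: measurable_int ir].
- by move=> x; rewrite fine_ge0//; exact: Radon_Nikodym_SigmaFinite.f_ge0.
- by rewrite (_ : _ \o _ = r)//; apply/funext => x /=; rewrite -rE.
move=> g mg g0.
transitivity (\int[nu]_x (g x)%:E)%E.
  rewrite -(Radon_Nikodym_SigmaFinite.change_of_variables dom)//.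
  - by apply: eq_integral => x _; rewrite EFinM -rE.
  - exact/measurable_EFinP.
rewrite integral_wpush//; exact/measurable_EFinP.
Qed.

End half.

Lemma bounded_mul_integrable (d0 : measure_display) (S : measurableType d0)
    (mu : {measure set S -> \bar R}) (g h : S -> R) (k : R) :
  measurable_fun setT g -> (forall x, `|g x| <= k) ->
  mu.-integrable setT (EFin \o h) ->
  mu.-integrable setT (EFin \o (fun x => g x * h x)).
Proof.
move=> mg gk ih; have mh := measurable_int _ ih.
have {}mh : measurable_fun setT h by exact/measurable_EFinP.
apply: (@le_integrable _ _ _ mu setT measurableT _ (fun x => k%:E * (h x)%:E)%E).
- by apply/measurable_EFinP; exact: measurable_funM.
- move=> x _; rewrite /= lee_fin !normrM ler_wpM2r//.
  by rewrite (le_trans (gk x))// ler_norm.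
- exact: integrableZl.
Qed.

(* [U] is the conditional expectation of [f] given [Phi], relative to [m]. The
   hypothesis [young] says both that the image of [f P] under [Phi] is absolutely
   continuous and, taking [g] close to [|U|], that its density has energy at
   most [C]. *)
Lemma conditional_density : exists U : T' -> R, [/\ measurable_fun setT U,
  (forall (g : T' -> R) (k : R), measurable_fun setT g -> (forall x, `|g x| <= k) ->
    \int[m]_x (g x * U x) = \int[P]_z (f z * g (Phi z))) &
  (\int[m]_x (U x ^+ 2)%:E <= C%:E)%E].
Proof.
have fpf z : (f ^\+)%R z <= `|f z| by rewrite /funrpos ge_max ler_norm normr_ge0.
have fnf z : (f ^\-)%R z <= `|f z| by rewrite /funrneg ge_max normr_ge0 -normrN ler_norm.
have [up [mup up0 iup upE]] := half_density (measurable_funrpos mf) (funrpos_ge0 f) fpf.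
have [un [mun un0 iun unE]] := half_density (measurable_funrneg mf) (funrneg_ge0 f) fnf.
have mU : measurable_fun setT (fun x => up x - un x) by exact: measurable_funB.
exists (fun x => up x - un x); split => //.
- move=> g k mg gk.
  have if_ : P.-integrable setT (EFin \o f).
    apply/integrableP; split; first exact/measurable_EFinP.
    exact: young_integrable.
  have mgP : measurable_fun setT (g \o Phi) by exact: measurableT_comp.
  have ifp : P.-integrable setT (EFin \o (f ^\+)%R).
    apply: (le_integrable measurableT _ _ if_) => [|z _].
      exact/measurable_EFinP/measurable_funrpos.
    by rewrite /= lee_fin ger0_norm ?funrpos_ge0.
  have ifn : P.-integrable setT (EFin \o (f ^\-)%R).
    apply: (le_integrable measurableT _ _ if_) => [|z _].
      exact/measurable_EFinP/measurable_funrneg.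
    by rewrite /= lee_fin ger0_norm ?funrneg_ge0.
  under eq_Rintegral do rewrite mulrBr.
  rewrite RintegralB//; [|exact: bounded_mul_integrable gk iup|
    exact: bounded_mul_integrable gk iun].
  rewrite (Rintegral_transfer up0 (funrpos_ge0 f) upE mg).
  rewrite (Rintegral_transfer un0 (funrneg_ge0 f) unE mg).
  have gkP z : `|(g \o Phi) z| <= k by exact: gk.
  rewrite -RintegralB//.
  + apply: eq_Rintegral => z _; rewrite -mulrBl; congr (_ * _).
    by have := congr1 (fun h => h z) (funrposBneg f).
  + have := bounded_mul_integrable mgP gkP ifp.
    by apply: eq_integrable => // z _ /=; rewrite mulrC.
  + have := bounded_mul_integrable mgP gkP ifn.
    by apply: eq_integrable => // z _ /=; rewrite mulrC.
- set U := fun x => up x - un x.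
  have mnU : measurable_fun setT (fun x => `|U x|) by exact: measurableT_comp.
  (* The natural test function |U| may be unbounded, so it is truncated to 0 where |U| > n; monotone
     convergence removes the truncation at the end. *)
  pose g (n : nat) x : R := `|U x| * \1_[set y | `|U y| <= n%:R] x.
  have mD (n : nat) : measurable [set y | `|U y| <= n%:R].
    rewrite (_ : [set _ | _] = setT `&` (fun y => `|U y|) @^-1` `]-oo, n%:R]).
      exact: mnU.
    by apply/seteqP; split => y /=; rewrite in_itv/= ?andbT => // -[].
  have mg n : measurable_fun setT (g n).
    by apply: measurable_funM => //; exact: measurable_indic.
  have gE n x : g n x = if `|U x| <= n%:R then `|U x| else 0.
    rewrite /g indicE; case: ifPn => h; first by rewrite mem_set// mulr1.
    by rewrite memNset ?mulr0//; exact/negP.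
  have g01 n x : 0 <= g n x <= n%:R.
    by rewrite gE; case: ifPn => // h; rewrite ?lexx ?ler0n ?normr_ge0.
  have g0 n x : 0 <= g n x by have /andP[] := g01 n x.
  have bound n : (\int[m]_x (g n x ^+ 2)%:E <= C%:E)%E.
    have := young (mg n) (g01 n).
    have -> : (\int[P]_z (`|f z| * g n (Phi z))%:E =
        \int[m]_x (g n x * up x + g n x * un x)%:E)%E.
      under [RHS]eq_integral do rewrite EFinD.
      rewrite ge0_integralD//.
      - rewrite upE// unE// -ge0_integralD//.
        + apply: eq_integral => z _; rewrite -EFinD -mulrDl; congr (_ * _)%:E.
          by have := congr1 (fun h => h z) (funrposDneg f).
        + by move=> z _; rewrite lee_fin mulr_ge0 ?funrpos_ge0.
        + apply/measurable_EFinP; apply: measurable_funM; first exact: measurable_funrpos.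
          exact: measurableT_comp.
        + by move=> z _; rewrite lee_fin mulr_ge0 ?funrneg_ge0.
        + apply/measurable_EFinP; apply: measurable_funM; first exact: measurable_funrneg.
          exact: measurableT_comp.
      - by move=> x _; rewrite lee_fin mulr_ge0.
      - by apply/measurable_EFinP; exact: measurable_funM.
      - by move=> x _; rewrite lee_fin mulr_ge0.
      - by apply/measurable_EFinP; exact: measurable_funM.
    (* Where g n is nonzero it equals |U| <= up + un. The hypothesis [young] then reads 2 I <= C + I
       for the integral I of (g n)^2, and I is finite because g n is bounded, so I <= C. *)
    have le2 : (\int[m]_x (g n x ^+ 2)%:E <= \int[m]_x (g n x * up x + g n x * un x)%:E)%E.
      apply: ge0_le_lower_integral => x _; first by rewrite lee_fin sqr_ge0.
      rewrite lee_fin -mulrDr expr2 ler_wpM2l// gE; case: ifP => _.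
        rewrite /U (le_trans (ler_normB _ _))// !ger0_norm//.
      by rewrite addr_ge0.
    move=> yg; have {}yg := le_trans (lee_wpmul2l _ le2) yg.
    have p2 : (0 <= 2%:E :> \bar R)%E by rewrite lee_fin.
    have {}yg := yg p2.
    have : (\int[m]_x (g n x ^+ 2)%:E)%E \is a fin_num.
      have := @bounded_integrable _ _ _ m (fun x => g n x ^+ 2) (n%:R ^+ 2).
      rewrite ge0_fin_numE; last by apply: integral_ge0 => x _; rewrite lee_fin sqr_ge0.
      move=> /(_ _ _)/integrableP[||_]; first exact: measurable_funX.
        move=> x; rewrite normrX; apply: lerXn2r; rewrite ?nnegrE//.
        by have /andP[a b] := g01 n x; rewrite ger0_norm.
      apply: le_lt_trans; apply: ge0_le_lower_integral => x _; rewrite lee_fin ?sqr_ge0//.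
      exact: ler_norm.
    move: yg; case: (\int[m]_x _)%E => // j.
    by rewrite -EFinM -EFinD !lee_fin => h _; lra.
  have cvgU x : (g n x ^+ 2)%:E @[n --> \oo] --> (U x ^+ 2)%:E.
    apply: cvg_near_cst; near=> n; rewrite gE ifT ?real_normK ?num_real//.
    near: n; exact: nbhs_infty_ger.
  rewrite (eq_integral (fun x => limn (fun n => (g n x ^+ 2)%:E))); last first.
    by move=> x _; apply/esym/cvg_lim => //; exact: cvgU.
  rewrite monotone_convergence//.
  + apply: lime_le; last by apply: nearW => n; exact: bound.
    apply: ereal_nondecreasing_is_cvgn => n p np; apply: ge0_le_lower_integral => x _.
      by rewrite lee_fin sqr_ge0.
    rewrite lee_fin lerXn2r ?nnegrE// !gE; case: ifPn => [h|_].
      by rewrite (le_trans h) ?ler_nat.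
    by case: ifP.
  + by move=> n; apply/measurable_EFinP; exact: measurable_funX.
  + by move=> n x _; rewrite lee_fin sqr_ge0.
  + move=> x _ n p np; rewrite lee_fin lerXn2r ?nnegrE// !gE; case: ifPn => [h|_].
      by rewrite (le_trans h) ?ler_nat.
    by case: ifP.
Unshelve. all: by end_near. Qed.

End conditional_density.

(** * Curves of measures carried by moving particles *)

Section plane_measurability.
Context {R : realType}.
Local Notation RR := (measurableTypeR R * measurableTypeR R)%type.

(** An open set is the union of the boxes with rational centre and radius that it contains. A radius
    r < e / 2 with a centre within r of the point keeps the box inside the ball of radius e. *)
Lemma open_measurable2 (A : set (R * R)) : open A -> measurable (A : set RR).
Proof.
move=> oA.
pose box (q : rat * rat * rat) : set RR :=
  (ball (ratr q.1.1 : R) (ratr q.2) : set (measurableTypeR R)) `*`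
  (ball (ratr q.1.2 : R) (ratr q.2) : set (measurableTypeR R)).
pose F q : set RR := if `[< box q `<=` A >] then box q else set0.
have -> : A = \bigcup_(q in [set: rat * rat * rat]) F q.
  apply/seteqP; split => [[x y] Axy|z [q _]]; last first.
    by rewrite /F; case: ifPn => // /asboolP; exact.
  have /nbhs_ballP[e /= e0 He] : nbhs ((x, y) : R * R) A by exact: open_nbhs_nbhs.
  have [r re] : exists r : rat, ratr r \in `]0, (e / 2)[ by apply: rat_in_itvoo; rewrite divr_gt0.
  move: re; rewrite in_itv/= => /andP[r0 re].
  have [a] : exists a : rat, ratr a \in `](x - ratr r), x[ by apply: rat_in_itvoo; rewrite ltrBlDr ltrDl.
  rewrite in_itv/= => /andP[a1 a2].
  have [b] : exists b : rat, ratr b \in `](y - ratr r), y[ by apply: rat_in_itvoo; rewrite ltrBlDr ltrDl.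
  rewrite in_itv/= => /andP[b1 b2].
  exists (a, b, r) => //; rewrite /F; case: ifPn => [_|/asboolP []].
    by split => /=; rewrite /ball/= ltr_norml; lra.
  move=> [x' y'] [/=]; rewrite /ball/= !ltr_norml => /andP[h1 h2] /andP[h3 h4].
  by apply: He; split => /=; rewrite /ball/= ltr_norml; lra.
apply: countable_bigcupT_measurable => // q; rewrite /F; case: ifP => // _.
by apply: measurableX; exact: measurable_ball.
Qed.

Lemma continuous_measurable2 (f : R * R -> R) : continuous f ->
  measurable_fun [set: RR] f.
Proof.
move=> /continuousP cf; apply: (measurability _ (RGenOpens.measurableE R)).
move=> _ [_ [a [b ->] <-]]; rewrite setTI.
by apply: open_measurable2; apply: cf; exact: interval_open.
Qed.

End plane_measurability.

Section plane_chain_rule.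
Context {R : realType}.
Implicit Types (eta : R * R -> R).

Lemma is_derive_slice1 eta (a c : R) : Ck_on setT 1 eta ->
  is_derive a 1 (fun s => eta (s, c)) ('D_((1, 0) : R * R) eta (a, c)).
Proof.
move=> Ceta; have E : (fun h : R => h^-1 *: (((fun s => eta (s, c)) \o shift a) (h *: (1:R)) - eta (a, c))) =
    (fun h => h^-1 *: ((eta \o shift ((a, c) : R * R)) (h *: ((1, 0) : R * R)) - eta (a, c))).
  apply/funext => h /=; congr (_ *: (eta _ - _)).
  have -> : h *: ((1, 0) : R * R) + (a, c) = (h * 1 + a, h * 0 + c) by [].
  by rewrite mulr0 add0r.
have := Ck_onT_derivable Ceta ((a, c) : R * R) ((1, 0) : R * R).
by rewrite /derivable -E => D; apply: DeriveDef => //; rewrite /derive E.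
Qed.

Lemma is_derive_slice2 eta (a c : R) : Ck_on setT 1 eta ->
  is_derive c 1 (fun s => eta (a, s)) ('D_((0, 1) : R * R) eta (a, c)).
Proof.
move=> Ceta; have E : (fun h : R => h^-1 *: (((fun s => eta (a, s)) \o shift c) (h *: (1:R)) - eta (a, c))) =
    (fun h => h^-1 *: ((eta \o shift ((a, c) : R * R)) (h *: ((0, 1) : R * R)) - eta (a, c))).
  apply/funext => h /=; congr (_ *: (eta _ - _)).
  have -> : h *: ((0, 1) : R * R) + (a, c) = (h * 0 + a, h * 1 + c) by [].
  by rewrite mulr0 add0r.
have := Ck_onT_derivable Ceta ((a, c) : R * R) ((0, 1) : R * R).
by rewrite /derivable -E => D; apply: DeriveDef => //; rewrite /derive E.
Qed.

Lemma mean_value_slice eta (a b c : R) : Ck_on setT 1 eta ->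
  exists xi, `|xi - a| <= `|b - a| /\
    eta (b, c) - eta (a, c) = 'D_((1, 0) : R * R) eta (xi, c) * (b - a).
Proof.
move=> Ceta.
have D s := is_derive_slice1 s c Ceta.
have cs (x y : R) : {within `[x, y], continuous (fun s => eta (s, c))}.
  by apply: continuous_subspaceT => s; apply: derivable_continuous1; have [] := D s.
have [ab|/ltW ba] := leP a b.
  have [xi] := MVT_segment ab (fun s _ => D s) (cs a b).
  rewrite in_itv/= => /andP[h1 h2] E; exists xi; split => //.
  by rewrite !ger0_norm ?subr_ge0// lerB.
have [xi] := MVT_segment ba (fun s _ => D s) (cs b a).
rewrite in_itv/= => /andP[h1 h2] E; exists xi; split.
  by rewrite !ler0_norm ?subr_le0// lerN2 lerB.
by rewrite -opprB E -mulrN opprB.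
Qed.

(** [Ck_on] gives partial derivatives but no Frechet derivative, so the chain rule is proved by
    hand. The increment is split into a spatial one at time h + t, handled by the mean value theorem
    and the continuity of the partial derivative, and a temporal one at the fixed point x t. *)
Lemma is_derive_curve eta (x : R -> R) (t v : R) : Ck_on setT 1 eta ->
  continuous ('D_((1, 0) : R * R) eta) ->
  is_derive t 1 x v ->
  is_derive t 1 (fun s => eta (x s, s))
    ('D_((1, 0) : R * R) eta (x t, t) * v + 'D_((0, 1) : R * R) eta (x t, t)).
Proof.
move=> Ceta cD dx.
have /choice[xi xiP] h : exists xi, `|xi - x t| <= `|x (h + t) - x t| /\
    eta (x (h + t), h + t) - eta (x t, h + t) =
    'D_((1, 0) : R * R) eta (xi, h + t) * (x (h + t) - x t) by exact: mean_value_slice.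
suff H : h^-1 *: (((fun s => eta (x s, s)) \o shift t) (h *: (1:R)) - eta (x t, t)) @[h --> 0^']
    --> 'D_((1, 0) : R * R) eta (x t, t) * v + 'D_((0, 1) : R * R) eta (x t, t).
  by apply: DeriveDef; [apply/cvg_ex; eexists; exact: H|exact: cvg_lim].
have -> : (fun h : R => h^-1 *: (((fun s => eta (x s, s)) \o shift t) (h *: (1:R)) - eta (x t, t))) = fun h : R =>
    'D_((1, 0) : R * R) eta (xi h, h + t) * (h^-1 *: ((x \o shift t) (h *: (1:R)) - x t)) +
    h^-1 *: (((fun s => eta (x t, s)) \o shift t) (h *: (1:R)) - eta (x t, t)).
  apply/funext => h; rewrite /= /GRing.scale/= mulr1.
  have [_ E] := xiP h; rewrite mulrCA -E -mulrDr; congr (_ * _); ring.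
have dx' : h^-1 *: ((x \o shift t) (h *: (1:R)) - x t) @[h --> 0^'] --> v.
  by case: dx => dx <-; exact: dx.
have ct : (h + t) @[h --> (0:R)^'] --> t.
  have : (h + t) @[h --> (0:R)^'] --> 0 + t.
    by apply: cvgD; [exact: cvg_within|exact: cvg_cst].
  by rewrite add0r.
have cx : x (h + t) @[h --> (0:R)^'] --> x t.
  have : {for t, continuous x} by apply: derivable_continuous1; case: dx.
  by move=> cx; exact: (@cvg_comp _ _ _ (fun h => h + t) x _ _ _ ct cx).
apply: cvgD; last first.
  by have [D <-] := is_derive_slice2 (x t) t Ceta; exact: D.
apply: cvgM => //.
apply: (@cvg_comp _ _ _ (fun h => (xi h, h + t)) ('D_((1, 0) : R * R) eta) 0^'
   (nbhs ((x t, t) : R * R))); last exact: cD.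
have cxi : xi h @[h --> (0:R)^'] --> x t; last exact: cvg_pair cxi ct.
  apply/cvgrPdist_lt => e e0; near=> h; have [le _] := xiP h.
  rewrite distrC (le_lt_trans le)// distrC; near: h.
  by have /cvgrPdist_lt := cx; exact.
Unshelve. all: by end_near. Qed.

End plane_chain_rule.

Section disintegration.
Context {R : realType}.
Local Notation RR := (measurableTypeR R * measurableTypeR R)%type.
Local Notation leb := (@lebesgue_measure R).
Variables (kappa : R -> {measure set (measurableTypeR R) -> \bar R})
  (m : {measure set RR -> \bar R}).

Definition disintegrates := forall G : RR -> \bar R, measurable_fun setT G ->
  (forall z, 0 <= G z)%E ->
  measurable_fun (`[0, 1]%classic : set (measurableTypeR R))
    (fun t => \int[kappa t]_x G (x, t))%E /\
  (\int[leb]_(t in `[0%R, 1%R]) \int[kappa t]_x G (x, t) = \int[m]_z G z)%E.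

Hypothesis dis : disintegrates.

(** For almost every t both parts of the inner integral are finite, so there [fine] changes nothing
    and the two parts may be subtracted. *)
Lemma disintegration_Rintegral (G : RR -> R) : m.-integrable setT (EFin \o G) ->
  \int[leb]_(t in `[0, 1]) \int[kappa t]_x G (x, t) = \int[m]_z G z.
Proof.
move=> iG.
have mI : measurable (`[0%R, 1%R]%classic : set (measurableTypeR R)).
  exact: measurable_itv.
have mG := measurable_int _ iG.
have mGp : measurable_fun setT ((EFin \o G)^\+)%E by exact: measurable_funepos.
have mGn : measurable_fun setT ((EFin \o G)^\-)%E by exact: measurable_funeneg.
have [ma aE] := dis mGp (fun z => funepos_ge0 _ z).
have [mb bE] := dis mGn (fun z => funeneg_ge0 _ z).
set a := (fun t => \int[kappa t]_x ((EFin \o G)^\+)%E (x, t))%E in ma aE.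
set b := (fun t => \int[kappa t]_x ((EFin \o G)^\-)%E (x, t))%E in mb bE.
have a0 t : (0 <= a t)%E by apply: integral_ge0 => x _; exact: funepos_ge0.
have b0 t : (0 <= b t)%E by apply: integral_ge0 => x _; exact: funeneg_ge0.
have ia : leb.-integrable `[0%R, 1%R]%classic a.
  apply/integrableP; split; first exact: ma.
  have -> : (\int[leb]_(t in `[0%R, 1%R]) `|a t| = \int[leb]_(t in `[0%R, 1%R]) a t)%E.
    by apply: eq_integral => t _; rewrite gee0_abs.
  rewrite [X in (X < _)%E]aE; have /integrableP[_] := integrable_funepos measurableT iG.
  by rewrite (eq_integral ((EFin \o G)^\+)%E) // => z _; rewrite gee0_abs.
have ib : leb.-integrable `[0%R, 1%R]%classic b.
  apply/integrableP; split; first exact: mb.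
  have -> : (\int[leb]_(t in `[0%R, 1%R]) `|b t| = \int[leb]_(t in `[0%R, 1%R]) b t)%E.
    by apply: eq_integral => t _; rewrite gee0_abs.
  rewrite [X in (X < _)%E]bE; have /integrableP[_] := integrable_funeneg measurableT iG.
  by rewrite (eq_integral ((EFin \o G)^\-)%E) // => z _; rewrite gee0_abs.
rewrite /Rintegral.
have E t : (\int[kappa t]_x (G (x, t))%:E = a t - b t)%E.
  rewrite integralE; congr (_ - _)%E; apply: eq_integral => x _.
    by rewrite !funeposE.
  by rewrite !funenegE.
transitivity (fine (\int[leb]_(t in `[0%R, 1%R]) (a t - b t))%E); last first.
  rewrite integralB; [|exact: mI|exact: ia|exact: ib].
  by rewrite [in RHS]integralE; congr (fine (_ - _)%E); [exact: aE|exact: bE].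
congr fine; apply: ae_eq_integral.
- exact: mI.
- apply/measurable_EFinP; apply: (@measurableT_comp _ _ _ _ _ _ fine).
    exact: fine_measurable.
  rewrite (_ : (fun t => _) = (fun t => a t - b t)%E); last by apply/funext => t; exact: E.
  exact: emeasurable_funB.
- exact: emeasurable_funB.
have FF := @ae_filter_ringOfSetsType _ _ _ leb.
apply: filterS2 (integrable_ae mI ia) (integrable_ae mI ib) => t ha hb t01.
by rewrite E fineK// fin_numB ha ?hb.
Qed.

End disintegration.

Section unit_time.
Context {R : realType}.
Local Notation leb := (@lebesgue_measure R).

Definition unit_time : probability (measurableTypeR R) R := uniform_prob (@ltr01 R).

Lemma integral_unit_time (f : R -> \bar R) :
  measurable_fun [set: measurableTypeR R] f -> (forall t, 0 <= f t)%E ->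
  (\int[unit_time]_t f t = \int[leb]_(t in `[0%R, 1%R]) f t)%E.
Proof. by move=> mf f0; rewrite /unit_time integral_uniform// subr0 invr1 mul1e. Qed.

Lemma Rintegral_unit_time (f : R -> R) :
  measurable_fun [set: measurableTypeR R] f ->
  \int[unit_time]_t f t = \int[leb]_(t in `[0, 1]) f t.
Proof.
move=> mf; rewrite /Rintegral integralE [in RHS]integralE; congr (fine (_ - _)%E).
  rewrite integral_unit_time//.
  by apply: measurable_funepos; exact/measurable_EFinP.
rewrite integral_unit_time//.
by apply: measurable_funeneg; exact/measurable_EFinP.
Qed.

Definition clip (t : R) : R := Num.max 0 (Num.min t 1).

Lemma clip01 t : 0 <= clip t <= 1.
Proof. by rewrite /clip le_max lexx ge_max ler01 ge_min lexx orbT. Qed.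

Lemma clip_id t : 0 <= t <= 1 -> clip t = t.
Proof. by move=> /andP[t0 t1]; rewrite /clip min_l// max_r. Qed.

Lemma continuous_clip : continuous clip.
Proof.
have E : clip = (fun t => (1 + `|t| - `|1 - t|) / 2).
  apply/funext => t; rewrite /clip.
  have [t1|t1] := leP t 1; last by rewrite max_r// ger0_norm ?ler0_norm; lra.
  by have [t0|t0] := leP 0 t; rewrite (ger0_norm (_ : 0 <= 1 - t)) ?subr_ge0// ?(ger0_norm t0) ?(ltr0_norm t0); lra.
rewrite E => t; apply: cvgMl; apply: cvgB; last first.
  by apply: cvg_norm; apply: cvgB; [exact: cvg_cst|exact: cvg_id].
by apply: cvgD; [exact: cvg_cst|apply: cvg_norm; exact: cvg_id].
Qed.

Lemma measurable_clip : measurable_fun [set: measurableTypeR R] clip.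
Proof. exact: continuous_measurableT continuous_clip. Qed.

End unit_time.

Lemma continuous_bounded_support {R : realType} {V : normedModType R} (f : V -> R) (K : set V) :
  continuous f -> compact K -> (forall x, ~ K x -> f x = 0) ->
  exists b, forall x, `|f x| <= b.
Proof.
move=> cf cK f0; have cfK : compact (f @` K).
  by apply: continuous_compact => //; exact: continuous_subspaceT.
have [b [_ /(_ (b + 1))]] := compact_bounded cfK.
rewrite ltrDl ltr01 => /(_ isT) bb; exists (Num.max 0 (b + 1)) => x.
have [Kx|nK] := pselect (K x); last by rewrite f0// normr0 le_max lexx.
by rewrite le_max bb ?orbT//; exists x.
Qed.

Lemma derive_eq0_off_support {R : realType} {V : normedModType R} (f : V -> R) (x v : V) :
  ~ closure [set x | f x != 0] x -> 'D_v f x = 0.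
Proof.
move=> ncx; rewrite (@near_eq_derive _ _ _ f (cst 0)) ?derive_cst//.
have : nbhs x (~` closure [set x | f x != 0]).
  by apply: open_nbhs_nbhs; split => //; apply: closed_openC; exact: closed_closure.
apply: filterS => y ny; apply: contrapT => /eqP fy; apply: ny; exact: subset_closure.
Qed.

Lemma test_function_bounded {R : realType} {V : normedModType R} (U : set V) (f : V -> R) :
  test_function U f -> exists b, forall x, `|f x| <= b.
Proof.
move=> tf; have [_ cK _] := tf; apply: continuous_bounded_support cK _.
  exact: test_function_continuous tf.
by move=> x nx; apply: contrapT => /eqP fx; apply: nx; exact: subset_closure.
Qed.

Lemma test_function_derive_bounded {R : realType} {V : normedModType R} (U : set V)
    (f : V -> R) (v : V) : test_function U f -> exists b, forall x, `|'D_v f x| <= b.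
Proof.
move=> tf; have [_ cK _] := tf; apply: continuous_bounded_support cK _.
  exact: test_function_continuous_derive tf.
by move=> x nx; exact: derive_eq0_off_support.
Qed.

Lemma finite_square_integrable {R : realType} d (T : measurableType d)
    (m : {finite_measure set T -> \bar R}) (f : T -> R) (c : R) :
  measurable_fun setT f -> (\int[m]_x (f x ^+ 2)%:E <= c%:E)%E ->
  m.-integrable setT (EFin \o f).
Proof.
move=> mf fc; apply/integrableP; split; first exact/measurable_EFinP.
apply: (@le_lt_trans _ _ (\int[m]_x (1 + (f x ^+ 2)%:E))%E).
  apply: ge0_le_lower_integral => x _; rewrite ?abse_ge0//= -EFinD lee_fin.
  have := sqr_ge0 (`|f x| - 1); rewrite sqrrB expr1n mulr1 real_normK ?num_real//.
  by have := sqr_ge0 (f x); have := normr_ge0 (f x); rewrite -mulr_natl; lra.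
rewrite ge0_integralD//; last 2 first.
- by move=> x _; rewrite lee_fin sqr_ge0.
- by apply/measurable_EFinP; exact: measurable_funX.
rewrite lte_add_pinfty//; last by rewrite (le_lt_trans fc)// ltry.
by rewrite (_ : (fun=> 1%E) = cst 1%E)// integral_cst// mul1e ltey_eq fin_num_measure.
Qed.

Lemma Rintegral_eq0 {R : realType} d (T : measurableType d) (m : {measure set T -> \bar R})
    (D : set T) (f : T -> R) : (forall x, D x -> f x = 0) -> \int[m]_(x in D) f x = 0.
Proof. by move=> f0; rewrite /Rintegral integral0_eq// => x Dx; rewrite f0. Qed.

(** * From random particle paths to solutions of the continuity equation *)

Section particles.
Context {R : realType} d (Z : measurableType d) (gam : probability Z R).
Local Notation leb := (@lebesgue_measure R).
Local Notation TZ := (measurableTypeR R * Z)%type.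
Local Notation RR := (measurableTypeR R * measurableTypeR R)%type.
Variables (X Xd : 'I_2 -> Z -> R -> R) (p pd : Z -> R -> R).

(* A random [z] carries, at time [t], the mass [p z t] at [X ord0 z t] on node 1
   and [1 - p z t] at [X ord_max z t] on node 2. By [pp_merge], mass is exchanged
   only while both particles sit at the same point. *)
Record particle_paths : Prop := {
  pp_measurable_X : forall i, measurable_fun [set: TZ] (fun y => X i y.2 y.1) ;
  pp_measurable_Xd : forall i, measurable_fun [set: TZ] (fun y => Xd i y.2 y.1) ;
  pp_measurable_p : measurable_fun [set: TZ] (fun y => p y.2 y.1) ;
  pp_measurable_pd : measurable_fun [set: TZ] (fun y => pd y.2 y.1) ;
  pp_derive_X : forall i z (t : R), is_derive t 1 (X i z) (Xd i z t) ;
  pp_derive_p : forall z (t : R), is_derive t 1 (p z) (pd z t) ;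
  pp_continuous_Xd : forall i z, continuous (Xd i z) ;
  pp_continuous_pd : forall z, continuous (pd z) ;
  pp_p01 : forall z t, 0 <= t <= 1 -> 0 <= p z t <= 1 ;
  pp_merge : forall z t, X ord0 z t != X ord_max z t -> pd z t = 0 }.

Hypothesis pp : particle_paths.

Definition weight (i : 'I_2) (z : Z) (t : R) : R := simplex_param (p z t) i.
(* Clipping the time makes [path_law t] below a probability for every real [t];
   only times in [0, 1] matter. *)
Definition cweight (i : 'I_2) (y : TZ) : R := weight i y.2 (clip y.1).
Definition position (i : 'I_2) (y : TZ) : RR := (X i y.2 y.1, y.1).
Definition time_path : probability TZ R := (unit_time \x gam)%E.

Lemma cweight_ge0 i y : 0 <= cweight i y.
Proof.
have := pp_p01 pp y.2 (clip01 y.1); rewrite /cweight /weight /simplex_param.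
by case: ifP => _ /andP[h0 h1]; rewrite ?subr_ge0.
Qed.

Lemma cweight_sum y : cweight ord0 y + cweight ord_max y = 1.
Proof. by rewrite /cweight /weight /simplex_param eqxx ord_max_neq0 addrC subrK. Qed.

Lemma cweight_le1 i y : cweight i y <= 1.
Proof.
have := cweight_sum y; have := cweight_ge0 ord0 y; have := cweight_ge0 ord_max y.
by have [->|->] := ord2_cases i; lra.
Qed.

Lemma cweight_norm i y : `|cweight i y| <= 1.
Proof. by rewrite ger0_norm ?cweight_ge0// cweight_le1. Qed.

Lemma measurable_cweight i : measurable_fun [set: TZ] (cweight i).
Proof.
have mc : measurable_fun [set: TZ] (fun y : TZ => (clip y.1 : measurableTypeR R, y.2) : TZ).
  apply: measurable_fun_pair; last exact: measurable_snd.
  exact: measurableT_comp measurable_clip (@measurable_fst _ _ _ _).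
have mp : measurable_fun [set: TZ] (fun y : TZ => p y.2 (clip y.1)).
  exact: measurableT_comp (pp_measurable_p pp) mc.
rewrite /cweight /weight /simplex_param; case: (i == ord0) => //.
exact: measurable_funB.
Qed.

Lemma measurable_position i : measurable_fun [set: TZ] (position i).
Proof.
apply: measurable_fun_pair; first exact: (pp_measurable_X pp).
exact: measurable_fst.
Qed.

Lemma measurable_path_slice (f : TZ -> R) (t : R) : measurable_fun setT f ->
  measurable_fun setT (fun z => f (t, z)).
Proof. by move=> mf; exact: measurableT_comp mf (pair1_measurable (t : measurableTypeR R)). Qed.

Lemma cweight_integral (i : 'I_2) (t : R) : (\int[gam]_z (cweight i (t, z))%:E < +oo)%E.
Proof.
apply: (@le_lt_trans _ _ (\int[gam]_z (cst 1%:E z))%E).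
  by apply: ge0_le_lower_integral => z _; rewrite /= lee_fin ?cweight_ge0 ?cweight_le1.
by rewrite integral_cst// ltey_eq fin_numM// fin_num_measure.
Qed.

Lemma cweight_integralP (i : 'I_2) : (\int[time_path]_y (cweight i y)%:E < +oo)%E.
Proof.
apply: (@le_lt_trans _ _ (\int[time_path]_z (cst 1%:E z))%E).
  by apply: ge0_le_lower_integral => z _; rewrite /= lee_fin ?cweight_ge0 ?cweight_le1.
by rewrite integral_cst// ltey_eq fin_numM// fin_num_measure.
Qed.

Lemma measurable_position_slice i (t : R) :
  measurable_fun [set: Z] (fun z => X i z t : measurableTypeR R).
Proof. exact: measurable_path_slice (pp_measurable_X pp i). Qed.

Definition path_comp (t : R) (i : 'I_2) : {finite_measure set (measurableTypeR R) -> \bar R} :=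
  wpush (measurable_path_slice t (measurable_cweight i)) (fun z => cweight_ge0 i (t, z))
    (cweight_integral i t) (measurable_position_slice i t).

Lemma path_compE t i (A : set (measurableTypeR R)) : measurable A ->
  path_comp t i A = (\int[gam]_z (cweight i (t, z) * \1_A (X i z t))%:E)%E.
Proof.
move=> mA; rewrite -[LHS]mul1e -[X in (X%:E * _)%E]/(1 : R).
have := integral_wpush (measurable_path_slice t (measurable_cweight i))
  (fun z => cweight_ge0 i (t, z)) (cweight_integral i t)
  (measurable_position_slice i t) (g := fun x => (\1_A x)%:E).
move=> <-; last 2 first.
- by apply/measurable_EFinP; exact: measurable_indic.
- by move=> x; rewrite lee_fin.
by rewrite integral_indic// setIT mul1e.
Qed.

Lemma path_mass t : (\sum_(i < 2) path_comp t i setT = 1)%E.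
Proof.
rewrite sume_ord2 !path_compE// -ge0_integralD//; last 4 first.
- by move=> z _; rewrite lee_fin mulr_ge0// cweight_ge0.
- apply/measurable_EFinP; apply: measurable_funM; first exact: measurable_path_slice (measurable_cweight _).
  exact: measurableT_comp (@measurable_indic _ _ R _ setT measurableT) (measurable_position_slice _ t).
- by move=> z _; rewrite lee_fin mulr_ge0// cweight_ge0.
- apply/measurable_EFinP; apply: measurable_funM; first exact: measurable_path_slice (measurable_cweight _).
  exact: measurableT_comp (@measurable_indic _ _ R _ setT measurableT) (measurable_position_slice _ t).
rewrite (eq_integral (cst 1%E)); first by rewrite integral_cst// mul1e; exact: probability_setT.
by move=> z _; rewrite !indicT !mulr1 -EFinD cweight_sum.
Qed.

Definition path_law (t : R) : vprob R 2 := VProb (path_mass t).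

Lemma integral_path_law t i (g : measurableTypeR R -> \bar R) :
  measurable_fun setT g -> (forall x, 0 <= g x)%E ->
  (\int[path_law t i]_x g x = \int[gam]_z ((cweight i (t, z))%:E * g (X i z t)))%E.
Proof. by move=> mg g0; rewrite integral_wpush. Qed.

Lemma Rintegral_path_law t i (eta : measurableTypeR R -> R) : measurable_fun setT eta ->
  \int[path_law t i]_x eta x = \int[gam]_z (cweight i (t, z) * eta (X i z t)).
Proof.
move=> meta; transitivity (\int[path_law t i]_x (eta x * 1)).
  by apply: eq_Rintegral => x _; rewrite mulr1.
apply: (@Rintegral_transfer _ _ _ _ R (path_law t i) gam (fun z => X i z t) (fun=> 1)
  (fun z => cweight i (t, z)) _ _ _ eta meta) => // [z|g mg g0]; first exact: cweight_ge0.
under eq_integral do rewrite mulr1.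
by rewrite integral_path_law//; exact/measurable_EFinP.
Qed.

Definition path_mass_st (i : 'I_2) : {finite_measure set RR -> \bar R} :=
  wpush (measurable_cweight i) (cweight_ge0 i) (cweight_integralP i) (measurable_position i).

Lemma integral_path_mass_st i (g : RR -> \bar R) :
  measurable_fun setT g -> (forall x, 0 <= g x)%E ->
  (\int[path_mass_st i]_x g x = \int[time_path]_y ((cweight i y)%:E * g (position i y)))%E.
Proof. by move=> mg g0; rewrite integral_wpush. Qed.

Lemma path_disintegrates i : disintegrates (path_law^~ i) (path_mass_st i).
Proof.
move=> G mG G0.
pose F (y : TZ) : \bar R := ((cweight i y)%:E * G (position i y))%E.
have mF : measurable_fun setT F.
  apply: emeasurable_funM; first by apply/measurable_EFinP; exact: measurable_cweight.
  exact: measurableT_comp mG (measurable_position i).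
have F0 y : (0 <= F y)%E by rewrite mule_ge0// lee_fin cweight_ge0.
have E t : (\int[path_law t i]_x G (x, t) = fubini_F gam F t)%E.
  by rewrite integral_path_law//; exact: measurableT_comp mG (pair2_measurable (t : measurableTypeR R)).
have mFF := @measurable_fun_fubini_tonelli_F _ _ _ _ _ gam F mF F0.
split.
  rewrite (_ : (fun t => _) = fubini_F gam F); last by apply/funext => t; exact: E.
  exact: measurable_funTS.
rewrite integral_path_mass_st// fubini_tonelli1// integral_unit_time//.
  by apply: eq_integral => t _; exact: E.
by move=> t; apply: integral_ge0 => z _; exact: F0.
Qed.

Definition path_bar : set RR -> \bar R :=
  measure_add (path_mass_st ord0) (path_mass_st ord_max).

HB.instance Definition _ := Measure.on path_bar.

Let path_bar_fin : fin_num_fun path_bar.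
Proof.
move=> A mA; rewrite /path_bar /measure_add/= /msum big_ord_recl big_ord1/= fin_numD.
by rewrite !fin_num_measure.
Qed.

HB.instance Definition _ := Measure_isFinite.Build _ _ _ path_bar path_bar_fin.

Lemma integral_path_bar (g : RR -> \bar R) :
  measurable_fun setT g -> (forall x, 0 <= g x)%E ->
  (\int[path_bar]_x g x = \int[path_mass_st ord0]_x g x + \int[path_mass_st ord_max]_x g x)%E.
Proof. by move=> mg g0; rewrite /path_bar ge0_integral_measure_add. Qed.

Lemma integral_vbar (m : vprob R 2) (g : measurableTypeR R -> \bar R) :
  measurable_fun setT g -> (forall x, 0 <= g x)%E ->
  (\int[vbar m]_x g x = \int[m ord0]_x g x + \int[m ord_max]_x g x)%E.
Proof.
move=> mg g0; rewrite -ge0_integral_measure_add//.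
apply: eq_measure_integral => A mA _.
transitivity (m ord0 A + m ord_max A)%E; first exact: sume_ord2.
by rewrite /measure_add/= /msum big_ord_recl big_ord1.
Qed.

Lemma path_bar_disintegrates : disintegrates (fun t => vbar (path_law t)) path_bar.
Proof.
move=> G mG G0.
have [m0 E0] := path_disintegrates ord0 mG G0.
have [m1 E1] := path_disintegrates ord_max mG G0.
have mGt t : measurable_fun [set: measurableTypeR R] (fun x => G (x, t)).
  exact: measurableT_comp mG (pair2_measurable (t : measurableTypeR R)).
have E : (fun t => \int[vbar (path_law t)]_x G (x, t))%E = (fun t =>
   \int[path_law t ord0]_x G (x, t) + \int[path_law t ord_max]_x G (x, t))%E.
  by apply/funext => t; rewrite integral_vbar.
rewrite E; split; first by apply: emeasurable_funD; [exact: m0|exact: m1].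
rewrite integral_path_bar// -E0 -E1 -ge0_integralD//.
- by move=> t _; exact: integral_ge0.
- by move=> t _; exact: integral_ge0.
Qed.

Lemma integral_time_path (F : TZ -> \bar R) : measurable_fun setT F ->
  (forall y, 0 <= F y)%E ->
  (\int[time_path]_y F y =
   \int[gam]_z \int[leb]_(t in `[0%R, 1%R]) F (t, z))%E.
Proof.
move=> mF F0; rewrite fubini_tonelli2; [|exact: mF|exact: F0]; apply: eq_integral => z _.
rewrite /fubini_G integral_unit_time; [by []| |by move=> t; exact: F0].
exact: measurableT_comp mF (pair2_measurable z).
Qed.

Section energy.
Variables (e : Z -> R) (C : R).
Hypotheses (energy_le : forall z t, 0 <= t <= 1 ->
    weight ord0 z t * Xd ord0 z t ^+ 2 + weight ord_max z t * Xd ord_max z t ^+ 2 +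
    2 * pd z t ^+ 2 <= e z)
  (energyC : (\int[gam]_z (e z)%:E <= C%:E)%E).

Definition transport_density (i : 'I_2) (y : TZ) : R := cweight i y * Xd i y.2 y.1.
Definition exchange_path (y : TZ) : R := pd y.2 y.1.

Lemma measurable_transport_density i : measurable_fun [set: TZ] (transport_density i).
Proof. by apply: measurable_funM; [exact: measurable_cweight|exact: (pp_measurable_Xd pp)]. Qed.

(** The bound e z holds at all times, so integrating over [0,1] does not increase it. The three
    pieces are named separately because the duality estimates below take one real constant each. *)
Lemma path_energy : exists k0 k1 k : R,
  [/\ (\int[time_path]_y (cweight ord0 y * Xd ord0 y.2 y.1 ^+ 2)%:E = k0%:E)%E,
      (\int[time_path]_y (cweight ord_max y * Xd ord_max y.2 y.1 ^+ 2)%:E = k1%:E)%E,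
      (\int[time_path]_y (exchange_path y ^+ 2)%:E = k%:E)%E &
      k0 + (k1 + 2 * k) <= C].
Proof.
pose f i (y : TZ) := cweight i y * Xd i y.2 y.1 ^+ 2.
have mf i : measurable_fun [set: TZ] (f i).
  apply: measurable_funM; first exact: measurable_cweight.
  by apply: measurable_funX; exact: (pp_measurable_Xd pp).
have f0 i y : 0 <= f i y by rewrite mulr_ge0 ?cweight_ge0 ?sqr_ge0.
pose g (y : TZ) := exchange_path y ^+ 2.
have mg : measurable_fun [set: TZ] g by apply: measurable_funX; exact: (pp_measurable_pd pp).
have g0 y : 0 <= g y by exact: sqr_ge0.
have i0 (h : TZ -> R) : (forall y, 0 <= h y) -> (0 <= \int[time_path]_y (h y)%:E)%E.
  by move=> h0; apply: integral_ge0 => y _; rewrite lee_fin.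
have n0 y : 0 <= 2 * g y by apply: mulr_ge0; rewrite ?g0.
have S : (\int[time_path]_y (f ord0 y)%:E + (\int[time_path]_y (f ord_max y)%:E +
    2%:E * \int[time_path]_y (g y)%:E) <= C%:E)%E.
  rewrite -ge0_integralZl//; last 2 first.
  - exact/measurable_EFinP.
  - by move=> y _; rewrite lee_fin.
  rewrite -ge0_integralD//; last 4 first.
  - by move=> y _; rewrite lee_fin.
  - exact/measurable_EFinP.
  - by move=> y _; rewrite -EFinM lee_fin mulr_ge0.
  - by apply/measurable_EFinP; exact: measurable_funM.
  rewrite -ge0_integralD//; last 4 first.
  - by move=> y _; rewrite lee_fin.
  - exact/measurable_EFinP.
  - by move=> y _; rewrite -EFinM -!EFinD lee_fin addr_ge0.
  - apply/measurable_EFinP; apply: measurable_funD; first exact: mf.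
    exact: measurable_funM.
  rewrite integral_time_path; last 2 first.
  - apply/measurable_EFinP; apply: measurable_funD => //.
    by apply: measurable_funD => //; exact: measurable_funM.
  - by move=> y; rewrite -EFinM -!EFinD lee_fin addr_ge0 ?addr_ge0.
  apply: le_trans energyC; apply: ge0_le_lower_integral => z _.
    by apply: integral_ge0 => t _; rewrite -EFinM -!EFinD lee_fin addr_ge0 ?addr_ge0.
  rewrite -[leRHS]integral01_cst; apply: ge0_le_lower_integral => t.
    by move=> _; rewrite -EFinM -!EFinD lee_fin addr_ge0 ?addr_ge0.
  rewrite /= in_itv/= => t01; rewrite -EFinM -!EFinD lee_fin (le_trans _ (energy_le z t01))//.
  by rewrite /f /g /cweight /exchange_path /= clip_id// addrA.
move: S (i0 _ (f0 ord0)) (i0 _ (f0 ord_max)) (i0 _ g0); rewrite -/(f _ _).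
case E0 : (\int[time_path]_y (f ord0 y)%:E)%E => [k0| |] //;
case E1 : (\int[time_path]_y (f ord_max y)%:E)%E => [k1| |] //;
case E2 : (\int[time_path]_y (g y)%:E)%E => [k| |] //.
- by rewrite -EFinM -!EFinD lee_fin => le _ _ _; exists k0, k1, k.
all: by rewrite ?gt0_muley ?lte_fin ?ltr0n// -?EFinM.
Qed.

(** The pointwise inequality is 2 |Xd| g <= Xd^2 + g^2 multiplied by the weight, which is the
    density of the space-time law. *)
Lemma transport_young i (k : R) :
  (\int[time_path]_y (cweight i y * Xd i y.2 y.1 ^+ 2)%:E = k%:E)%E ->
  forall (g : RR -> R) (b : R), measurable_fun setT g -> (forall x, 0 <= g x <= b) ->
  (2%:E * \int[time_path]_y (`|transport_density i y| * g (position i y))%:E <=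
   k%:E + \int[path_mass_st i]_x (g x ^+ 2)%:E)%E.
Proof.
move=> kE g b mg gb; have g0 x : 0 <= g x by have /andP[] := gb x.
have mgp : measurable_fun [set: TZ] (fun y => g (position i y)).
  exact: measurableT_comp mg (measurable_position i).
rewrite integral_path_mass_st; last 2 first.
- by apply/measurable_EFinP; exact: measurable_funX.
- by move=> x; rewrite lee_fin sqr_ge0.
rewrite -kE -ge0_integralD//; last 4 first.
- by move=> y _; rewrite lee_fin mulr_ge0 ?cweight_ge0 ?sqr_ge0.
- apply/measurable_EFinP; apply: measurable_funM; first exact: measurable_cweight.
  by apply: measurable_funX; exact: (pp_measurable_Xd pp).
- by move=> y _; rewrite -EFinM lee_fin mulr_ge0 ?cweight_ge0 ?sqr_ge0.
- apply/measurable_EFinP; apply: measurable_funM; first exact: measurable_cweight.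
  exact: measurable_funX.
rewrite -ge0_integralZl//; last 2 first.
- apply/measurable_EFinP; apply: measurable_funM => //.
  by apply: measurableT_comp => //; exact: measurable_transport_density.
- by move=> y _; rewrite lee_fin mulr_ge0.
apply: ge0_le_lower_integral => y _.
  by rewrite -EFinM lee_fin !mulr_ge0.
rewrite -!EFinM -EFinD lee_fin /transport_density normrM (ger0_norm (cweight_ge0 _ _)).
rewrite -mulrDr -mulrA mulrCA ler_wpM2l ?cweight_ge0//.
rewrite -[X in _ <= X + _]real_normK ?num_real//.
by have := sqr_ge0 (`|Xd i y.2 y.1| - g (position i y)); rewrite sqrrB -mulr_natl; lra.
Qed.

(** The left side carries no weight, so the right side must provide g^2 with total weight 1. When
    the particles are apart, [pp_merge] makes the left side vanish; when they sit together, the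
    weights of the two nodes add up to 1 at the common position. *)
Lemma exchange_young (k : R) :
  (\int[time_path]_y (exchange_path y ^+ 2)%:E = k%:E)%E ->
  forall (g : RR -> R) (b : R), measurable_fun setT g -> (forall x, 0 <= g x <= b) ->
  (2%:E * \int[time_path]_y (`|exchange_path y| * g (position ord0 y))%:E <=
   k%:E + \int[path_bar]_x (g x ^+ 2)%:E)%E.
Proof.
move=> kE g b mg gb; have g0 x : 0 <= g x by have /andP[] := gb x.
have mgp i : measurable_fun [set: TZ] (fun y => g (position i y)).
  exact: measurableT_comp mg (measurable_position i).
have mpd : measurable_fun [set: TZ] exchange_path by exact: (pp_measurable_pd pp).
have mgX : measurable_fun [set: RR] (fun x => (g x ^+ 2)%:E).
  by apply/measurable_EFinP; exact: measurable_funX.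
have gX0 x : (0 <= (g x ^+ 2)%:E)%E by rewrite lee_fin sqr_ge0.
have mcg i : measurable_fun [set: TZ] (fun y => (cweight i y)%:E * (g (position i y) ^+ 2)%:E)%E.
  apply/measurable_EFinP; apply: measurable_funM; first exact: measurable_cweight.
  exact: measurable_funX.
have cg0 i y : (0 <= (cweight i y)%:E * (g (position i y) ^+ 2)%:E)%E.
  by rewrite -EFinM lee_fin mulr_ge0 ?cweight_ge0 ?sqr_ge0.
rewrite integral_path_bar// !integral_path_mass_st//.
rewrite -(@ge0_integralD _ _ _ time_path _ measurableT)//.
rewrite -kE -ge0_integralD//; last 4 first.
- by move=> y _; rewrite lee_fin sqr_ge0.
- by apply/measurable_EFinP; exact: measurable_funX.
- by move=> y _; rewrite adde_ge0.
- exact: emeasurable_funD.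
rewrite -ge0_integralZl//; last 2 first.
- apply/measurable_EFinP; apply: measurable_funM => //.
  exact: measurableT_comp.
- by move=> y _; rewrite lee_fin mulr_ge0.
apply: ge0_le_lower_integral => y _.
  by rewrite -EFinM lee_fin !mulr_ge0.
rewrite -!EFinM -!EFinD lee_fin.
have [E|ne] := eqVneq (X ord0 y.2 y.1) (X ord_max y.2 y.1); last first.
  rewrite /exchange_path (pp_merge pp ne) normr0 mul0r mulr0 expr0n add0r.
  by rewrite addr_ge0 ?mulr_ge0 ?cweight_ge0 ?sqr_ge0.
have -> : position ord_max y = position ord0 y by rewrite /position E.
rewrite -mulrDl cweight_sum mul1r -[X in _ <= X + _]real_normK ?num_real//.
by have := sqr_ge0 (`|exchange_path y| - g (position ord0 y)); rewrite sqrrB -mulr_natl; lra.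
Qed.

End energy.

Lemma is_derive_weight i z (t : R) : is_derive t 1 (weight i z) (edge_sign i * pd z t).
Proof. exact: is_derive_simplex_param (pp_derive_p pp z t). Qed.

Section solution.
Variables (U : 'I_2 -> RR -> R) (S : RR -> R) (k : 'I_2 -> R) (ks : R).
Hypotheses (mU : forall i, measurable_fun setT (U i)) (mS : measurable_fun setT S)
  (UE : forall i (g : RR -> R) (b : R), measurable_fun setT g -> (forall x, `|g x| <= b) ->
    \int[path_mass_st i]_x (g x * U i x) =
    \int[time_path]_y (transport_density i y * g (position i y)))
  (SE : forall (g : RR -> R) (b : R), measurable_fun setT g -> (forall x, `|g x| <= b) ->
    \int[path_bar]_x (g x * S x) =
    \int[time_path]_y (exchange_path y * g (position ord0 y)))
  (U2 : forall i, (\int[path_mass_st i]_x (U i x ^+ 2)%:E <= (k i)%:E)%E)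
  (S2 : (\int[path_bar]_x (S x ^+ 2)%:E <= ks%:E)%E)
  (itd : forall i, time_path.-integrable setT (EFin \o transport_density i))
  (iex : time_path.-integrable setT (EFin \o exchange_path)).

Definition path_velocity (i : 'I_2) (t x : R) : R := U i (x, t).
(** The antisymmetric exchange with v_12 = 2 S: since theta is 1/2, this moves mass to node 1 at the
    rate S relative to the total mass. *)
Definition path_exchange (i j : 'I_2) (t x : R) : R :=
  S (x, t) * ((i == ord0)%:R - (j == ord0)%:R) * 2.

Lemma U_integrable i : (path_mass_st i).-integrable setT (EFin \o U i).
Proof. exact: finite_square_integrable (mU i) (U2 i). Qed.

Lemma S_integrable : path_bar.-integrable setT (EFin \o S).
Proof. exact: finite_square_integrable mS S2. Qed.

Lemma path_exchange_diag i t x : path_exchange i i t x = 0.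
Proof. by rewrite /path_exchange subrr mulr0 mul0r. Qed.

Lemma measurable_path_exchange i j :
  measurable_fun [set: RR] (fun z => path_exchange i j z.2 z.1).
Proof.
apply: measurable_funM => //; apply: measurable_funM => //.
by apply: measurableT_comp mS _; rewrite (_ : (fun _ => _) = id)//; apply/funext => -[].
Qed.

Lemma measurable_path_velocity i :
  measurable_fun [set: RR] (fun z => path_velocity i z.2 z.1).
Proof.
by apply: measurableT_comp (mU i) _; rewrite (_ : (fun _ => _) = id)//; apply/funext => -[].
Qed.

Lemma path_measurable_slice (f : RR -> R) t : measurable_fun setT f ->
  measurable_fun [set: measurableTypeR R] (fun x => f (x, t)).
Proof. by move=> mf; exact: measurableT_comp mf (pair2_measurable (t : measurableTypeR R)). Qed.

Lemma path_narrow_continuous : narrow_continuous 0 1 path_law.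
Proof.
move=> i eta ceta [M [_ bM]].
have [b etab] : exists b, forall x, `|eta x| <= b.
  by exists (M + 1) => x; apply: (bM (M + 1)); rewrite ?ltrDl.
have meta := continuous_measurableT ceta.
have E t := Rintegral_path_law t i meta.
have mf t : measurable_fun setT (fun z => cweight i (t, z) * eta (X i z t)).
  apply: measurable_funM; first exact: measurable_path_slice (measurable_cweight i).
  exact: measurableT_comp meta (measurable_position_slice i t).
have fb t z : `|cweight i (t, z) * eta (X i z t)| <= b.
  rewrite normrM -[leRHS]mul1r ler_pM// cweight_norm//.
rewrite (_ : (fun t => _) = fun t => \int[gam]_z (cweight i (t, z) * eta (X i z t))); last exact/funext.
have cz z : continuous (fun t => cweight i (t, z) * eta (X i z t)).
  move=> t; apply: cvgM.
    have cw : continuous (weight i z).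
      by move=> s; apply: derivable_continuous1; have [] := is_derive_weight i z s.
    exact: continuous_comp (@continuous_clip _ t) (cw _).
  apply: continuous_comp; last exact: ceta.
  by apply: derivable_continuous1; have [] := pp_derive_X pp i z t.
(* Continuity under the integral is obtained on an open interval, hence the enlargement of [0,1].
   The clipped weights keep the integrand bounded there. *)
have cI : {in `](-1), 2[%classic, continuous (fun t => \int[gam]_z (cweight i (t, z) * eta (X i z t)))}.
  apply: (@continuity_under_integral R _ Z gam
    (fun t z => cweight i (t, z) * eta (X i z t)) setT measurableT (-1) 2 _ _ (cst b)).
  - by move=> t _; exact: bounded_integrable (mf t) (fb t).
  - by apply: aeW => z _ t _; exact: cz.
  - by apply: (@bounded_integrable _ _ _ gam (cst b) `|b|).
  - by move=> t _; apply: aeW => z _; exact: fb.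
apply: continuous_in_subspaceT => t; rewrite inE/= in_itv/= => /andP[t0 t1].
by apply: cI; rewrite inE/= in_itv/=; lra.
Qed.

Lemma Rintegral_path_mass_st i (g : RR -> R) : measurable_fun setT g ->
  \int[path_mass_st i]_x g x = \int[time_path]_y (cweight i y * g (position i y)).
Proof.
move=> mg; transitivity (\int[path_mass_st i]_x (g x * 1)).
  by apply: eq_Rintegral => x _; rewrite mulr1.
apply: (@Rintegral_transfer _ _ _ _ R (path_mass_st i) time_path (position i) (fun=> 1)
  (cweight i) _ _ _ g mg) => // [y|h mh h0]; first exact: cweight_ge0.
transitivity (\int[path_mass_st i]_x (h x)%:E)%E.
  by apply: eq_integral => x _; rewrite mulr1.
by rewrite integral_path_mass_st//; exact/measurable_EFinP.
Qed.

Definition path_rate i (eta : R * R -> R) (y : TZ) : R :=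
  cweight i y * 'D_((0, 1) : R * R) eta (position i y) +
  transport_density i y * 'D_((1, 0) : R * R) eta (position i y) +
  edge_sign i * (exchange_path y * eta (position i y)).

(** For fixed z, [path_rate] is the time derivative of weight(t) eta(X(t), t), and eta vanishes at
    times 0 and 1. By Fubini the time integral may be taken first, for almost every z. *)
Lemma path_rate_integral0 (i : 'I_2) (eta : R * R -> R) :
  test_function ([set: R] `*` `]0, 1[ : set (R * R)%type) eta ->
  time_path.-integrable setT (EFin \o path_rate i eta) ->
  \int[time_path]_y path_rate i eta y = 0.
Proof.
move=> teta irate; rewrite /Rintegral -integral21_prod_meas1//.
have mrate : measurable_fun [set: TZ] (path_rate i eta).
  by have := measurable_int _ irate; move/measurable_EFinP.
have [Ceta _ _] := teta.
have mH := measurable_fubini_G irate.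
rewrite (@ae_eq_integral _ _ _ gam setT (cst 0%E))//; first by rewrite integral_cst// mul0e.
have FF := @ae_filter_ringOfSetsType _ _ _ gam.
apply: filterS (ae_integrable2 irate) => z iz _.
rewrite /fubini_G -[LHS]fineK; last exact: integrable_fin_num.
congr EFin; rewrite -[LHS]/(\int[unit_time]_t path_rate i eta (t, z)).
rewrite Rintegral_unit_time; last exact: measurableT_comp mrate (pair2_measurable z).
pose F s := weight i z s * eta (X i z s, s).
pose f s := weight i z s * ('D_((1, 0) : R * R) eta (X i z s, s) * Xd i z s +
      'D_((0, 1) : R * R) eta (X i z s, s)) + eta (X i z s, s) * (edge_sign i * pd z s).
have cD (v : R * R) : continuous ('D_v eta) := test_function_continuous_derive teta.
have ceta := test_function_continuous teta.
have cX : continuous (X i z).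
  by move=> s; apply: derivable_continuous1; have [] := pp_derive_X pp i z s.
have cX2 : continuous (fun s => (X i z s, s)).
  by move=> s; exact: cvg_pair (cX s) cvg_id.
have cw : continuous (weight i z).
  by move=> s; apply: derivable_continuous1; have [] := is_derive_weight i z s.
have dF (s : R) : is_derive s 1 F (f s).
  have D := is_deriveM (is_derive_weight i z s) (is_derive_curve (Ceta 1%N) (cD _) (pp_derive_X pp i z s)).
  by refine (is_derive_eq D _).
have F'E : F^`()%classic = f.
  by apply/funext => s; rewrite derive1E (@derive_val _ _ _ _ _ _ _ (dF s)).
transitivity (\int[leb]_(t in `[0, 1]) F^`()%classic t).
  apply: eq_Rintegral => t; rewrite inE/= in_itv/= => t01.
  rewrite F'E /path_rate /f /transport_density /cweight /exchange_path /position/= clip_id//.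
  ring.
rewrite Rintegral_derive1//.
  by rewrite /F !(test_function_eq0 teta) ?mulr0 ?subrr//= in_itv/= ltxx ?andbF => -[].
rewrite F'E => s; apply: cvgD.
  apply: cvgM; first exact: cw.
  apply: cvgD; last exact: continuous_comp (cX2 s) (cD _ _).
  by apply: cvgM; [exact: continuous_comp (cX2 s) (cD _ _)|exact: pp_continuous_Xd pp i z s].
apply: cvgM; first exact: continuous_comp (cX2 s) (ceta _).
by apply: cvgM; [exact: cvg_cst|exact: pp_continuous_pd pp z s].
Qed.

Lemma Rintegral_vbar_vtheta (m : vprob R 2) i j (f : R -> R) : i != j ->
  measurable_fun [set: measurableTypeR R] f ->
  \int[vbar m]_x (f x * vtheta amean m i j x) = \int[vbar m]_x (f x / 2).
Proof.
move=> ij mf; congr fine; apply: ae_eq_integral => //.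
- by apply/measurable_EFinP; apply: measurable_funM => //; exact: measurable_vtheta.
- by apply/measurable_EFinP; exact: measurable_funM.
have FF := @ae_filter_ringOfSetsType _ _ _ (vbar m).
have E := vtheta_amean m ij.
by apply: filterS E => x + _ => ->.
Qed.

Lemma edge_signE i j : i != j -> (i == ord0)%:R - (j == ord0)%:R = edge_sign i :> R.
Proof.
rewrite /edge_sign; have [->|->] := ord2_cases i; have [->|->] := ord2_cases j;
  by rewrite ?eqxx ?ord_max_neq0 //= ?subr0 ?sub0r.
Qed.

(** Off the diagonal the difference of the two exchanges is 4 S up to sign, and theta contributes
    1/2. The result is an integral against [path_bar], where S is characterized by [SE]. *)
Lemma path_exchange_integral (eta : RR -> R) (b : R) i j :
  measurable_fun setT eta -> (forall z, `|eta z| <= b) ->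
  \int[leb]_(t in `[0, 1])
    \int[vbar (path_law t)]_x (eta (x, t) * vtheta amean (path_law t) i j x *
      (path_exchange i j t x - path_exchange j i t x) * two_node_weight i j) =
  (i != j)%:R * (2 * edge_sign i * \int[time_path]_y (exchange_path y * eta (position ord0 y))).
Proof.
move=> meta etab; have [->|ij] := eqVneq i j.
  rewrite (_ : (~~ true)%:R = 0 :> R)// mul0r; apply: Rintegral_eq0 => t _; apply: Rintegral_eq0 => x _.
  by rewrite /two_node_weight eqxx mulr0.
rewrite mul1r; transitivity (\int[leb]_(t in `[0, 1]) \int[vbar (path_law t)]_x
    ((2 * edge_sign i * eta (x, t)) * S (x, t))).
  apply: eq_Rintegral => t _.
  transitivity (\int[vbar (path_law t)]_x
      ((4 * edge_sign i * eta (x, t) * S (x, t)) * vtheta amean (path_law t) i j x)).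
    apply: eq_Rintegral => x _; rewrite /two_node_weight ij mulr1.
    rewrite /path_exchange (edge_signE ij) -(opprB (_ == _)%:R) (edge_signE ij); ring.
  rewrite (@Rintegral_vbar_vtheta (path_law t) i j
    (fun x => 4 * edge_sign i * eta (x, t) * S (x, t)) ij).
    by apply: eq_Rintegral => x _; field.
  apply: measurable_funM; last exact: path_measurable_slice.
  by apply: measurable_funM => //; exact: path_measurable_slice.
have mg : measurable_fun [set: RR] (fun z => 2 * edge_sign i * eta z).
  exact: measurable_funM.
have gb z : `|2 * edge_sign i * eta z| <= 2 * b.
  by rewrite normrM ler_pM// normrM normr_edge_sign mulr1 ger0_norm.
rewrite (disintegration_Rintegral path_bar_disintegrates
  (bounded_mul_integrable mg gb S_integrable)) (SE mg gb).
have ieta : time_path.-integrable setT (EFin \o (fun y => exchange_path y * eta (position ord0 y))).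
  have mc : measurable_fun [set: TZ] (fun y => eta (position ord0 y)).
    exact: measurableT_comp meta (measurable_position ord0).
  have := bounded_mul_integrable mc (fun y => etab _) iex.
  apply: eq_integrable => // y _ /=.
  by rewrite mulrC.
rewrite -RintegralZl//; apply: eq_Rintegral => y _; ring.
Qed.

Lemma path_weak (eta : R * R -> R) (i : 'I_2) :
  test_function ([set: R] `*` `]0, 1[ : set (R * R)%type) eta ->
  \int[leb]_(t in `[0, 1]) \int[path_law t i]_x 'D_((0, 1) : R * R) eta (x, t) =
  - (\int[leb]_(t in `[0, 1])
       \int[path_law t i]_x ('D_((1, 0) : R * R) eta (x, t) * path_velocity i t x))
  - 2^-1 * (\sum_(j < 2) \int[leb]_(t in `[0, 1])
       \int[vbar (path_law t)]_x (eta (x, t) * vtheta amean (path_law t) i j x *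
         (path_exchange i j t x - path_exchange j i t x) * two_node_weight i j)).
Proof.
move=> teta.
have [b0 eb0] := test_function_bounded teta.
have [b1 eb1] := test_function_derive_bounded ((1, 0) : R * R) teta.
have [b2 eb2] := test_function_derive_bounded ((0, 1) : R * R) teta.
have meta : measurable_fun [set: RR] eta.
  exact: continuous_measurable2 (test_function_continuous teta).
have mD (v : R * R) : measurable_fun [set: RR] ('D_v eta).
  exact: continuous_measurable2 (test_function_continuous_derive teta).
have mp (g : RR -> R) j : measurable_fun setT g -> measurable_fun [set: TZ] (fun y => g (position j y)).
  by move=> mg; exact: measurableT_comp mg (measurable_position j).
rewrite (disintegration_Rintegral (path_disintegrates i)
  (bounded_integrable (path_mass_st i) (mD _) eb2)) Rintegral_path_mass_st//.
rewrite (disintegration_Rintegral (path_disintegrates i)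
  (bounded_mul_integrable (mD _) eb1 (U_integrable i))) (UE i (mD _) eb1).
have -> : \sum_(j < 2) \int[leb]_(t in `[0, 1])
       \int[vbar (path_law t)]_x (eta (x, t) * vtheta amean (path_law t) i j x *
         (path_exchange i j t x - path_exchange j i t x) * two_node_weight i j) =
    2 * edge_sign i * \int[time_path]_y (exchange_path y * eta (position ord0 y)).
  rewrite sum_ord2 !(path_exchange_integral _ _ meta eb0).
  by have [->|->] := ord2_cases i; rewrite ?eqxx ?[ord0 == _]eq_sym ord_max_neq0 /=
    ?mul0r ?mul1r ?addr0 ?add0r.
have i1 : time_path.-integrable setT
    (EFin \o (fun y => cweight i y * 'D_((0, 1) : R * R) eta (position i y))).
  apply: (@bounded_integrable _ _ _ _ _ b2).
    by apply: measurable_funM; [exact: measurable_cweight|exact: (mp _ i (mD (0, 1)))].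
  by move=> y; rewrite normrM -[leRHS]mul1r ler_pM// cweight_norm.
have i2 : time_path.-integrable setT
    (EFin \o (fun y => transport_density i y * 'D_((1, 0) : R * R) eta (position i y))).
  have := bounded_mul_integrable (mp _ i (mD (1, 0))) (fun y => eb1 _) (itd i).
  by apply: eq_integrable => // y _ /=; rewrite mulrC.
have i3 : time_path.-integrable setT
    (EFin \o (fun y => exchange_path y * eta (position i y))).
  have := bounded_mul_integrable (mp _ i meta) (fun y => eb0 _) iex.
  by apply: eq_integrable => // y _ /=; rewrite mulrC.
(* S was conditioned on the position of particle 1, but the equation for node i needs that of
   particle i; exchange happens only where the two coincide. *)
have -> : \int[time_path]_y (exchange_path y * eta (position ord0 y)) =
    \int[time_path]_y (exchange_path y * eta (position i y)).
  apply: eq_Rintegral => y _.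
  have [E|ne] := eqVneq (X ord0 y.2 y.1) (X ord_max y.2 y.1).
    by rewrite /position; have [->|->] := ord2_cases i; rewrite ?E.
  by rewrite /exchange_path (pp_merge pp ne) !mul0r.
have i4 : time_path.-integrable setT
    (EFin \o (fun y => edge_sign i * (exchange_path y * eta (position i y)))).
  have := integrableZl measurableT (edge_sign i) i3.
  by apply: eq_integrable => // y _ /=.
have irate : time_path.-integrable setT (EFin \o path_rate i eta).
  have := integrableD measurableT (integrableD measurableT i1 i2) i4.
  by apply: eq_integrable => // y _ /=.
have := path_rate_integral0 teta irate.
rewrite RintegralD//; last first.
  have := integrableD measurableT i1 i2.
  by apply: eq_integrable => // y _ /=.
rewrite RintegralD// RintegralZl//.
move/eqP; rewrite -addrA addr_eq0 => /eqP ->.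
by rewrite opprD -mulrA mulKf// pnatr_eq0.
Qed.

Lemma path_continuity_equation :
  continuity_equation two_node_weight amean 0 1 path_law path_velocity path_exchange.
Proof.
have sub (A : set RR) (f : RR -> R) : measurable_fun setT f -> measurable_fun A f.
  exact: measurable_funTS.
split.
- exact: path_narrow_continuous.
- by move=> i; apply: sub; exact: measurable_path_velocity.
- move=> i; have mG : measurable_fun [set: RR] (fun z => `|U i z|%:E).
    by apply/measurable_EFinP; exact: measurableT_comp.
  have [_ ->] := path_disintegrates i mG (fun z => normr_ge0 _).
  by have /integrableP[_] := U_integrable i.
- by move=> i j; apply: sub; exact: measurable_path_exchange.
- move=> i j; have [<-|ij] := eqVneq i j.
    rewrite (_ : (\int[leb]_(t in _) _)%E = 0%E) ?ltry//.
    apply: integral0_eq => t _; apply: integral0_eq => x _.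
    by rewrite path_exchange_diag normr0 mul0r.
  have mG : measurable_fun [set: RR] (fun z => (`|path_exchange i j z.2 z.1| / 2)%:E).
    apply/measurable_EFinP; apply: measurable_funM => //.
    by apply: measurableT_comp => //; exact: measurable_path_exchange.
  have [_ E] := path_bar_disintegrates mG (fun z => divr_ge0 (normr_ge0 _) (ler0n _ 2)).
  rewrite (_ : (\int[leb]_(t in _) _)%E = (\int[path_bar]_z (`|path_exchange i j z.2 z.1| / 2)%:E)%E).
    rewrite (eq_integral (fun z => `|S z|%:E)); first by have /integrableP[_] := S_integrable.
    move=> [x t] _; rewrite /path_exchange/= (edge_signE ij) !normrM; congr EFin.
    rewrite normr_edge_sign.
    by rewrite mulr1 (ger0_norm (ler0n _ 2)) mulfK// pnatr_eq0.
  rewrite -E; apply: eq_integral => t _.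
  apply: vtheta_integral => // .
  apply: measurableT_comp => //; exact: (path_measurable_slice t (measurable_path_exchange i j)).
- exact: path_weak.
Qed.

(** With v_12 = - v_21 = 2 S the exchange density is 4 S^2; the factor 1/2 in the action leaves 2
    S^2, the coefficient already present in the energy of the paths. *)
Lemma path_action_le :
  (total_action path_law path_velocity path_exchange <=
   (k ord0 + (k ord_max + 2 * ks))%:E)%E.
Proof.
have mI : measurable (`[0%R, 1%R]%classic : set (measurableTypeR R)).
  exact: measurable_itv.
have mG i : measurable_fun [set: RR] (fun z => (U i z ^+ 2)%:E).
  by apply/measurable_EFinP; exact: measurable_funX.
have G0 i z : (0 <= (U i z ^+ 2)%:E)%E by rewrite lee_fin sqr_ge0.
have mH : measurable_fun [set: RR] (fun z => (4 * S z ^+ 2)%:E).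
  by apply/measurable_EFinP; apply: measurable_funM => //; exact: measurable_funX.
have H0 z : (0 <= (4 * S z ^+ 2)%:E)%E by rewrite lee_fin mulr_ge0// sqr_ge0.
have [m0 E0] := path_disintegrates ord0 (mG ord0) (G0 ord0).
have [m1 E1] := path_disintegrates ord_max (mG ord_max) (G0 ord_max).
have [mx Ex] := path_bar_disintegrates mH H0.
have a0 i t : (0 <= \int[path_law t i]_x (U i (x, t) ^+ 2)%:E)%E by exact: integral_ge0.
have x0 t : (0 <= \int[vbar (path_law t)]_x (4 * S (x, t) ^+ 2)%:E)%E by exact: integral_ge0.
have hx0 t : (0 <= (2^-1)%:E * \int[vbar (path_law t)]_x (4 * S (x, t) ^+ 2)%:E)%E.
  by rewrite mule_ge0// lee_fin.
rewrite /total_action; have -> : (\int[leb]_(t in `[0%R, 1%R])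
    action two_node_weight amean (path_law t) (fun i => path_velocity i t)
      (fun i j => path_exchange i j t) =
  \int[leb]_(t in `[0%R, 1%R]) (\int[path_law t ord0]_x (U ord0 (x, t) ^+ 2)%:E +
    (\int[path_law t ord_max]_x (U ord_max (x, t) ^+ 2)%:E +
     (2^-1)%:E * \int[vbar (path_law t)]_x (4 * S (x, t) ^+ 2)%:E)))%E.
  apply: eq_integral => t; rewrite inE/= in_itv/= => t01.
  rewrite (actionE path_continuity_equation t01); congr (_ + (_ + _ * _))%E.
  apply: eq_integral => x _; rewrite /path_exchange !eqxx ord_max_neq0 /=; congr EFin.
  by field.
have mhx : measurable_fun (`[0%R, 1%R]%classic : set (measurableTypeR R))
    (fun t => (2^-1)%:E * \int[vbar (path_law t)]_x (4 * S (x, t) ^+ 2)%:E)%E.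
  exact: measurable_funeM.
rewrite ge0_integralD; [|exact: mI|by move=> t _; exact: a0|exact: m0
  |by move=> t _; apply: adde_ge0; [exact: a0|exact: hx0]|by apply: emeasurable_funD; [exact: m1|exact: mhx]].
rewrite [X in (_ + X <= _)%E]ge0_integralD; [|exact: mI|by move=> t _; exact: (a0 ord_max t)|exact: m1
  |by move=> t _; exact: hx0|exact: mhx].
rewrite ge0_integralZl; [|exact: mI|exact: mx|by move=> t _; exact: x0|by rewrite lee_fin].
rewrite [X in (X + _ <= _)%E]E0 [X in (_ + (X + _) <= _)%E]E1 [X in (_ * X)%E]Ex !EFinD.
apply: leeD; first exact: U2.
apply: leeD; first exact: U2.
have -> : (\int[path_bar]_z (4 * S z ^+ 2)%:E = 4%:E * \int[path_bar]_z (S z ^+ 2)%:E)%E.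
  rewrite -ge0_integralZl//; first by apply/measurable_EFinP; exact: measurable_funX.
  by move=> z _; rewrite lee_fin sqr_ge0.
rewrite muleA -EFinM (_ : 2^-1 * 4 = 2 :> R); last by field.
by rewrite EFinM; apply: lee_wpmul2l => //; rewrite lee_fin.
Qed.

End solution.

(** Each velocity is conditioned relative to the measure against which [action] integrates it: the
    transport velocity of a node relative to the mass of that node, the exchange relative to the
    total mass. Each conditioning keeps its own energy bound. *)
Lemma W_dyn_le_path (e : Z -> R) (C : R) (mu nu : vprob R 2) :
  (forall z t, 0 <= t <= 1 ->
    weight ord0 z t * Xd ord0 z t ^+ 2 + weight ord_max z t * Xd ord_max z t ^+ 2 +
    2 * pd z t ^+ 2 <= e z) ->
  (\int[gam]_z (e z)%:E <= C%:E)%E ->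
  vprob_eq (path_law 0) mu -> vprob_eq (path_law 1) nu ->
  (W_dyn two_node_weight amean mu nu <= sqrte C%:E)%E.
Proof.
move=> eb eC h0 h1.
have [k0 [k1 [ks [E0 E1 Es kC]]]] := path_energy eb eC.
pose k (i : 'I_2) := if i == ord0 then k0 else k1.
have Ek i : (\int[time_path]_y (cweight i y * Xd i y.2 y.1 ^+ 2)%:E = (k i)%:E)%E.
  by rewrite /k; have [->|->] := ord2_cases i; rewrite ?eqxx ?ord_max_neq0.
have H i := conditional_density (measurable_position i) (measurable_transport_density i)
  (transport_young (Ek i)).
have mex : measurable_fun [set: TZ] exchange_path by exact: pp_measurable_pd pp.
have [S [mS SE S2]] := conditional_density (measurable_position ord0) mex (exchange_young Es).
have [U HU] := choice H.
have mU i : measurable_fun setT (U i) by have [] := HU i.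
have UE i := let: And3 _ h _ := HU i in h.
have U2 i := let: And3 _ _ h := HU i in h.
have itd i : time_path.-integrable setT (EFin \o transport_density i).
  apply/integrableP; split; first by apply/measurable_EFinP; exact: measurable_transport_density.
  exact: (young_integrable (transport_young (Ek i))).
have iex : time_path.-integrable setT (EFin \o exchange_path).
  apply/integrableP; split; first exact/measurable_EFinP.
  exact: (young_integrable (exchange_young Es)).
have sol := path_continuity_equation mU mS UE SE U2 S2 itd iex.
have A := path_action_le mU mS UE SE U2 S2 itd iex.
have {}A : (total_action path_law (path_velocity U) (path_exchange S) <= C%:E)%E.
  by apply: le_trans A _; rewrite lee_fin.
rewrite /W_dyn lee_sqrt; last first.
  by apply: le_trans A; apply: integral_ge0 => t _; exact: action_ge0.
apply: ge_ereal_inf; exists (total_action path_law (path_velocity U) (path_exchange S)) => //.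
by exists path_law, (path_velocity U), (path_exchange S); split.
Qed.

End particles.

(** * Comparison with the static quantities *)

Section finite_measures_on_the_line.
Context {R : realType}.
Local Notation TR := (measurableTypeR R).

Lemma clip_le0 (t : R) : t <= 0 -> clip t = 0.
Proof. by move=> t0; rewrite /clip max_l// ge_min t0. Qed.

Lemma clip_ge1 (t : R) : 1 <= t -> clip t = 1.
Proof. by move=> t1; rewrite /clip min_r// max_r. Qed.

Lemma clip_norm (t : R) : `|clip t| <= 1.
Proof. by have /andP[h0 h1] := clip01 t; rewrite ger0_norm. Qed.

Lemma clip_lipschitz (a b : R) : `|clip a - clip b| <= `|a - b|.
Proof.
wlog ab : a b / a <= b.
  move=> H; have [/H//|/ltW/H] := leP a b.
  by rewrite distrC [leRHS]distrC.
rewrite (ler0_norm (_ : a - b <= 0)) ?subr_le0// /clip /Order.max /Order.min.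
by case: (ltP a 1) => a1; case: (ltP b 1) => b1; rewrite ?ltr01; case: (ltP 0 a) => a0;
  case: (ltP 0 b) => b0; rewrite ler_norml; lra.
Qed.

(** Continuous ramps of slope n converge pointwise to the indicator of a closed half-line, so the
    measures agree on half-lines. These are stable under intersection and generate the Borel
    sets. *)
Lemma finite_measure_ext (m1 m2 : {finite_measure set TR -> \bar R}) :
  (forall eta : R -> R, continuous eta -> bounded_fun eta ->
    \int[m1]_x eta x = \int[m2]_x eta x) ->
  forall A : set TR, measurable A -> m1 A = m2 A.
Proof.
move=> H.
have key (a : R) : m1 `[a, +oo[%classic = m2 `[a, +oo[%classic.
  pose f (n : nat) (x : R) := clip (1 + n%:R * (x - a)).
  have cf n : continuous (f n).
    move=> x; apply: (@continuous_comp _ _ _ (fun x => 1 + n%:R * (x - a)) clip).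
      apply: cvgD; first exact: cvg_cst.
      by apply: cvgM; [exact: cvg_cst|apply: cvgB; [exact: cvg_id|exact: cvg_cst]].
    exact: continuous_clip.
  have mf n : measurable_fun [set: TR] (f n) by exact: continuous_measurableT.
  have bf n : bounded_fun (f n).
    by exists 1; split => // b /ltW b1 x _; exact: le_trans (clip_norm _) b1.
  have fcvg x : (f n x)%:E @[n --> \oo] --> (\1_(`[a, +oo[%classic) x : R)%:E.
    rewrite indicE; have [xa|xa] := leP a x.
      rewrite mem_set/= ?in_itv/= ?xa//; apply: cvg_near_cst; apply: nearW => n.
      by rewrite /f clip_ge1// lerDl mulr_ge0// subr_ge0.
    rewrite memNset/= ?in_itv/= ?andbT; last by apply/negP; rewrite -ltNge.
    apply: cvg_near_cst; near=> n; rewrite /f clip_le0//.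
    have : (a - x)^-1 <= n%:R by near: n; exact: nbhs_infty_ger.
    by rewrite -(ler_pM2r (_ : 0 < a - x)) ?subr_gt0// mulVf ?subr_eq0 ?gt_eqF//; lra.
  have C (m : {finite_measure set TR -> \bar R}) :
      (\int[m]_x (f n x)%:E)%E @[n --> \oo] --> m `[a, +oo[%classic.
    have [] := @dominated_convergence _ _ R m setT measurableT
      (fun n x => (f n x)%:E) (fun x => (\1_(`[a, +oo[%classic) x)%:E) (cst 1%:E).
    - by move=> n; exact/measurable_EFinP.
    - by apply/measurable_EFinP; exact: measurable_indic.
    - by apply: aeW => x _; exact: fcvg.
    - by apply: (@bounded_integrable _ _ _ m (cst 1) 1) => // x; rewrite normr1.
    - by apply: aeW => x n _; rewrite lee_fin clip_norm.
    by move=> _ _; rewrite integral_indic// setIT.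
  have E n : (\int[m1]_x (f n x)%:E = \int[m2]_x (f n x)%:E)%E.
    have fin (m : {finite_measure set TR -> \bar R}) : (\int[m]_x (f n x)%:E)%E \is a fin_num.
      apply: integrable_fin_num => //.
      by apply: (@bounded_integrable _ _ _ m (f n) 1) => // x; exact: clip_norm.
    by rewrite -[LHS]fineK// -[RHS]fineK//; congr EFin; exact: H.
  have C1 := C m1; have C2 := C m2.
  rewrite (_ : (fun n => _) = (fun n => \int[m2]_x (f n x)%:E)%E) in C1; last exact/funext.
  exact: (cvg_unique _ C1 C2).
pose g (n : nat) : set TR := `[- n%:R, +oo[%classic.
have GI : setI_closed (@RGenCInfty.G R : set (set TR)).
  move=> _ _ [a ->] [b ->]; exists (Num.max a b).
  by apply/seteqP; split => x /=; rewrite !in_itv/= !andbT ge_max; [case=> -> ->|move/andP].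
have Gg n : (@RGenCInfty.G R : set (set TR)) (g n) by exists (- n%:R).
have gT : \bigcup_k g k = setT.
  apply/seteqP; split => // x _; have [n xn] : exists n : nat, - x <= n%:R.
    by exists (Num.trunc `|x|).+1; rewrite (le_trans (ler_norm _))// normrN ltW// truncnS_gt.
  by exists n => //; rewrite /g/= in_itv/= andbT lerNl.
have GE A : (@RGenCInfty.G R : set (set TR)) A -> m1 A = m2 A by move=> [a ->]; exact: key.
have goo k : (m1 (g k) < +oo)%E by rewrite ltey_eq fin_num_measure//; exact: measurable_itv.
exact: (@measure_unique _ R TR _ g (RGenCInfty.measurableE R) GI Gg gT m1 m2 GE goo).
Unshelve. all: by end_near. Qed.

End finite_measures_on_the_line.

Section transfer_plan.
Context {R : realType}.
Local Notation TR := (measurableTypeR R).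
Local Notation RR := (TR * TR)%type.

Lemma Rintegral_pushforward_eq d d' (T : measurableType d) (T' : measurableType d')
    (m : {measure set T' -> \bar R}) (P : {measure set T -> \bar R}) (Phi : T -> T')
    (f : T' -> R) : measurable_fun setT Phi ->
  (forall A, measurable A -> P (Phi @^-1` A) = m A) -> measurable_fun setT f ->
  \int[m]_x f x = \int[P]_z f (Phi z).
Proof.
move=> mPhi E mf; transitivity (\int[m]_x (f x * 1)).
  by apply: eq_Rintegral => x _; rewrite mulr1.
transitivity (\int[P]_z (1 * f (Phi z))); last first.
  by apply: eq_Rintegral => x _; rewrite mul1r.
apply: (@Rintegral_transfer _ _ _ _ R m P Phi (fun=> 1) (fun=> 1)) => // g mg g0.
transitivity (\int[pushforward P Phi]_x (g x)%:E)%E.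
  under eq_integral do rewrite mulr1.
  by apply: eq_measure_integral => A mA _; rewrite -E.
rewrite (ge0_integral_pushforward mPhi)//.
- by apply: eq_integral => z _; rewrite mul1r.
- exact/measurable_EFinP.
- by move=> y _; rewrite lee_fin.
Qed.

Lemma measurable_simplex_param (i : 'I_2) : measurable_fun [set: TR] (simplex_param^~ i).
Proof. by rewrite /simplex_param; case: (i == ord0) => //; exact: measurable_funB. Qed.

Lemma measurable_strip : measurable (@strip R).
Proof.
rewrite (_ : strip = setT `*` `[0, 1]%classic); first exact: measurableX.
by apply/seteqP; split => -[x r] /=; rewrite /strip/= in_itv/=; [split|case].
Qed.

Lemma lifted_ae (lam : probability RR R) : lifted lam -> {ae lam, forall z, 0 <= z.2 <= 1}.
Proof.
move=> L; have mS := measurable_strip.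
exists (~` (@strip R)); split; first exact: measurableC.
  by rewrite probability_setC// [X in (1 - X)%E](_ : _ = 1%E) ?subee.
by move=> z /= nz Sz; apply: nz.
Qed.

Lemma measurable_lift_test (eta : R -> R) (i : 'I_2) : continuous eta ->
  measurable_fun [set: RR] (fun z => simplex_param (clip z.2) i * eta z.1).
Proof.
move=> ceta; apply: measurable_funM.
  apply: measurableT_comp (measurable_simplex_param i) _.
  exact: measurableT_comp measurable_clip (@measurable_snd _ _ _ _).
exact: measurableT_comp (continuous_measurableT ceta) (@measurable_fst _ _ _ _).
Qed.

Lemma lifted_clip (lam : probability RR R) (eta : R -> R) (i : 'I_2) :
  lifted lam -> continuous eta ->
  \int[lam]_z (simplex_param z.2 i * eta z.1) =
  \int[lam]_z (simplex_param (clip z.2) i * eta z.1).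
Proof.
move=> L ceta; congr fine; apply: ae_eq_integral => //.
- apply/measurable_EFinP; apply: measurable_funM.
    exact: measurableT_comp (measurable_simplex_param i) (@measurable_snd _ _ _ _).
  exact: measurableT_comp (continuous_measurableT ceta) (@measurable_fst _ _ _ _).
- apply/measurable_EFinP; exact: measurable_lift_test.
have FF := @ae_filter_ringOfSetsType _ _ _ lam.
by apply: filterS (lifted_ae L) => z z01 _; rewrite clip_id.
Qed.

(* A lift charges the strip only almost surely; clipping the second coordinate
   avoids carrying null sets through couplings. *)
Lemma lift_of_clip (mu : vprob R 2) (lam : probability RR R) (eta : R -> R) (i : 'I_2) :
  lift_of mu lam -> continuous eta -> bounded_fun eta ->
  \int[mu i]_x eta x = \int[lam]_z (simplex_param (clip z.2) i * eta z.1).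
Proof. by move=> [L E] ceta beta; rewrite E// lifted_clip. Qed.

Variables (mu nu : vprob R 2) (lam1 lam2 : probability RR R)
  (gam : probability (RR * RR)%type R).
Hypotheses (lift1 : lift_of mu lam1) (lift2 : lift_of nu lam2)
  (cpl : coupling lam1 lam2 gam).

(** Both nodes use the same position, so exchange is allowed at all times: each coupled pair moves
    at constant speed in x and in r. *)
Definition plan_position (i : 'I_2) (z : RR * RR) (t : R) : R := z.1.1 + t * (z.2.1 - z.1.1).
Definition plan_velocity (i : 'I_2) (z : RR * RR) (t : R) : R := z.2.1 - z.1.1.
Definition plan_weight (z : RR * RR) (t : R) : R := clip z.1.2 + t * (clip z.2.2 - clip z.1.2).
Definition plan_rate (z : RR * RR) (t : R) : R := clip z.2.2 - clip z.1.2.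

Let TZ := (TR * (RR * RR))%type.

Lemma plan_paths : particle_paths plan_position plan_velocity plan_weight plan_rate.
Proof.
have mx1 : measurable_fun [set: TZ] (fun y => y.2.1.1 : R).
  by apply: measurableT_comp => //; apply: measurableT_comp.
have mx2 : measurable_fun [set: TZ] (fun y => y.2.2.1 : R).
  by apply: measurableT_comp => //; apply: measurableT_comp.
have mr1 : measurable_fun [set: TZ] (fun y => clip y.2.1.2 : R).
  apply: measurableT_comp measurable_clip _.
  by apply: measurableT_comp => //; apply: measurableT_comp.
have mr2 : measurable_fun [set: TZ] (fun y => clip y.2.2.2 : R).
  apply: measurableT_comp measurable_clip _.
  by apply: measurableT_comp => //; apply: measurableT_comp.
have mt : measurable_fun [set: TZ] (fun y => y.1 : R) by exact: measurable_fst.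
split.
- move=> i; apply: measurable_funD => //; apply: measurable_funM => //.
  exact: measurable_funB.
- by move=> i; exact: measurable_funB.
- by apply: measurable_funD => //; apply: measurable_funM => //; exact: measurable_funB.
- exact: measurable_funB.
- by move=> i z t; exact: is_derive_segment.
- by move=> z t; exact: is_derive_segment.
- by move=> i z t; exact: cvg_cst.
- by move=> z t; exact: cvg_cst.
- move=> z t /andP[t0 t1]; rewrite /plan_weight.
  have /andP[a0 a1] := clip01 z.1.2; have /andP[b0 b1] := clip01 z.2.2.
  by apply/andP; split; nra.
- by move=> z t; rewrite /plan_position eqxx.
Qed.

Lemma plan_law (t : R) (m : vprob R 2) (lam : probability RR R) (pr : RR * RR -> RR) :
  lift_of m lam -> measurable_fun setT pr ->
  (forall A, measurable A -> gam (pr @^-1` A) = lam A) ->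
  (forall i z, plan_position i z t = (pr z).1) ->
  (forall z, plan_weight z (clip t) = clip (pr z).2) ->
  vprob_eq (path_law gam plan_paths t) m.
Proof.
move=> lm mpr prE posE wE i; apply: finite_measure_ext => eta ceta beta.
rewrite Rintegral_path_law; last exact: continuous_measurableT.
rewrite (lift_of_clip i lm ceta beta) (Rintegral_pushforward_eq mpr prE).
  by apply: eq_Rintegral => z _; rewrite /cweight /weight/= posE wE.
exact: measurable_lift_test.
Qed.

Lemma plan_law0 : vprob_eq (path_law gam plan_paths 0) mu.
Proof.
apply: (plan_law lift1 measurable_fst) => [A mA|i z|z]; first by have [] := cpl mA.
  by rewrite /plan_position mul0r addr0.
by rewrite clip_id ?lexx ?ler01// /plan_weight mul0r addr0.
Qed.

Lemma plan_law1 : vprob_eq (path_law gam plan_paths 1) nu.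
Proof.
apply: (plan_law lift2 measurable_snd) => [A mA|i z|z]; first by have [] := cpl mA.
  by rewrite /plan_position mul1r subrKC.
by rewrite clip_id ?lexx ?ler01// /plan_weight mul1r subrKC.
Qed.

Lemma W_dyn_le_plan : (W_dyn two_node_weight amean mu nu <=
  sqrte (\int[gam]_z (((z.1.1 - z.2.1) ^+ 2)%R%:E +
    d_interval two_node_weight amean z.1.2 z.2.2 ^+ 2)))%E.
Proof.
set c := (\int[gam]_z _)%E.
have [->|cy] := eqVneq c +oo%E; first by rewrite leey.
have c0 : (0 <= c)%E.
  apply: integral_ge0 => z _; apply: adde_ge0; first by rewrite lee_fin sqr_ge0.
  by apply: le_trans (d_interval_ge _ _); rewrite lee_fin mulr_ge0// sqr_ge0.
have cfin : c \is a fin_num by rewrite ge0_fin_numE// ltey.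
rewrite -(fineK cfin).
(* The clipped cost is constant along each path and measurable in z. It lies below the actual cost
   because clipping is 1-Lipschitz and [d_interval_ge] holds for all real arguments. *)
apply: (@W_dyn_le_path _ _ _ gam _ _ _ _ plan_paths
  (fun z => (z.1.1 - z.2.1) ^+ 2 + 2 * (clip z.1.2 - clip z.2.2) ^+ 2)).
- move=> z t t01; rewrite /plan_velocity /plan_rate -mulrDl /weight /simplex_param.
  by rewrite eqxx ord_max_neq0; lra.
- rewrite fineK//; apply: ge0_le_lower_integral => z _.
    by rewrite lee_fin addr_ge0 ?sqr_ge0// mulr_ge0 ?sqr_ge0.
  rewrite EFinD leeD2l//; apply: le_trans (d_interval_ge _ _).
  rewrite lee_fin ler_pM2l// -[leLHS]real_normK ?num_real// -[leRHS]real_normK ?num_real//.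
  by rewrite lerXn2r ?nnegrE// clip_lipschitz.
- exact: plan_law0.
- exact: plan_law1.
Qed.

End transfer_plan.

Section static_comparisons.
Context {R : realType}.
Local Notation TR := (measurableTypeR R).
Local Notation RR := (TR * TR)%type.

Lemma le_sqrte_ereal_inf (A : set (\bar R)) (y : \bar R) : (0 <= y)%E ->
  (forall c, A c -> 0 <= c /\ y <= sqrte c)%E -> (y <= sqrte (ereal_inf A))%E.
Proof.
move=> y0 H; rewrite -[y]gee0_abs// -sqrte_sqr lee_sqrt.
  apply: le_ereal_inf_tmp => c /H[c0 yc].
  by rewrite -[leRHS](sqr_sqrte c0) !expe2 lee_pmul.
by apply: le_ereal_inf_tmp => c /H[].
Qed.

Lemma transport_cost_ge0 (gam : {measure set (RR * RR) -> \bar R}) :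
  (0 <= \int[gam]_z (((z.1.1 - z.2.1) ^+ 2)%R%:E +
    d_interval two_node_weight amean z.1.2 z.2.2 ^+ 2))%E.
Proof.
apply: integral_ge0 => z _; apply: adde_ge0; first by rewrite lee_fin sqr_ge0.
by apply: le_trans (d_interval_ge _ _); rewrite lee_fin mulr_ge0// sqr_ge0.
Qed.

Theorem W_dyn_le_D_static (mu nu : vprob R 2) :
  (W_dyn two_node_weight amean mu nu <= D_static two_node_weight amean mu nu)%E.
Proof.
apply: le_ereal_inf_tmp => _ [lam1 [lam2 [l1 l2 ->]]].
apply: le_sqrte_ereal_inf; first exact: sqrte_ge0.
by move=> _ [gam cpl <-]; split; [exact: transport_cost_ge0|exact: W_dyn_le_plan l1 l2 cpl].
Qed.

End static_comparisons.

Section canonical_lifting_is_a_lift.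
Context {R : realType}.
Local Notation TR := (measurableTypeR R).
Local Notation RR := (TR * TR)%type.

(** A copy of [canonical_lifting] under its own head symbol, to which the structure of probability
    can be attached. *)
Definition canonical_prob (mu : vprob R 2) : set RR -> \bar R := canonical_lifting mu.

HB.instance Definition _ mu := Measure.on (canonical_prob mu).

Lemma product_dirac (m : {finite_measure set TR -> \bar R}) (r : R) (A : set RR) :
  measurable A -> ((m \x \d_(r : TR)) A = m (ysection A r))%E.
Proof.
move=> mA; rewrite /product_measure1.
rewrite (eq_integral (fun x => (\1_(ysection A r) x : R)%:E)).
  by rewrite integral_indic// ?setIT//; exact: measurable_ysection.
move=> x _; rewrite /= /dirac !indicE; congr ((nat_of_bool _)%:R)%:E.
Qed.

Lemma canonical_probE (mu : vprob R 2) (A : set RR) : measurable A ->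
  canonical_prob mu A = (mu ord0 (ysection A 1%R) + mu ord_max (ysection A 0%R))%E.
Proof.
move=> mA; rewrite /canonical_prob /canonical_lifting /measure_add/= /msum.
by rewrite big_ord_recl big_ord1/= !product_dirac.
Qed.

Let canonical_setT (mu : vprob R 2) : canonical_prob mu setT = 1%E.
Proof.
rewrite canonical_probE// -(vcomp_mass mu) sume_ord2.
by congr (mu _ _ + mu _ _)%E; apply/seteqP; split => x //= _; rewrite /ysection/= inE.
Qed.

HB.instance Definition _ mu := Measure_isProbability.Build _ _ _
  (canonical_prob mu) (canonical_setT mu).

Lemma Rintegral_canonical (mu : vprob R 2) (f : RR -> R) (b : R) :
  measurable_fun setT f -> (forall z, `|f z| <= b) ->
  \int[canonical_prob mu]_z f z =
  \int[mu ord0]_x f (x, 1) + \int[mu ord_max]_x f (x, 0).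
Proof.
move=> mf fb.
have E i (r : R) : \int[(mu i \x \d_(r : TR))%E]_z f z = \int[mu i]_x f (x, r).
  apply: (@Rintegral_pushforward_eq _ _ _ _ _ _ (mu i) (fun x : TR => (x, r : TR) : RR)) => //.
  move=> A mA; rewrite [RHS]product_dirac//; congr (mu i _).
  by apply/seteqP; split => x /=; rewrite /ysection/= inE.
have int i (r : R) : (mu i \x \d_(r : TR))%E.-integrable setT (EFin \o f).
  apply/integrableP; split; first exact/measurable_EFinP.
  apply: (@le_lt_trans _ _ (\int[(mu i \x \d_(r : TR))%E]_x (cst b%:E x))%E).
    by apply: ge0_le_lower_integral => x _ //=; rewrite lee_fin.
  rewrite integral_cst// [X in (_ * X)%E]product_dirac// ltey_eq fin_numM//.
  by apply: fin_num_measure; exact: measurable_ysection.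
rewrite -!E /Rintegral -fineD; [|exact: integrable_fin_num (int _ _)|exact: integrable_fin_num (int _ _)].
congr fine; apply: (@integral_measure_add _ _ R _ _ setT measurableT (EFin \o f)).
- exact: int.
- exact: int.
Qed.

Lemma canonical_lifted (mu : vprob R 2) : lifted (canonical_prob mu).
Proof.
  apply: (etrans (canonical_probE mu measurable_strip)).
  rewrite -(vcomp_mass mu) sume_ord2; congr (mu _ _ + mu _ _)%E;
    apply/seteqP; split => x //= _; rewrite /ysection/= inE /strip/=; lra.
Qed.

Lemma canonical_lift (mu : vprob R 2) : lift_of mu (canonical_prob mu).
Proof.
split; first exact: canonical_lifted.
move=> eta i ceta [M [_ bM]].
have [b etab] : exists b, forall x, `|eta x| <= b.
  by exists (M + 1) => x; apply: (bM (M + 1)); rewrite ?ltrDl.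
have L := canonical_lifted mu.
rewrite lifted_clip// (@Rintegral_canonical _ _ b); [|exact: measurable_lift_test|]; last first.
  move=> z; rewrite normrM -[leRHS]mul1r ler_pM//.
  have /andP[h0 h1] := clip01 z.2.
  by rewrite /simplex_param; case: ifP => _; rewrite ger0_norm; lra.
have c1 : clip 1 = 1 :> R by rewrite clip_ge1.
have c0 : clip 0 = 0 :> R by rewrite clip_le0.
rewrite /= c1 c0 /simplex_param; have [->|->] := ord2_cases i.
  rewrite eqxx [X in _ + X]Rintegral_eq0 ?addr0 => [|x _]; last by rewrite mul0r.
  by apply: eq_Rintegral => x _; rewrite mul1r.
rewrite ord_max_neq0 subrr subr0 [X in X + _]Rintegral_eq0 ?add0r => [|x _]; last by rewrite mul0r.
by apply: eq_Rintegral => x _; rewrite mul1r.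
Qed.

Theorem D_static_le_W_2W (mu nu : vprob R 2) :
  (D_static two_node_weight amean mu nu <= W_2W two_node_weight amean mu nu)%E.
Proof.
apply: ereal_inf_lbound; exists (canonical_prob mu), (canonical_prob nu).
by split; [exact: canonical_lift|exact: canonical_lift|].
Qed.

End canonical_lifting_is_a_lift.

(** * Atomic examples *)

Section atoms.
Context {R : realType}.

Section scaled_finite_measure.
Context d (T : measurableType d) (r : {nonneg R}) (m : {finite_measure set T -> \bar R}).

Let mscale_fin : fin_num_fun (mscale r m).
Proof. by move=> A mA; rewrite /mscale fin_numM// fin_num_measure. Qed.

HB.instance Definition _ := Measure_isFinite.Build _ _ _ (mscale r m) mscale_fin.

End scaled_finite_measure.

Lemma integral_atom d (T : measurableType d) (r : {nonneg R}) (a : T) (f : T -> \bar R) :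
  measurable_fun setT f -> (forall x, 0 <= f x)%E ->
  (\int[mscale r \d_a]_x f x = r%:num%:E * f a)%E.
Proof.
move=> mf f0; rewrite ge0_integral_mscale// integral_dirac//.
by rewrite diracT mul1e.
Qed.

Lemma Rintegral_atom d (T : measurableType d) (r : {nonneg R}) (a : T) (f : T -> R) :
  measurable_fun setT f -> \int[mscale r \d_a]_x f x = r%:num * f a.
Proof.
move=> mf; transitivity (\int[mscale r \d_a]_x (f x * 1)).
  by apply: eq_Rintegral => x _; rewrite mulr1.
rewrite (@Rintegral_transfer _ _ _ _ R (mscale r \d_a) \d_a id (fun=> 1) (fun=> r%:num))//.
  rewrite /Rintegral integral_dirac//; first by rewrite diracT mul1e.
  by apply/measurable_EFinP; exact: measurable_funM.
move=> g mg g0; rewrite integral_atom; last 2 first.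
- by apply/measurable_EFinP; exact: measurable_funM.
- by move=> x; rewrite lee_fin mulr1.
rewrite integral_dirac//; last by apply/measurable_EFinP; exact: measurable_funM.
by rewrite diracT mul1e mulr1 EFinM.
Qed.

Section two_atoms.
Context d (T : measurableType d) (r s : {nonneg R}) (rs : r%:num + s%:num = 1).

(* The proof argument serves to attach the probability structure to the term. *)
Definition two_atoms (_ : r%:num + s%:num = 1) (a b : T) : set T -> \bar R :=
  measure_add (mscale r \d_a) (mscale s \d_b).

HB.instance Definition _ a b := Measure.on (two_atoms rs a b).

Lemma two_atomsE (a b : T) (A : set T) :
  two_atoms rs a b A = (r%:num%:E * \d_a A + s%:num%:E * \d_b A)%E.
Proof. by rewrite /two_atoms /measure_add/= /msum big_ord_recl big_ord1. Qed.

Let two_atoms_setT a b : two_atoms rs a b setT = 1%E.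
Proof. by rewrite [LHS]two_atomsE !diracT !mule1 -EFinD rs. Qed.

HB.instance Definition _ a b := Measure_isProbability.Build _ _ _
  (two_atoms rs a b) (two_atoms_setT a b).

(** An inequality rather than an equality, because f is not assumed measurable; it is applied to a
    transport cost involving [d_interval]. *)
Lemma integral_two_atoms_le (a b : T) (f : T -> \bar R) : (forall x, 0 <= f x)%E ->
  (\int[two_atoms rs a b]_x f x <= r%:num%:E * f a + s%:num%:E * f b)%E.
Proof.
move=> f0; have [g [mg g0 gf <-]] := @lower_integral_minorant _ _ _ (two_atoms rs a b) setT f measurableT (fun x _ => f0 x).
rewrite ge0_integral_measure_add// !integral_atom//.
by apply: leeD; apply: lee_wpmul2l; rewrite ?lee_fin ?gf.
Qed.

End two_atoms.

Section two_diracs.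
Context (r s : {nonneg R}) (rs : r%:num + s%:num = 1) (x y : R).
Local Notation TR := (measurableTypeR R).

Definition scaled_dirac (t : {nonneg R}) (z : R) : {finite_measure set TR -> \bar R} :=
  mscale t \d_(z : TR).

Lemma scaled_diracE t z (A : set TR) : scaled_dirac t z A = (t%:num * \1_A z)%:E.
Proof. by []. Qed.

Definition node_atom (i : 'I_2) : {finite_measure set TR -> \bar R} :=
  if i == ord0 then scaled_dirac r x else scaled_dirac s y.

Lemma node_atom_mass : (\sum_(i < 2) node_atom i setT = 1)%E.
Proof.
by rewrite sume_ord2 /node_atom eqxx ord_max_neq0 !scaled_diracE !indicT !mulr1 -EFinD rs.
Qed.

Definition two_diracs : vprob R 2 := VProb node_atom_mass.

Lemma Rintegral_two_diracs i (f : R -> R) : measurable_fun [set: TR] f ->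
  \int[two_diracs i]_x f x = if i == ord0 then r%:num * f x else s%:num * f y.
Proof.
move=> mf; rewrite /two_diracs /= /node_atom.
by case: (i == ord0); exact: Rintegral_atom.
Qed.

Lemma P2_two_diracs : P2 two_diracs.
Proof.
have mX : measurable_fun [set: TR] (fun x : R => (x ^+ 2)%:E).
  by apply/measurable_EFinP; exact: measurable_funX.
move=> i; rewrite /two_diracs /= /node_atom; case: (i == ord0).
  rewrite [X in (X < _)%E](integral_atom r (x : TR) mX) ?ltry// => z.
  by rewrite lee_fin sqr_ge0.
rewrite [X in (X < _)%E](integral_atom s (y : TR) mX) ?ltry// => z.
by rewrite lee_fin sqr_ge0.
Qed.

Lemma canonical_two_diracs (A : set (TR * TR)) : measurable A ->
  canonical_lifting two_diracs A =
  (r%:num%:E * \d_((x, 1%R) : TR * TR) A + s%:num%:E * \d_((y, 0%R) : TR * TR) A)%E.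
Proof.
move=> mA; rewrite [LHS](canonical_probE two_diracs mA) /two_diracs /=.
rewrite /mscale; congr (_%:E * _ + _%:E * _)%E.
  by rewrite /dirac !indicE; congr ((nat_of_bool _)%:R)%:E; rewrite mem_ysection.
by rewrite /dirac !indicE; congr ((nat_of_bool _)%:R)%:E; rewrite mem_ysection.
Qed.

End two_diracs.
End atoms.

Section transport_between_atoms.
Context {R : realType}.
Local Notation TR := (measurableTypeR R).
Local Notation RR := (TR * TR)%type.

Definition atom_cost (z : RR * RR) : R :=
  (z.1.1 - z.2.1) ^+ 2 + 2 * (z.1.2 - z.2.2) ^+ 2.

(** The coupling matches z.1 with z.2 and w.1 with w.2. The distance on the interval is evaluated
    only at these pairs, which is where the upper bound for r in [0,1] suffices. *)
Lemma W_lifted_le (lam1 lam2 : {measure set RR -> \bar R}) (r s : {nonneg R})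
    (z w : RR * RR) : r%:num + s%:num = 1 ->
  (forall A, measurable A -> lam1 A = (r%:num%:E * \d_(z.1) A + s%:num%:E * \d_(w.1) A)%E) ->
  (forall A, measurable A -> lam2 A = (r%:num%:E * \d_(z.2) A + s%:num%:E * \d_(w.2) A)%E) ->
  0 <= z.1.2 <= 1 -> 0 <= z.2.2 <= 1 -> 0 <= w.1.2 <= 1 -> 0 <= w.2.2 <= 1 ->
  (W_lifted two_node_weight amean lam1 lam2 <=
   sqrte (r%:num * atom_cost z + s%:num * atom_cost w)%:E)%E.
Proof.
move=> rs E1 E2 z1 z2 w1 w2; rewrite /W_lifted.
have c0 z' : 0 <= atom_cost z' by rewrite addr_ge0 ?sqr_ge0// mulr_ge0 ?sqr_ge0.
rewrite lee_sqrt; last by rewrite lee_fin addr_ge0// mulr_ge0.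
apply: ge_ereal_inf; eexists.
  exists (two_atoms rs z w); last by [].
  move=> A mA; split.
    exact: (etrans (two_atomsE rs z w _) (esym (E1 A mA))).
  exact: (etrans (two_atomsE rs z w _) (esym (E2 A mA))).
set f := (fun z : RR * RR => _ : \bar R).
have f0 x : (0 <= f x)%E.
  apply: adde_ge0; first by rewrite lee_fin sqr_ge0.
  by apply: le_trans (d_interval_ge _ _); rewrite lee_fin mulr_ge0// sqr_ge0.
apply: le_trans (integral_two_atoms_le rs z w f0) _.
have fle x : 0 <= x.1.2 <= 1 -> 0 <= x.2.2 <= 1 -> (f x <= (atom_cost x)%:E)%E.
  by move=> x1 x2; rewrite /f EFinD leeD2l// d_interval_le.
by rewrite EFinD !EFinM; apply: leeD; apply: lee_wpmul2l; rewrite ?lee_fin// fle.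
Qed.

(** Kantorovich duality with explicit potentials: for r, r' in [0,1] one has 2 (r - r')^2 >= 2 (1 -
    r)^2 - 4 (1 - r'). The right side splits over the marginals and integrates to at least 2 (1/2) -
    0 = 1. *)
Lemma W_lifted_ge1 (lam1 lam2 : probability RR R) :
  2^-1 <= \int[lam1]_z ((1 - clip z.2) ^+ 2) ->
  \int[lam2]_z (1 - clip z.2) = 0 ->
  (1 <= W_lifted two_node_weight amean lam1 lam2)%E.
Proof.
move=> h1 h2; apply: le_sqrte_ereal_inf => // _ [gam cpl <-].
split; first exact: transport_cost_ge0.
rewrite -[leLHS](_ : sqrte 1 = 1%E); last by rewrite /= sqrtr1.
rewrite lee_sqrt; last exact: transport_cost_ge0.
have mc1 : measurable_fun [set: RR] (fun z => 1 - clip z.2).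
  by apply: measurable_funB => //; exact: measurableT_comp measurable_clip (@measurable_snd _ _ _ _).
have mc2 : measurable_fun [set: RR] (fun z => (1 - clip z.2) ^+ 2) by exact: measurable_funX.
have b1 (z : RR) : `|1 - clip z.2| <= 1.
  by have /andP[a0 a1] := clip01 z.2; rewrite ger0_norm; lra.
have b2 (z : RR) : `|(1 - clip z.2) ^+ 2| <= 1 by rewrite normrX expr_le1.
pose k (z : RR * RR) := 2 * (clip z.1.2 - clip z.2.2) ^+ 2.
pose h (z : RR * RR) := 2 * (1 - clip z.1.2) ^+ 2 - 4 * (1 - clip z.2.2).
have mg1 : measurable_fun [set: RR * RR] (fun z : RR * RR => (1 - clip z.1.2) ^+ 2).
  exact: measurableT_comp mc2 (@measurable_fst _ _ _ _).
have mg2 : measurable_fun [set: RR * RR] (fun z : RR * RR => 1 - clip z.2.2).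
  exact: measurableT_comp mc1 (@measurable_snd _ _ _ _).
have i1 : gam.-integrable setT (EFin \o (fun z : RR * RR => 2 * (1 - clip z.1.2) ^+ 2)).
  apply: (@bounded_integrable _ _ _ gam _ 2); first exact: measurable_funM.
  by move=> z; rewrite normrM ger0_norm// -[leRHS]mulr1 ler_pM2l.
have i2 : gam.-integrable setT (EFin \o (fun z : RR * RR => 4 * (1 - clip z.2.2))).
  apply: (@bounded_integrable _ _ _ gam _ 4); first exact: measurable_funM.
  by move=> z; rewrite normrM ger0_norm// -[leRHS]mulr1 ler_pM2l.
have i3 : gam.-integrable setT (EFin \o h).
  by have := integrableB measurableT i1 i2; apply: eq_integrable.
have ik : gam.-integrable setT (EFin \o k).
  apply: (@bounded_integrable _ _ _ gam _ 2).
    apply: measurable_funM => //; apply: measurable_funX; apply: measurable_funB.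
      apply: measurableT_comp measurable_clip _.
      exact: measurableT_comp (@measurable_snd _ _ _ _) (@measurable_fst _ _ _ _).
    apply: measurableT_comp measurable_clip _.
    exact: measurableT_comp (@measurable_snd _ _ _ _) (@measurable_snd _ _ _ _).
  move=> z; rewrite normrM ger0_norm// -[leRHS]mulr1 ler_pM2l// normrX expr_le1//.
  have /andP[a0 a1] := clip01 z.1.2; have /andP[a2 a3] := clip01 z.2.2.
  by rewrite ler_norml; lra.
have hE : \int[gam]_z h z = 2 * \int[lam1]_z ((1 - clip z.2) ^+ 2) - 4 * \int[lam2]_z (1 - clip z.2).
  rewrite RintegralB//; congr (_ - _).
    rewrite (@Rintegral_pushforward_eq R _ _ _ _ lam1 gam fst); [|exact: measurable_fst| |exact: mc2].
      rewrite RintegralZl//; apply: (@bounded_integrable _ _ _ gam _ 1) => // z; exact: b2.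
    by move=> A mA; have [] := cpl A mA.
  rewrite (@Rintegral_pushforward_eq R _ _ _ _ lam2 gam snd); [|exact: measurable_snd| |exact: mc1].
    rewrite RintegralZl//; apply: (@bounded_integrable _ _ _ gam _ 1) => // z; exact: b1.
  by move=> A mA; have [] := cpl A mA.
have hk : \int[gam]_z h z <= \int[gam]_z k z.
  apply: le_Rintegral => // z _; rewrite /h /k.
  have /andP[a0 a1] := clip01 z.1.2; have /andP[a2 a3] := clip01 z.2.2.
  by rewrite !expr2; nra.
apply: (@le_trans _ _ (\int[gam]_z (k z)%:E)%E).
  rewrite -[leRHS]fineK; last exact: integrable_fin_num.
  by rewrite lee_fin (le_trans _ hk)// hE h2; lra.
apply: ge0_le_lower_integral => z _; first by rewrite lee_fin mulr_ge0// sqr_ge0.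
apply: (@le_trans _ _ (d_interval two_node_weight amean z.1.2 z.2.2 ^+ 2)%E); last first.
  by rewrite leeDr// lee_fin sqr_ge0.
apply: le_trans (d_interval_ge _ _).
rewrite lee_fin ler_pM2l// -[leLHS]real_normK ?num_real// -[leRHS]real_normK ?num_real//.
by rewrite lerXn2r ?nnegrE// clip_lipschitz.
Qed.

End transport_between_atoms.

(** * Test functions of small slope *)

Section bumps.
Context {R : realType}.
Local Notation TR := (measurableTypeR R).

(** One plateau is rescaled by k, so B does not depend on k: the slope tends to 0 with k while psi
    still drops from 1 at 0 to 0 at 1 / k. *)
Lemma wide_bump : exists B : R, 0 <= B /\ forall k : R, 0 < k ->
  exists psi : R -> R, [/\ test_function setT psi,
    (forall x, 0 <= psi x <= 1), (forall x, `|psi^`()%classic x| <= k * B),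
    psi 0 = 1 & psi k^-1 = 0].
Proof.
pose d : R := 4^-1; have d0 : 0 < d by rewrite invr_gt0.
pose phi := plateau d.
have [B phiB] := test_function_derive_bounded (1 : R) (test_function_plateau d0 (lexx _)).
exists B; split => [|k k0]; first exact: le_trans (phiB 0).
have dphi (x : R) : is_derive x 1 phi ('D_1 phi x).
  by apply: DeriveDef => //; exact: (Ck_onT_derivable (Ck_plateau 1 d)).
pose psi (x : R) := phi (k * x + 2^-1).
have dpsi (x : R) : is_derive x 1 psi (k * 'D_1 phi (k * x + 2^-1)).
  have D1 := is_derive_affine k 2^-1 x.
  have D : is_derive x 1 (phi \o (fun x : R => k * x + 2^-1)) ('D_1 phi (k * x + 2^-1) * k).
    by apply: is_derive1_comp; exact: dphi.
  by refine (is_derive_eq D _); rewrite mulrC.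
exists psi; split.
- apply: (@test_function_itv _ psi (- k^-1) k^-1) => //.
    by move=> m; apply: Ck_comp_affine; exact: Ck_plateau.
  move=> x nx; apply: plateau_eq0 => // -/andP[h1 h2]; apply: nx.
  rewrite -ler_norml -(ler_pM2l k0) mulfV ?gt_eqF// -(ger0_norm (ltW k0)) -normrM ler_norml.
  by rewrite /d in h1 h2; lra.
- by move=> x; rewrite plateau_ge0 ?plateau_le1.
- move=> x; rewrite derive1E (@derive_val _ _ _ _ _ _ _ (dpsi x)) normrM (ger0_norm (ltW k0)).
  by rewrite ler_pM2l.
- by rewrite /psi mulr0 add0r /phi plateau_ramp// lexx ramp_eq1// /d; lra.
- rewrite /psi mulfV ?gt_eqF//; apply: plateau_eq0 => //.
  by rewrite /d => /andP[_]; lra.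
Qed.

(** A compactly supported function of height 1 would exceed the norm bound. Height b < 1 leaves the
    budget c = 1 - b^2 for the square of the slope, and a wide bump with slope at most c fits since
    c^2 <= c. The bit [sg] tells which of the two measures carries the atom. *)
Lemma BL_norm_dirac_ge1 (sg : bool) (m1 m2 : {finite_measure set TR -> \bar R}) :
  (forall eta : R -> R, measurable_fun [set: TR] eta ->
     \int[m1]_x eta x - \int[m2]_x eta x = (-1) ^+ sg * eta 0) ->
  (1 <= BL_norm m1 m2)%E.
Proof.
move=> H; have [B [B0 bump]] := wide_bump.
have key (b : R) : 0 < b -> b < 1 -> (b%:E <= BL_norm m1 m2)%E.
  move=> b0 b1; pose c := 1 - b ^+ 2.
  have bb : b ^+ 2 < 1 by rewrite expr_lt1// ltW.
  have c0 : 0 < c by rewrite subr_gt0.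
  have [psi [tpsi psi01 psi' psi0 _]] := bump (c / (1 + B)) (divr_gt0 c0 (ltr_wpDr B0 ltr01)).
  pose eta x := (-1) ^+ sg * b * psi x.
  have s0 : (-1) ^+ sg * b != 0 by rewrite mulf_neq0 ?signr_eq0// gt_eqF.
  have teta : test_function setT eta by exact: test_functionZ.
  apply: ereal_sup_ubound; exists eta => /=.
    split => //; apply: (@W12oo_norm_le1 _ _ b (c / (1 + B) * B)).
    - move=> x; rewrite !normrM normr_sign mul1r (ger0_norm (ltW b0)).
      by have /andP[h0 h1] := psi01 x; rewrite ger0_norm// ler_piMr// ltW.
    - move=> x; have D : is_derive x 1 eta ((-1) ^+ sg * b * psi^`()%classic x).
        have D := is_deriveM (is_derive_cst ((-1) ^+ sg * b) x 1) (is_derive_test_function x tpsi).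
        by refine (is_derive_eq D _); rewrite /GRing.scale/= mulr0 addr0.
      rewrite derive1E (@derive_val _ _ _ _ _ _ _ D) !normrM normr_sign mul1r (ger0_norm (ltW b0)).
      by rewrite (le_trans _ (psi' x))// ler_piMl// ltW.
    - have cB : c / (1 + B) * B <= c.
        rewrite -mulrA -[leRHS]mulr1 ler_pM2l// mulrC ler_pdivrMr ?mul1r; lra.
      have c1 : c <= 1 by rewrite /c lerBlDr lerDl sqr_ge0.
      have cB0 : 0 <= c / (1 + B) * B by exact: mulr_ge0 (divr_ge0 (ltW c0) (addr_ge0 ler01 B0)) B0.
      have : (c / (1 + B) * B) ^+ 2 <= c.
        by rewrite expr2 (le_trans (ler_pM cB0 cB0 cB cB))// ler_piMr// ltW.
      by rewrite /c; lra.
  rewrite H; last exact: test_function_measurable teta.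
  by rewrite /eta psi0 mulr1 mulrA -expr2 sqrr_sign mul1r.
apply/lee_addgt0Pr => e e0.
have [e1|e1] := ltP e 1; last first.
  by apply: le_trans (leeDr _ (BL_norm_ge0 _ _)); rewrite lee_fin.
have h1 : 0 < 1 - e by rewrite subr_gt0.
have h2 : 1 - e < 1 by rewrite ltrBlDr ltrDl.
have := key _ h1 h2; rewrite EFinB leeBlDr//.
Qed.

End bumps.

Section positive_part.
Context {R : realType}.

Lemma continuous_posp : continuous (fun t : R => Num.max 0 t).
Proof.
rewrite (_ : (fun t : R => _) = fun t => (t + `|t|) / 2).
  move=> t; apply: cvgMl; apply: cvgD; [exact: cvg_id|apply: cvg_norm; exact: cvg_id].
apply/funext => t; have [t0|t0] := leP 0 t; first by rewrite ger0_norm//; lra.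
by rewrite ltr0_norm//; lra.
Qed.

(** The positive part has a corner at 0, its square has a continuous derivative. This lets piecewise
    motions be switched on and off while the paths stay differentiable at all times. *)
Lemma is_derive_posp2 (x : R) :
  is_derive x 1 (fun t : R => Num.max 0 t ^+ 2) (2 * Num.max 0 x).
Proof.
have [x0|x0|->] := ltrgtP x 0.
- rewrite mulr0.
  apply: (@near_eq_is_derive _ R R (cst 0) _ x 1 0).
    near=> t; rewrite max_l ?expr0n//.
    by apply: ltW; near: t; exact: lt_nbhsl.
- apply: (@near_eq_is_derive _ _ _ (fun t : R => t ^+ 2)).
    near=> t; rewrite max_r//.
    by apply: ltW; near: t; exact: lt_nbhsr.
  have D := is_deriveX 2 (is_derive_id x 1).
  by refine (is_derive_eq D _); rewrite /GRing.scale/= expr1 mulr1.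
rewrite mulr0; suff H : h^-1 *: (((fun t : R => Num.max 0 t ^+ 2) \o shift 0) (h *: (1:R)) -
    Num.max 0 (0:R) ^+ 2) @[h --> 0^'] --> (0 : R).
  by apply: DeriveDef; [apply/cvg_ex; eexists; exact: H|exact: cvg_lim].
have P : Num.max 0 (h:R) @[h --> (0:R)^'] --> (0:R).
  have := @continuous_posp 0; rewrite /continuous_at maxxx => C.
  exact: cvg_within_filter C.
apply: cvg_trans P; apply: near_eq_cvg; near=> h.
rewrite /= maxxx expr0n subr0 addr0 /GRing.scale/= mulr1.
have [h0|h0] := ltP 0 h; last by rewrite expr0n mulr0.
by rewrite expr2 mulrA mulVf ?mul1r// gt_eqF.
Unshelve. all: by end_near. Qed.

Lemma is_derive_posp2_affine (a b x : R) :
  is_derive x 1 (fun t : R => Num.max 0 (a * t + b) ^+ 2) (2 * Num.max 0 (a * x + b) * a).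
Proof.
have D1 := is_derive_affine a b x.
have D : is_derive x 1 ((fun t : R => Num.max 0 t ^+ 2) \o (fun x : R => a * x + b))
    (2 * Num.max 0 (a * x + b) * a).
  by apply: is_derive1_comp; exact: is_derive_posp2.
exact: D.
Qed.

Lemma continuous_posp_affine (a b : R) : continuous (fun t : R => Num.max 0 (a * t + b)).
Proof.
move=> x; apply: (@continuous_comp _ _ _ (fun t : R => a * t + b) (fun t => Num.max 0 t)).
  by apply: cvgD; [apply: cvgM; [exact: cvg_cst|exact: cvg_id]|exact: cvg_cst].
exact: continuous_posp.
Qed.

End positive_part.

(** * A curve along which the particles meet before exchanging mass *)

Section merging_path.
Context {R : realType}.
Local Notation TR := (measurableTypeR R).

(** Small enough for two purposes: meeting by time 1/10 costs at most 1/25 per unit of time, and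
    1/100 + 1 / sqrt 2 < 1 in the failure of the triangle inequality. *)
Definition offset : R := 100^-1.

Definition start (i : 'I_2) : R := if i == ord0 then - offset else offset.

(* The two particles meet at time 1/10; from then on mass is moved to node 1,
   the rate growing linearly on [1/10, 2/10] and being constant afterwards. *)
Definition merge_position (i : 'I_2) (z : TR) (t : R) : R :=
  start i * Num.max 0 (- 10 * t + 1) ^+ 2.
Definition merge_velocity (i : 'I_2) (z : TR) (t : R) : R :=
  start i * (2 * Num.max 0 (- 10 * t + 1) * - 10).
(** The constant 50/17 normalizes the transferred mass: (9/10)^2 - (8/10)^2 = 17/100, so node 1
    gains exactly 1/2 by time 1. *)
Definition merge_weight (z : TR) (t : R) : R :=
  2^-1 + 50 / 17 * (Num.max 0 (1 * t - 10^-1) ^+ 2 - Num.max 0 (1 * t - 5^-1) ^+ 2).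
Definition merge_rate (z : TR) (t : R) : R :=
  50 / 17 * (2 * Num.max 0 (1 * t - 10^-1) * 1 - 2 * Num.max 0 (1 * t - 5^-1) * 1).

Lemma maxP (x : R) : (x <= 0 /\ Num.max 0 x = 0) \/ (0 <= x /\ Num.max 0 x = x).
Proof. by have [h|/ltW h] := leP 0 x; [right|left]. Qed.

Lemma merge_paths : particle_paths merge_position merge_velocity merge_weight merge_rate.
Proof.
have mcont (f : R -> R) : continuous f -> measurable_fun [set: TR * TR] (fun y => f y.1).
  by move=> cf; exact: measurableT_comp (continuous_measurableT cf) (@measurable_fst _ _ _ _).
have dX i z (t : R) : is_derive t 1 (merge_position i z) (merge_velocity i z t).
  have D := is_deriveM (is_derive_cst (start i) t 1) (is_derive_posp2_affine (- 10) 1 t).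
  by refine (is_derive_eq D _); rewrite /GRing.scale/= mulr0 addr0.
have dp z (t : R) : is_derive t 1 (merge_weight z) (merge_rate z t).
  have D0 := is_deriveB (is_derive_posp2_affine 1 (- 10^-1) t) (is_derive_posp2_affine 1 (- 5^-1) t).
  have D1 := is_deriveM (is_derive_cst (50 / 17 : R) t 1) D0.
  have D := is_deriveD (is_derive_cst (2^-1 : R) t 1) D1.
  by refine (is_derive_eq D _); rewrite /GRing.scale/= mulr0 addr0 add0r.
have cXd i z : continuous (merge_velocity i z).
  move=> t; apply: cvgM; first exact: cvg_cst.
  apply: cvgM; last exact: cvg_cst.
  by apply: cvgM; [exact: cvg_cst|exact: continuous_posp_affine].
have cpd z : continuous (merge_rate z).
  move=> t; apply: cvgM; first exact: cvg_cst.
  apply: cvgB; (apply: cvgM; last exact: cvg_cst);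
    by apply: cvgM; [exact: cvg_cst|exact: continuous_posp_affine].
have cX i : continuous (merge_position i 0).
  by move=> t; apply: derivable_continuous1; have [] := dX i 0 t.
have cp : continuous (merge_weight 0).
  by move=> t; apply: derivable_continuous1; have [] := dp 0 t.
split => //.
- by move=> i; exact: (mcont (merge_position i 0)).
- by move=> i; exact: (mcont (merge_velocity i 0)).
- exact: (mcont (merge_weight 0)).
- exact: (mcont (merge_rate 0)).
- move=> z t /andP[t0 t1]; rewrite /merge_weight mul1r.
  have [[h1 ->]|[h1 ->]] := maxP (t - 10^-1); have [[h2 ->]|[h2 ->]] := maxP (t - 5^-1);
    by rewrite !expr2; apply/andP; split; nra.
- move=> z t; rewrite /merge_position; have [[h ->]|[h _]] := maxP (- 10 * t + 1).
    by rewrite expr0n !mulr0 eqxx.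
  move=> _; rewrite /merge_rate mul1r.
  have [[h1 ->]|[h1 ->]] := maxP (t - 10^-1); have [[h2 ->]|[h2 ->]] := maxP (t - 5^-1); lra.
Qed.

Let half : 2^-1 + 2^-1 = 1 :> R. Proof. lra. Qed.
Let one : 1 + 0 = 1 :> R. Proof. lra. Qed.

Definition split_pair : vprob R 2 :=
  @two_diracs R (2^-1)%:nng (2^-1)%:nng half (- offset) offset.
Definition split_origin : vprob R 2 := @two_diracs R (2^-1)%:nng (2^-1)%:nng half 0 0.
Definition single_node (x : R) : vprob R 2 := @two_diracs R 1%:nng 0%:nng one x 0.

Lemma merge_law (t : R) i (A : set TR) : measurable A ->
  path_law \d_(0 : TR) merge_paths t i A =
  (simplex_param (merge_weight 0 (clip t)) i * \1_A (merge_position i 0 t))%:E.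
Proof.
move=> mA; rewrite [LHS]path_compE// integral_dirac//.
  by rewrite diracT mul1e.
have -> : (fun z : TR => (cweight merge_weight i (t, z) * \1_A (merge_position i z t))%:E) =
  cst (cweight merge_weight i (t, 0) * \1_A (merge_position i 0 t))%:E by [].
exact: measurable_cst.
Qed.

Lemma merge_law0 : vprob_eq (path_law \d_(0 : TR) merge_paths 0) split_pair.
Proof.
move=> i A mA; rewrite merge_law// /merge_weight /merge_position clip_le0//.
rewrite (max_l (_ : 1 * 0 - 10^-1 <= 0 :> R)); last lra.
rewrite (max_l (_ : 1 * 0 - 5^-1 <= 0 :> R)); last lra.
rewrite (max_r (_ : 0 <= - 10 * 0 + 1 :> R)); last lra.
rewrite subrr !mulr0 addr0 add0r expr1n mulr1 /split_pair /= /node_atom /simplex_param /start.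
case: (i == ord0); rewrite scaled_diracE//.
by rewrite (_ : 1 - 2^-1 = 2^-1 :> R)//; lra.
Qed.

Lemma merge_law1 : vprob_eq (path_law \d_(0 : TR) merge_paths 1) (single_node 0).
Proof.
move=> i A mA; rewrite merge_law// /merge_weight /merge_position clip_ge1//.
rewrite (max_r (_ : 0 <= 1 * 1 - 10^-1 :> R)); last lra.
rewrite (max_r (_ : 0 <= 1 * 1 - 5^-1 :> R)); last lra.
rewrite (max_l (_ : - 10 * 1 + 1 <= 0 :> R)); last lra.
rewrite expr0n mulr0 (_ : 2^-1 + _ = 1); last by rewrite !expr2; lra.
rewrite /single_node /= /node_atom /simplex_param.
case: (i == ord0); rewrite scaled_diracE//.
by rewrite subrr.
Qed.

(** The squared speed is at most 1/25 and the exchange rate at most 10/17. Even the sum of the two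
    maxima, 1/25 + 200/289, is below 3/4, although motion and exchange never take place at the same
    time. *)
Lemma W_dyn_merge : (W_dyn two_node_weight amean split_pair (single_node 0) <= sqrte (3 / 4)%:E)%E.
Proof.
apply: (@W_dyn_le_path _ _ _ \d_(0 : TR) _ _ _ _ merge_paths (fun=> 3 / 4)).
- move=> z t /andP[t0 t1].
  have : 0 <= weight merge_weight ord0 z t <= 1.
    by rewrite /weight /simplex_param eqxx; apply: (pp_p01 merge_paths); rewrite t0.
  have -> : weight merge_weight ord_max z t = 1 - weight merge_weight ord0 z t.
    by rewrite /weight /simplex_param eqxx ord_max_neq0.
  move: (weight _ _ _ _) => w /andP[w0 w1].
  rewrite /merge_velocity /merge_rate /start eqxx ord_max_neq0 /offset.
  have -> : w * (- 100^-1 * (2 * Num.max 0 (-10 * t + 1) * -10)) ^+ 2 +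
      (1 - w) * (100^-1 * (2 * Num.max 0 (-10 * t + 1) * -10)) ^+ 2 =
      (5^-1 * Num.max 0 (-10 * t + 1)) ^+ 2 by field.
  have v2 : (5^-1 * Num.max 0 (-10 * t + 1)) ^+ 2 <= 25^-1.
    by have [[h1 ->]|[h1 ->]] := maxP (- 10 * t + 1); rewrite expr2; nra.
  have r2 : 0 <= 50 / 17 * (2 * Num.max 0 (1 * t - 10^-1) * 1 - 2 * Num.max 0 (1 * t - 5^-1) * 1) <= 10 / 17.
    by rewrite mul1r; have [[h1 ->]|[h1 ->]] := maxP (t - 10^-1);
      have [[h2 ->]|[h2 ->]] := maxP (t - 5^-1); lra.
  move: r2 v2; move: (50 / 17 * _) (_ ^+ 2) => c e /andP[c0 c1] v2.
  by rewrite expr2; nra.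
- by rewrite integral_dirac// diracT mul1e.
- exact: merge_law0.
- exact: merge_law1.
Qed.

End merging_path.

(** * The pairs realizing equality and strictness *)

Section extremal_pairs.
Context {R : realType}.
Local Notation TR := (measurableTypeR R).
Local Notation RR := (TR * TR)%type.
Local Notation q := (@two_node_weight R).

Let zero_one : 0 + 1 = 1 :> R. Proof. by rewrite add0r. Qed.

Definition other_node : vprob R 2 := @two_diracs R 0%:nng 1%:nng zero_one 0 0.

Lemma Rintegral_canonical_two_diracs (r s : {nonneg R}) (rs : r%:num + s%:num = 1)
    (b x y : R) (f : RR -> R) : measurable_fun setT f -> (forall z, `|f z| <= b) ->
  \int[canonical_prob (two_diracs rs x y)]_z f z = r%:num * f (x, 1) + s%:num * f (y, 0).
Proof.
move=> mf fb; rewrite (Rintegral_canonical _ mf fb).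
rewrite !Rintegral_two_diracs ?eqxx ?ord_max_neq0//.
  exact: measurableT_comp mf (pair2_measurable (0 : TR)).
exact: measurableT_comp mf (pair2_measurable (1 : TR)).
Qed.

(** The distance treats the nodes separately: a unit mass disappears at one node and appears at the
    other, contributing 1 each, with opposite signs of the test function. *)
Lemma d_BL_nodes : (sqrte 2%:E <= d_BL (single_node (0 : R)) other_node)%E.
Proof.
rewrite /d_BL lee_sqrt; last by apply: sume_ge0 => i _; rewrite expe_ge0// BL_norm_ge0.
rewrite sume_ord2 (_ : 2 = 1 + 1 :> R)// EFinD.
have B0 : (1 <= BL_norm (single_node (0 : R) ord0) (other_node ord0))%E.
  apply: (@BL_norm_dirac_ge1 _ false) => eta meta.
  by rewrite !Rintegral_two_diracs// eqxx /= mul0r subr0 expr0 !mul1r.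
have B1 : (1 <= BL_norm (single_node (0 : R) ord_max) (other_node ord_max))%E.
  apply: (@BL_norm_dirac_ge1 _ true) => eta meta.
  by rewrite !Rintegral_two_diracs// ord_max_neq0 /= mul0r sub0r expr1 mulN1r mul1r.
by apply: leeD; rewrite expe2 -[leLHS]mule1; apply: lee_pmul.
Qed.

Lemma W_2W_nodes : (W_2W q amean (single_node 0) other_node <= sqrte 2%:E)%E.
Proof.
pose z : RR * RR := ((0, 1), (0, 0)); pose w : RR * RR := ((0, 0), (0, 1)).
have one0 : (1%:nng : {nonneg R})%:num + (0%:nng : {nonneg R})%:num = 1 :> R by rewrite addr0.
apply: le_trans (@W_lifted_le R _ _ 1%:nng 0%:nng z w one0 _ _ _ _ _ _) _;
  rewrite /z /w /= ?lexx ?ler01//.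
- by move=> A mA; rewrite canonical_two_diracs.
- by move=> A mA; rewrite canonical_two_diracs// addeC.
rewrite lee_fin ler_sqrt// /atom_cost /=.
by rewrite !expr2; lra.
Qed.

Lemma d_BL_single_le (K : R) : (d_BL (single_node 0) (single_node K) <= 2%:E)%E.
Proof.
have B0 : (BL_norm (single_node 0 ord0) (single_node K ord0) <= 2%:E)%E.
  apply: ge_ereal_sup => _ [eta [teta n1] <-].
  have meta := test_function_measurable teta.
  have [a [b [ea _ ab]]] := W12oo_norm_le1P teta n1.
  rewrite !Rintegral_two_diracs// eqxx /= !mul1r lee_fin.
  have := ea 0; have := ea K; rewrite !ler_norml => /andP[h1 h2] /andP[h3 h4].
  by rewrite !expr2 in ab; nra.
have B1 : (BL_norm (single_node 0 ord_max) (single_node K ord_max) <= 0)%E.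
  apply: ge_ereal_sup => _ [eta [teta n1] <-].
  have meta := test_function_measurable teta.
  by rewrite !Rintegral_two_diracs// ord_max_neq0 /= subrr.
rewrite -[leRHS]gee0_abs ?lee_fin// -sqrte_sqr /d_BL lee_sqrt ?expe_ge0 ?lee_fin//.
rewrite sume_ord2 -[leRHS]adde0; apply: leeD.
  by rewrite !expe2; apply: lee_pmul => //; exact: BL_norm_ge0.
rewrite expe2 -[leRHS](mule0 0); apply: lee_pmul => //; exact: BL_norm_ge0.
Qed.

Lemma W_dyn_far : exists K : R,
  (2%:E < W_dyn q amean (single_node 0) (single_node K))%E.
Proof.
have [B [B0 bump]] := @wide_bump R.
(* The slope bound k (B + 1) becomes 1/6, so that the drop of psi by 1 gives the lower bound 1 /
   (2/6) = 3 > 2. B + 1 replaces B because the slope bound must be positive. *)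
pose k := (6 * (B + 1))^-1; have k0 : 0 < k by rewrite invr_gt0 mulr_gt0// ltr_wpDl.
have [psi [tpsi psi01 psi' psi0 psiK]] := bump k k0; exists k^-1.
have mpsi := test_function_measurable tpsi.
have b0 : 0 < k * (B + 1) by rewrite mulr_gt0// ltr_wpDl.
have psib x : `|psi x| <= 1 by have /andP[h0 h1] := psi01 x; rewrite ger0_norm.
have psi'b x : `|psi^`()%classic x| <= k * (B + 1).
  by rewrite (le_trans (psi' x))// ler_pM2l// lerDl.
apply: lt_le_trans (total_mass_le_W_dyn (single_node 0) (single_node k^-1) tpsi psib psi'b b0).
rewrite !Rintegral_two_diracs// eqxx ord_max_neq0 /= psi0 psiK lte_fin.
have -> : k * (B + 1) = 6^-1.
  by rewrite /k invfM -mulrA mulVf ?mulr1// gt_eqF// ltr_wpDl.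
by rewrite !mul0r !mul1r; lra.
Qed.

(* [eta] separates the two atoms of [split_pair]; testing a lift against it shows
   that [r] is almost surely 0 or 1, here through [(1 - 2 r) eta <= (1 - r)^2]. *)
Lemma D_static_pair_ge1 : (1 <= D_static q amean split_pair (single_node (0 : R)))%E.
Proof.
apply: le_ereal_inf_tmp => _ [lam1 [lam2 [l1 l2 ->]]].
have bcst : bounded_fun (cst 1 : R -> R).
  by exists 1; split => // b /ltW b1 x _; apply: le_trans b1; rewrite /= normr1.
(* The slope 50 is 1 / (2 [offset]), so that eta rises from 0 to 1 exactly between the two atoms. *)
pose eta (x : R) := clip (50 * x + 2^-1).
have ceta : continuous eta.
  move=> x; apply: (@continuous_comp _ _ _ (fun x : R => 50 * x + 2^-1) clip).
    by apply: cvgD; [apply: cvgM; [exact: cvg_cst|exact: cvg_id]|exact: cvg_cst].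
  exact: continuous_clip.
have beta : bounded_fun eta.
  by exists 1; split => // b /ltW b1 x _; exact: le_trans (clip_norm _) b1.
have meta := continuous_measurableT ceta.
have etaN : eta (- offset) = 0 by apply: clip_le0; rewrite /offset; lra.
have etaP : eta offset = 1 by apply: clip_ge1; rewrite /offset; lra.
have mc : measurable_fun [set: RR] (fun z : RR => 1 - clip z.2).
  by apply: measurable_funB => //; exact: measurableT_comp measurable_clip (@measurable_snd _ _ _ _).
have b01 (z : RR) : 0 <= 1 - clip z.2 <= 1 by have /andP[h0 h1] := clip01 z.2; apply/andP; split; lra.
apply: W_lifted_ge1.
  have E0 := lift_of_clip ord0 l1 ceta beta.
  have E1 := lift_of_clip ord_max l1 ceta beta.
  rewrite !Rintegral_two_diracs// ?eqxx ?ord_max_neq0 in E0 E1.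
  rewrite etaN mulr0 in E0; rewrite etaP mulr1 in E1.
  have ib i : lam1.-integrable setT (EFin \o (fun z : RR => simplex_param (clip z.2) i * eta z.1)).
    apply: (@bounded_integrable _ _ _ lam1 _ 1); first exact: measurable_lift_test.
    move=> z; rewrite normrM mulr_ile1//; last exact: clip_norm.
    have /andP[h0 h1] := clip01 z.2.
    by rewrite /simplex_param; case: ifP => _; rewrite ger0_norm; lra.
  have -> : 2^-1 = \int[lam1]_z (simplex_param (clip z.2) ord_max * eta z.1 -
      simplex_param (clip z.2) ord0 * eta z.1).
    by rewrite RintegralB// -E0 -E1 subr0.
  apply: le_Rintegral => //.
  - have := integrableB measurableT (ib ord_max) (ib ord0).
    by apply: eq_integrable.
  - apply: (@bounded_integrable _ _ _ lam1 _ 1); first exact: measurable_funX.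
    by move=> z; have /andP[h0 h1] := b01 z; rewrite normrX expr_le1// ger0_norm.
  move=> z _; rewrite /simplex_param eqxx ord_max_neq0.
  have /andP[h0 h1] := clip01 z.2; have /andP[h2 h3] : 0 <= eta z.1 <= 1 by exact: clip01.
  move: (clip z.2) (eta z.1) h0 h1 h2 h3 => r e r0 r1 e0 e1.
  (* Since 1 - 2 r = (1 - r)^2 - r^2, the difference is the convex combination of (1 - r)^2 and r^2
     with weights 1 - e and e. *)
  rewrite -subr_ge0 (_ : _ - _ = (1 - r) ^+ 2 * (1 - e) + e * r ^+ 2); last by ring.
  by rewrite addr_ge0// mulr_ge0 ?sqr_ge0// subr_ge0.
(* [single_node 0] has no mass on node 2; testing its lift with the constant 1 shows that 1 - r
   integrates to 0. *)
have E := lift_of_clip ord_max l2 (fun x => cvg_cst _) bcst.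
rewrite Rintegral_two_diracs// ord_max_neq0 /= mul0r in E.
by rewrite E; apply: eq_Rintegral => z _; rewrite /simplex_param ord_max_neq0 mulr1.
Qed.

Lemma W_2W_pair_origin : (W_2W q amean split_pair split_origin <= (offset : R)%:E)%E.
Proof.
have -> : (offset : R)%:E = sqrte (offset ^+ 2)%:E.
  by rewrite /= sqrtr_sqr ger0_norm// /offset invr_ge0.
pose z : RR * RR := ((- offset, 1), (0, 1)); pose w : RR * RR := ((offset, 0), (0, 0)).
have half : (2^-1%:nng : {nonneg R})%:num + (2^-1%:nng : {nonneg R})%:num = 1 :> R.
  by change (2^-1 + 2^-1 = 1 :> R); lra.
apply: le_trans (@W_lifted_le R _ _ (2^-1)%:nng (2^-1)%:nng z w half _ _ _ _ _ _) _;
  rewrite /z /w /= ?lexx ?ler01//.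
- by move=> A mA; rewrite canonical_two_diracs.
- by move=> A mA; rewrite canonical_two_diracs.
rewrite lee_fin ler_sqrt ?sqr_ge0// /atom_cost /=.
by rewrite !expr2; lra.
Qed.

(** Two atoms at the same point x are also represented by a single atom at the intermediate height
    r, which is closer to the ends of the interval than these are to each other. *)
Lemma lift_of_two_diracs (r s : {nonneg R}) (rs : r%:num + s%:num = 1) (x : R) :
  lift_of (two_diracs rs x x) (\d_((x, r%:num) : RR)).
Proof.
split.
  change (\d_((x, r%:num) : RR) (@strip R) = 1%E :> \bar R); rewrite diracE mem_set//=.
  by rewrite /strip/= ge0/= -rs lerDl.
move=> eta i ceta _; have meta := continuous_measurableT ceta.
rewrite Rintegral_two_diracs// /Rintegral integral_dirac//.
  by rewrite diracT mul1e /= /simplex_param -[X in X - _]rs addrC addKr; case: ifP.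
apply/measurable_EFinP; apply: measurable_funM.
  exact: measurableT_comp (measurable_simplex_param i) (@measurable_snd _ _ _ _).
exact: measurableT_comp meta (@measurable_fst _ _ _ _).
Qed.

Lemma D_static_origin : (D_static q amean split_origin (single_node (0 : R)) <= sqrte (2^-1)%:E)%E.
Proof.
pose z : RR * RR := ((0, 2^-1), (0, 1)).
have one0 : (1%:nng : {nonneg R})%:num + (0%:nng : {nonneg R})%:num = 1 :> R by rewrite addr0.
apply: ge_ereal_inf; eexists.
  exists \d_((0, 2^-1) : RR), \d_((0, 1) : RR).
  by split; [exact: lift_of_two_diracs|exact: lift_of_two_diracs|reflexivity].
apply: le_trans (@W_lifted_le R _ _ 1%:nng 0%:nng z z one0 _ _ _ _ _ _) _;
  rewrite /z /= ?lexx ?ler01//.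
- by move=> A mA; rewrite mul1e mul0e adde0.
- by move=> A mA; rewrite mul1e mul0e adde0.
- lra.
- lra.
rewrite lee_fin ler_sqrt ?invr_ge0// /atom_cost /=.
by rewrite !expr2; lra.
Qed.

(** The canonical lifting keeps half of the mass at r = 0, so (1 - r)^2 integrates to 1/2 although
    the two atoms share their position. *)
Lemma W_2W_origin_ge1 : (1 <= W_2W q amean split_origin (single_node (0 : R)))%E.
Proof.
have mc : measurable_fun [set: RR] (fun z : RR => 1 - clip z.2).
  by apply: measurable_funB => //; exact: measurableT_comp measurable_clip (@measurable_snd _ _ _ _).
have b1 (z : RR) : `|1 - clip z.2| <= 1.
  by have /andP[a0 a1] := clip01 z.2; rewrite ger0_norm; lra.
have c1 : clip 1 = 1 :> R by rewrite clip_ge1.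
have c0 : clip 0 = 0 :> R by rewrite clip_le0.
apply: (@W_lifted_ge1 R (canonical_prob split_origin) (canonical_prob (single_node 0))).
  rewrite (@Rintegral_canonical_two_diracs _ _ _ 1 _ _ _); [|exact: measurable_funX|]; last first.
    by move=> z; rewrite normrX expr_le1.
  by rewrite /= c1 c0 !expr2; lra.
rewrite (@Rintegral_canonical_two_diracs _ _ _ 1 _ _ _)//.
by rewrite /= c1 c0; lra.
Qed.

Lemma sharp_of_equality (A B : vprob R 2 -> vprob R 2 -> \bar R) (mu nu : vprob R 2) (s : R) :
  (forall m1 m2, A m1 m2 <= B m1 m2)%E -> P2 mu -> P2 nu -> 0 < s ->
  A mu nu = s%:E -> B mu nu = s%:E -> sharp_inequality 1 A B.
Proof.
move=> AB p1 p2 s0 As Bs; split => [m1 m2 _ _|c' H]; first by rewrite mul1e.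
have := H mu nu p1 p2; rewrite As Bs -EFinM lee_fin.
by rewrite -[leRHS]mul1r ler_pM2r.
Qed.

End extremal_pairs.

Theorem proposition1p6 (R : realType) :
  let q : 'I_2 -> 'I_2 -> R := two_node_weight in
  let Q : R := max_degree q in
  let c : R := Num.min 1 (Num.sqrt Q)^-1 in
  exists theta : R -> R -> R,
    interpolation_function theta /\
    ((sharp_inequality c d_BL (W_dyn q theta) /\
      strict_somewhere c d_BL (W_dyn q theta)) /\
     (sharp_inequality 1 (W_dyn q theta) (D_static q theta) /\
      strict_somewhere 1 (W_dyn q theta) (D_static q theta)) /\
     (sharp_inequality 1 (D_static q theta) (W_2W q theta) /\
      strict_somewhere 1 (D_static q theta) (W_2W q theta))) /\
    ~ triangle_inequality (D_static q theta).
Proof.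
move=> q Q c; exists amean; split; first exact: interpolation_amean.
have -> : c = 1 by rewrite /c /Q max_degree_two_node sqrtr1 invr1 minxx.
pose mu0 : vprob R 2 := single_node 0; pose nu0 : vprob R 2 := other_node.
have h1 := d_BL_le_W_dyn mu0 nu0; have h2 := W_dyn_le_D_static mu0 nu0.
have h3 := D_static_le_W_2W mu0 nu0; have h0 := d_BL_nodes (R := R).
have h4 := W_2W_nodes (R := R).
have s2 : sqrte 2%:E = (Num.sqrt 2)%:E :> \bar R by [].
rewrite s2 in h0 h4; set s := Num.sqrt 2 in s2 h0 h4.
have s0 : 0 < s by rewrite sqrtr_gt0.
have eBL : d_BL mu0 nu0 = s%:E.
  by apply/eqP; rewrite eq_le h0 (le_trans h1 (le_trans h2 (le_trans h3 h4))).
have eW : W_dyn q amean mu0 nu0 = s%:E.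
  by apply/eqP; rewrite eq_le (le_trans h0 h1) (le_trans h2 (le_trans h3 h4)).
have eD : D_static q amean mu0 nu0 = s%:E.
  by apply/eqP; rewrite eq_le (le_trans h0 (le_trans h1 h2)) (le_trans h3 h4).
have e2 : W_2W q amean mu0 nu0 = s%:E.
  by apply/eqP; rewrite eq_le (le_trans h0 (le_trans h1 (le_trans h2 h3))) h4.
have p1 : P2 mu0 by exact: P2_two_diracs.
have p2 : P2 nu0 by exact: P2_two_diracs.
have p3 : P2 (split_pair (R := R)) by exact: P2_two_diracs.
have p4 : P2 (split_origin (R := R)) by exact: P2_two_diracs.
have lt1 (x : R) : x < 1 -> (sqrte x%:E < 1)%E.
  by move=> x1; rewrite /= lte_fin -[ltRHS]sqrtr1 ltr_sqrt.
split; last first.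
  move=> T; have := T split_pair split_origin mu0 p3 p4 p1.
  move/(le_trans D_static_pair_ge1).
  move/le_trans => /(_ _ (leeD (le_trans (D_static_le_W_2W _ _) W_2W_pair_origin) D_static_origin)).
  have -> : sqrte (2^-1)%:E = (Num.sqrt 2^-1)%:E :> \bar R by [].
  have h20 : 0 <= 2^-1 :> R by rewrite invr_ge0.
  rewrite -EFinD lee_fin /offset; have := sqr_sqrtr h20; have := sqrtr_ge0 (2^-1 : R).
  (* The triangle inequality would give 1 <= 1/100 + y with y^2 = 1/2, hence y >= 99/100,
     contradicting (99/100)^2 > 1/2. *)
  move: (Num.sqrt 2^-1) => y y0 yy le1.
  have : (99 / 100) ^+ 2 <= y ^+ 2 by rewrite lerXn2r ?nnegrE//; lra.
  by rewrite yy expr2; lra.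
split; last split.
- split; first exact: (sharp_of_equality d_BL_le_W_dyn p1 p2 s0).
  have [K far] := W_dyn_far (R := R); exists mu0, (single_node K); split => //.
    exact: P2_two_diracs.
  by rewrite mul1e; exact: le_lt_trans (d_BL_single_le K) far.
- split; first exact: (sharp_of_equality W_dyn_le_D_static p1 p2 s0).
  exists split_pair, mu0; split => //.
  rewrite mul1e; apply: lt_le_trans D_static_pair_ge1.
  by apply: le_lt_trans W_dyn_merge (lt1 _ _); lra.
- split; first exact: (sharp_of_equality D_static_le_W_2W p1 p2 s0).
  exists split_origin, mu0; split => //.
  rewrite mul1e; apply: lt_le_trans W_2W_origin_ge1.
  by apply: le_lt_trans D_static_origin (lt1 _ _); lra.
Qed.
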